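(* Let $d\in\{2,3\}$, $\Omega=\prod_{i=1}^d[-X_i,X_i)$ with periodic boundary conditions, $\epsilon>0$, $\gamma>0$, $M>0$, $\omega\in(0,1)$, $T>0$, $N\ge 1$ an integer, $\tau=T/N$. Let $\phi^0\in H^1_{\mathrm{per}}(\Omega)$ be given, let $\kappa,\beta$ be real constants, and let $\phi^1,\dots,\phi^N$ be the $\Omega$-periodic functions determined successively by the linear semi-implicit scheme, for $0\le n\le N-1$, $$ \begin{aligned} \frac{\phi^{n+1}-\phi^n}{\tau} =\ & \epsilon\Delta\phi^{n+1}-\frac{\kappa}{\epsilon}\phi^{n+1}-\gamma\beta(-\Delta)^{-1}(\phi^{n+1}-\omega)+\frac1\epsilon\big[\kappa\phi^n-W'(\phi^n)\big]\\ &+\gamma\Big[\beta(-\Delta)^{-1}(\phi^n-\omega)-\big((-\Delta)^{-1}(f(\phi^n)-\omega)\big)f'(\phi^n)\Big]-M\Big[\int_\Omega f(\phi^n)\,dx-\omega|\Omega|\Big]f'(\phi^n). \end{aligned} $$ Suppose that $$ \kappa\ \ge\ \frac{L_W}{2}+\epsilon\left(\frac{\gamma L_f}{2}\,\|(-\Delta)^{-1}\|_{L^\infty}\max\{\omega,1-\omega\}+\frac M2|\Omega|\big(L_p^2+L_f\max\{\omega,1-\omega\}\big)\right),\qquad \beta\ \ge\ \frac{L_p^2}{2}. $$ Then the scheme is energy stable: for every $0\le n\le N-1$, $$E[\phi^{n+1}]\le E[\phi^n],$$ where $$E[\phi]=\int_\Omega\Big[\frac\epsilon2|\nabla\phi|^2+\frac1\epsilon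 W(\phi)\Big]dx+\frac\gamma2\int_\Omega\Big|(-\Delta)^{-\frac12}(f(\phi)-\omega)\Big|^2dx+\frac M2\Big(\int_\Omega f(\phi)\,dx-\omega|\Omega|\Big)^2 .$$
   Context: $H^s_{\mathrm{per}}(\Omega)$ is the space of $\Omega$-periodic functions in $H^s(\Omega)$; all functions are real-valued. Nonlinearities. $f:\mathbb R\to\mathbb R$ is $f(s)=0$ for $s<0$, $f(s)=6s^5-15s^4+10s^3$ for $0\le s\le1$, $f(s)=1$ for $s>1$ (a $C^2$ function). $W:\mathbb R\to\mathbb R$ is the quadratically extended double well: for a fixed $M_{\mathrm{cut}}>0$, $W(s)=18(s^2-s)^2$ for $|s|\le M_{\mathrm{cut}}$, and for $s>M_{\mathrm{cut}}$ (resp. $s<-M_{\mathrm{cut}}$) $W$ is the second-order Taylor polynomial of $18(s^2-s)^2$ at $M_{\mathrm{cut}}$ (resp. $-M_{\mathrm{cut}}$), so $W\in C^2$ has bounded second derivative. $L_W$ and $L_f$ are upper bounds: $|W''(s)|\le L_W$ and $|f''(s)|\le L_f$ for all $s\in\mathbb R$; $L_p$ is a Lipschitz constant of $f$. Inverse Laplacian. For $g\in L^2_{\mathrm{per}}(\Omega)$, $(-\Delta)^{-1}g$ is the unique periodic function $u$ with zero mean such that $-\Delta u=g-\frac1{|\Omega|}\int_\Omega g\,dx$ (i.e. the zero-th Fourier mode of $g$ is removed). $(-\Delta)^{-1/2}$ is its nonnegative self-adjoint square root, so $\|(-\Delta)^{-1/2}g\|_{L^2}^2=\langle(-\Delta)^{-1}g,g\rangle_{L^2}$.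 $\|(-\Delta)^{-1}\|_{L^\infty}$ is the operator norm of $(-\Delta)^{-1}$ from $L^\infty_{\mathrm{per}}(\Omega)$ to itself. For each $n$ the scheme determines $\phi^{n+1}$ uniquely, since under the conditions on $\kappa,\beta$ the operator $(\frac1\tau+\frac\kappa\epsilon)I-\epsilon\Delta+\gamma\beta(-\Delta)^{-1}$ has only positive eigenvalues. *)

(* Defs.v *)
From HB Require Import structures.
From mathcomp Require Import all_boot all_order all_algebra.
From mathcomp Require Import all_classical all_reals all_analysis.

Set Implicit Arguments.
Unset Strict Implicit.
Unset Printing Implicit Defensive.
Import Order.TTheory GRing.Theory Num.Theory.
Import numFieldNormedType.Exports.

Local Open Scope classical_set_scope.
Local Open Scope ring_scope.

(* MathComp-Analysis provides the product sigma-algebra on [n.-tuple T] but not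
   on row vectors; derivatives need the normed space ['rV[R]_n], so it is given
   the sigma-algebra generated by its coordinates, i.e. the Borel one. *)
Section measurable_row.
Context {d : measure_display} {T : sigmaRingType d}.
Variable n : nat.

Let coord : 'I_n -> 'rV[T]_n -> T := fun i x => x ord0 i.

Let row_set0 : g_sigma_preimage coord set0.
Proof. exact: sigma_algebra0. Qed.

Let row_setC A : g_sigma_preimage coord A -> g_sigma_preimage coord (~` A).
Proof. exact: sigma_algebraC. Qed.

Let row_bigcup (F : (set 'rV[T]_n)^nat) :
  (forall i, g_sigma_preimage coord (F i)) ->
  g_sigma_preimage coord (\bigcup_i (F i)).
Proof. exact: sigma_algebra_bigcup. Qed.

HB.instance Definition _ := @isMeasurable.Build (measure_tuple_display d)
  'rV[T]_n (g_sigma_preimage coord) row_set0 row_setC row_bigcup.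

End measurable_row.

Lemma measurable_fun_row d1 d2 (T1 : measurableType d1) (T2 : measurableType d2)
    n (f : T1 -> 'rV[T2]_n) :
  (forall i, measurable_fun [set: T1] (fun x => f x ord0 i)) ->
  measurable_fun [set: T1] f.
Proof.
move=> mf _ A mA; rewrite setTI.
pose G : set (set 'rV[T2]_n) := \big[setU/set0]_(i < n)
  preimage_set_system setT (fun x : 'rV[T2]_n => x ord0 i) measurable.
pose H : set (set 'rV[T2]_n) := [set B | measurable (f @^-1` B)].
suff GH : <<s G >> `<=` H by exact: GH.
apply: smallest_sub.
  split; rewrite /H/=.
  - by rewrite preimage_set0; exact: measurable0.
  - move=> B mB; rewrite setTD -preimage_setC; exact: measurableC.
  - by move=> F mF; rewrite preimage_bigcup; exact: bigcupT_measurable.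
rewrite /G -bigcup_seq => B [i _] [C mC <-].
rewrite /H/= setTI -[X in measurable X]setTI -comp_preimage.
exact: mf.
Qed.

Lemma measurable_row_coord d (T : sigmaRingType d) n (i : 'I_n) :
  measurable_fun [set: 'rV[T]_n] (fun x : 'rV[T]_n => x ord0 i).
Proof.
move=> _ Y mY; rewrite setTI; apply: sub_sigma_algebra => /=.
rewrite -bigcup_seq/=; exists i => /=; first by rewrite mem_index_enum.
by exists Y => //; rewrite setTI.
Qed.

Section lebesgue_row.
Context {R : realType}.

Definition row_rcons n (p : 'rV[measurableTypeR R]_n * measurableTypeR R) :
    'rV[measurableTypeR R]_n.+1 :=
  \row_(i < n.+1) oapp (fun j => p.1 ord0 j) p.2 (unlift ord_max i).

Lemma measurable_row_rcons n : measurable_fun setT (@row_rcons n).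
Proof.
apply: measurable_fun_row => i.
apply: (eq_measurable_fun (fun p : 'rV[measurableTypeR R]_n * measurableTypeR R =>
  oapp (fun j => p.1 ord0 j) p.2 (unlift ord_max i))).
  by move=> p _; rewrite mxE.
case: unliftP => [j _|_] /=; last exact: measurable_snd.
apply: (@measurableT_comp _ _ _ _ _ _ (fun x : 'rV[measurableTypeR R]_n => x ord0 j)) => //.
exact: measurable_row_coord.
Qed.

Section leb_rcons.
Variables (n : nat) (mu : {measure set 'rV[measurableTypeR R]_n -> \bar R}).

Definition leb_rcons : set 'rV[measurableTypeR R]_n.+1 -> \bar R :=
  pushforward (mu \x @lebesgue_measure R)%E (@row_rcons n).

Let mf := @measurable_row_rcons n.

Let leb_rcons0 : leb_rcons set0 = 0%E.
Proof. exact: measure0. Qed.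

Let leb_rcons_ge0 A : (0 <= leb_rcons A)%E.
Proof. exact: measure_ge0. Qed.

Let leb_rcons_sigma_additive : semi_sigma_additive leb_rcons.
Proof. exact: measure_semi_sigma_additive. Qed.

HB.instance Definition _ := isMeasure.Build _ _ _
  leb_rcons leb_rcons0 leb_rcons_ge0 leb_rcons_sigma_additive.

End leb_rcons.

Fixpoint leb (n : nat) : {measure set 'rV[measurableTypeR R]_n -> \bar R} :=
  if n is m.+1 then leb_rcons (leb m)
  else @dirac _ 'rV[measurableTypeR R]_0 (0 : 'rV[R]_0) R.

End lebesgue_row.

Section periodic_box.
Context {R : realType} {d : nat}.
Variable X : 'I_d -> R.
Local Notation V := 'rV[R]_d.
Local Notation mu := (@leb R d).

Definition box : set V := [set x | forall i, x ord0 i \in `[- X i, X i[].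

Definition vol : R := fine (mu box).

Definition periodic (u : V -> R) : Prop :=
  forall x i, u (x + (2 * X i) *: delta_mx ord0 i) = u x.

Definition partial (i : 'I_d) (u : V -> R) : V -> R :=
  fun x => 'D_(delta_mx ord0 i) u x.

Definition partials (s : seq 'I_d) (u : V -> R) : V -> R := foldr partial u s.

(* All iterated partial derivatives exist and are continuous. *)
Definition smooth (u : V -> R) : Prop := forall s : seq 'I_d,
  continuous (partials s u) /\
  forall i x, derivable (partials s u) x (delta_mx ord0 i).

Definition smooth_per (u : V -> R) : Prop := smooth u /\ periodic u.

Definition ae_eq_box (u v : V -> R) : Prop :=
  {ae mu, forall x, box x -> u x = v x}.

Definition inner (u v : V -> R) : R := \int[mu]_(x in box) (u x * v x).

Definition mean (u : V -> R) : R := (\int[mu]_(x in box) u x) / vol.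

Definition L2per (u : V -> R) : Prop :=
  [/\ measurable_fun [set: V] u, periodic u &
      (\int[mu]_(x in box) ((u x) ^+ 2)%:E < +oo)%E].

(* The function is set to 0 outside the box, so this is the essential supremum
   of |u| over one period. *)
Definition Linf_norm (u : V -> R) : \bar R :=
  'N[mu]_(+oo)[(EFin \o u) \_ box]%E.

Definition Linfper (u : V -> R) : Prop :=
  [/\ measurable_fun [set: V] u, periodic u & (Linf_norm u < +oo)%E].

(* H^1 of the torus is the completion of the smooth periodic functions for the
   H^1 norm: [g] is the gradient of [u] when smooth periodic functions converge
   to [u] in L^2(box) while their gradients converge to [g] in L^2(box).
   Derivatives are taken across the faces of the box, so a jump of the periodic
   extension there excludes [u]. *)
Definition is_grad (u : V -> R) (g : 'I_d -> V -> R) : Prop :=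
  [/\ L2per u, forall i, L2per (g i) &
      exists psi : nat -> V -> R,
        [/\ forall k, smooth_per (psi k),
            inner (psi k \- u) (psi k \- u) @[k --> \oo] --> 0 &
            forall i, inner (partial i (psi k) \- g i)
                            (partial i (psi k) \- g i) @[k --> \oo] --> 0]].

Definition H1per (u : V -> R) : Prop := exists g, is_grad u g.

(* As for [invlap] and [invlap_half] below, the value is determined up to a null
   set when it exists, and [xget] selects a representative. *)
Definition grad (u : V -> R) : 'I_d -> V -> R :=
  xget (fun _ _ => 0) [set g | is_grad u g].

(* [w] is the weak Laplacian of [u], an L^2 function; for [u] in [H1per] such a
   [w] exists exactly when [u] is in the periodic H^2 space. *)
Definition is_laplacian (u w : V -> R) : Prop :=
  [/\ H1per u, L2per w & forall psi, smooth_per psi ->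
      \int[mu]_(x in box) (\sum_(i < d) grad u i x * partial i psi x) =
      - inner w psi].

Definition is_invlap (g u : V -> R) : Prop :=
  is_laplacian u (fun x => - (g x - mean g)) /\ mean u = 0.

Definition invlap (g : V -> R) : V -> R :=
  xget (fun=> 0) [set u | is_invlap g u].

(* Linearity and boundedness are not listed because they follow: an everywhere
   defined symmetric operator on a Hilbert space is linear and bounded. *)
Definition is_nonneg_sqrt (A B : (V -> R) -> V -> R) : Prop :=
  [/\ forall g, L2per g -> L2per (B g),
      forall g h, L2per g -> L2per h -> inner (B g) h = inner g (B h),
      forall g, L2per g -> 0 <= inner (B g) g &
      forall g, L2per g -> ae_eq_box (B (B g)) (A g)].

Definition invlap_half : (V -> R) -> V -> R :=
  xget (fun g => g : V -> R) [set B | is_nonneg_sqrt invlap B].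

Definition invlap_Linf_norm : \bar R :=
  ereal_sup [set Linf_norm (invlap g) |
    g in [set g | Linfper g /\ (Linf_norm g <= 1)%E]].

End periodic_box.

Section nonlinearities.
Context {R : realType}.

Definition fphase (s : R) : R :=
  if s < 0 then 0
  else if s <= 1 then 6 * s ^+ 5 - 15 * s ^+ 4 + 10 * s ^+ 3
  else 1.

Definition double_well (s : R) : R := 18 * (s ^+ 2 - s) ^+ 2.

Definition taylor2 (g : R -> R) (a s : R) : R :=
  g a + derive1 g a * (s - a) + derive1n 2 g a / 2 * (s - a) ^+ 2.

Definition Wcut (Mcut s : R) : R :=
  if `|s| <= Mcut then double_well s
  else if Mcut < s then taylor2 double_well Mcut s
  else taylor2 double_well (- Mcut) s.

End nonlinearities.

Section ohta_kawasaki.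
Context {R : realType} {d : nat}.
Variable X : 'I_d -> R.
Variables (eps gamma M omega Mcut : R).
Local Notation V := 'rV[R]_d.
Local Notation mu := (@leb R d).

Definition volume_defect (u : V -> R) : R :=
  (\int[mu]_(x in box X) fphase (u x)) - omega * vol X.

Definition energy (u : V -> R) : R :=
  \int[mu]_(x in box X)
    (eps / 2 * (\sum_(i < d) (grad X u i x) ^+ 2) + eps^-1 * Wcut Mcut (u x))
  + gamma / 2 * \int[mu]_(x in box X)
      (`|invlap_half X (fun y => fphase (u y) - omega) x| ^+ 2)
  + M / 2 * volume_defect u ^+ 2.

(* [v] is the solution at the next time level when [u] is the current one. *)
Definition scheme_step (tau kappa beta : R) (u v : V -> R) : Prop :=
  exists2 lap_v : V -> R, is_laplacian X v lap_v &
    {ae mu, forall x, box X x ->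
      (v x - u x) / tau =
        eps * lap_v x - kappa / eps * v x
        - gamma * beta * invlap X (fun y => v y - omega) x
        + eps^-1 * (kappa * u x - derive1 (Wcut Mcut) (u x))
        + gamma * (beta * invlap X (fun y => u y - omega) x
                   - invlap X (fun y => fphase (u y) - omega) x
                     * derive1 fphase (u x))
        - M * volume_defect u * derive1 fphase (u x)}.

End ohta_kawasaki.

(* Main.v *)
Require Import Defs.
From mathcomp Require Import all_boot all_order all_algebra.
From mathcomp Require Import all_classical all_reals all_analysis.
From mathcomp Require Import measurable_realfun ess_sup_inf ring lra.

(* Write A = (-Delta)^-1, u = phi^n, v = phi^(n+1), dl = v - u. Testing the scheme with
   dl turns energy decay into four increment bounds, each absorbed by the stabilising
   terms: Taylor's formula for the double well and for the volume defect, convexity of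
   the Dirichlet energy, and a second-order bound for the nonlocal energy
   Phi(t) = 1/2 <A f(u + t dl), f(u + t dl)>.

   The last one is not obtained from |A^(1/2) (f(v) - f(u))| <= L_p |A^(1/2) (v - u)|, which
   fails in general because A^(1/2) does not commute with multiplications. Instead
   Phi'' <= ||A||_oo (L_f / 2) |dl|^2 + L_p^2 <A dl, dl>, as follows. The part of Phi'' carrying f''
   is at most (||A||_oo / 2) int |f''| dl^2, since A kills constants and |f - 1/2| <= 1/2. With
   z = f'(u + t dl) dl, max f' = 15/8 <= L_p and 5/6 the value of f' where |f''| is maximal,
   <A z, z> - (15/8)^2 <A dl, dl> <= (81/65) <A x, x> for x = z - (5/6) dl, because the
   difference is a square; and <A x, x> <= ||A||_oo |x|^2. The weights add up thanks to the
   scalar inequality |f''| / 2 + (81/65) (f' - 5/6)^2 <= max |f''| / 2. As dl is only in L^2,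
   the bound on Phi'' is used through finite differences, whose errors vanish by dominated
   convergence.

   A exists by Riesz representation on mean-free gradients and the Poincare inequality;
   its square root is c^(1/2) (1 - Y), Y being the limit of Y <- ((1 - A/c) + Y^2) / 2. *)

Set Implicit Arguments.
Unset Strict Implicit.
Unset Printing Implicit Defensive.
Import Order.TTheory GRing.Theory Num.Theory.
Import numFieldNormedType.Exports.
Local Open Scope classical_set_scope.
Local Open Scope ring_scope.

(** Functions that agree almost everywhere are not identified, and [invlap] selects a
    representative, so [L2per] carries only a semi-inner product and A is linear only after pairing.
    Operators are therefore handled through symmetry alone, which already makes <A x, y> linear in
    x.

    The number 5/6 is forced by the splitting: where |f''| reaches its maximum, the f'' part of
    Phi'' already uses the whole budget max |f''| / 2, so the extra square must vanish there, which
    means that dl is multiplied by the value of f' at that point.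

    The bound <A x, x> <= ||A||_oo |x|^2 passes from L^oo to L^2 without interpolation: for bounded
    x the L^oo bound limits the growth of <A^k x, x> in k, and for a symmetric nonnegative operator
    this growth rate controls <A x, x> / |x|^2.

    ||A||_oo is an extended real whose finiteness is not proved from the geometry of the box. It is
    read off from the condition on kappa, where it stands with a positive coefficient below a real
    number. *)

Lemma cvg_le_dist {R : realType} (a b : nat -> R) (l : R) :
  (forall n, `|a n - l| <= b n) -> b @ \oo --> 0 -> a @ \oo --> l.
Proof.
move=> ab b0; apply/cvgrPdist_le => e e0.
have [N _ hN] := (cvgrPdist_le _ _).1 b0 _ e0.
exists N => // n Nn; rewrite distrC; apply: le_trans (ab n) _.
by apply: le_trans (ler_norm _) _; have := hN n Nn; rewrite sub0r normrN.
Qed.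

Lemma cvg0_le {R : realType} (b : nat -> R) (e : R) : 0 < e ->
  b @ \oo --> 0 -> exists N, forall n, (N <= n)%N -> b n <= e.
Proof.
move=> e0 b0; have [N _ hN] := (cvgrPdist_le _ _).1 b0 _ e0.
exists N => n Nn; apply: le_trans (ler_norm _) _.
by have := hN n Nn; rewrite sub0r normrN.
Qed.

Lemma cvg_seq_le {R : realType} (a b : nat -> R) (la lb : R) :
  (forall n, a n <= b n) -> a @ \oo --> la -> b @ \oo --> lb -> la <= lb.
Proof. by move=> ab ha hb; apply: ler_cvg_to ha hb _; exact: nearW. Qed.

Lemma cvg_seq_unique {R : realType} (a : nat -> R) (l l' : R) :
  a @ \oo --> l -> a @ \oo --> l' -> l = l'.
Proof. by move=> h h'; apply: (cvg_unique _ h h'). Qed.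

Lemma bernoulli_ineq {R : realType} (p : R) n : 0 <= p -> 1 + n%:R * p <= (1 + p) ^+ n.
Proof.
move=> p0; elim: n => [|n IH]; first by rewrite mul0r addr0 expr0.
rewrite exprS; apply: le_trans (ler_wpM2l _ IH); last by rewrite addr_ge0.
rewrite -natr1; have : 0 <= n%:R * p * p by rewrite !mulr_ge0// ler0n.
by set q := n%:R; nra.
Qed.

(** * Semi-inner product spaces *)

Section pre_hilbert.
Context {R : realType} {H : lmodType R}.
Implicit Types (P : set H) (ip : H -> H -> R).

(** The carrier is a full function space, or a product of such, and [P] selects the vectors on which
    [ip] makes sense. Definiteness is left out: for functions, [ip x x = 0] only means vanishing
    almost everywhere. *)
Record semi_inner P ip : Prop := SemiInner {
  si_mem : forall a x y, P x -> P y -> P (a *: x + y);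
  si_mem0 : P 0;
  si_sym : forall x y, P x -> P y -> ip x y = ip y x;
  si_lin : forall a x y z, P x -> P y -> P z ->
    ip (a *: x + y) z = a * ip x z + ip y z;
  si_ge0 : forall x, P x -> 0 <= ip x x }.

Definition ip_cauchy ip (u : nat -> H) := forall e : R, 0 < e ->
  exists N, forall m n, (N <= m)%N -> (N <= n)%N ->
    ip (u m - u n) (u m - u n) <= e.

Definition ip_lim ip (u : nat -> H) (l : H) := forall e : R, 0 < e ->
  exists N, forall n, (N <= n)%N -> ip (u n - l) (u n - l) <= e.

Definition ip_complete P ip := forall u, (forall n, P (u n)) ->
  ip_cauchy ip u -> exists2 l, P l & ip_lim ip u l.

Section theory.
Variables (P : set H) (ip : H -> H -> R).
Hypothesis si : semi_inner P ip.

Let mem := si_mem si.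
Let sym := si_sym si.
Let ge0 := si_ge0 si.

Lemma si_memZ a x : P x -> P (a *: x).
Proof. by move=> Px; rewrite -[_ *: _]addr0; exact/mem/(si_mem0 si). Qed.

Lemma si_memD x y : P x -> P y -> P (x + y).
Proof. by move=> Px Py; rewrite -[x]scale1r; exact: mem. Qed.

Lemma si_memN x : P x -> P (- x).
Proof. by rewrite -scaleN1r; exact: si_memZ. Qed.

Lemma si_memB x y : P x -> P y -> P (x - y).
Proof. by move=> Px Py; apply/si_memD/si_memN. Qed.

Lemma si_Dl x y z : P x -> P y -> P z -> ip (x + y) z = ip x z + ip y z.
Proof. by move=> *; rewrite -[x]scale1r (si_lin si)// mul1r scale1r. Qed.

Lemma si_0l z : P z -> ip 0 z = 0.
Proof.
move=> Pz; have P0 := si_mem0 si.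
by have := si_Dl P0 P0 Pz; rewrite addr0 => /eqP; rewrite -subr_eq subrr eq_sym => /eqP.
Qed.

Lemma si_Zl a x z : P x -> P z -> ip (a *: x) z = a * ip x z.
Proof.
move=> Px Pz; rewrite -[_ *: _]addr0 (si_lin si)//; last exact: (si_mem0 si).
by rewrite si_0l// addr0.
Qed.

Lemma si_Nl x z : P x -> P z -> ip (- x) z = - ip x z.
Proof. by move=> Px Pz; rewrite -scaleN1r si_Zl// mulN1r. Qed.

Lemma si_Bl x y z : P x -> P y -> P z -> ip (x - y) z = ip x z - ip y z.
Proof. by move=> Px Py Pz; rewrite si_Dl ?si_Nl//; exact: si_memN. Qed.

Lemma si_Dr x y z : P x -> P y -> P z -> ip z (x + y) = ip z x + ip z y.
Proof. by move=> Px Py Pz; rewrite sym ?si_Dl//; [rewrite (sym Px Pz) (sym Py Pz)|exact: si_memD]. Qed.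

Lemma si_Zr a x z : P x -> P z -> ip z (a *: x) = a * ip z x.
Proof. by move=> Px Pz; rewrite sym ?si_Zl//; [rewrite (sym Px Pz)|exact: si_memZ]. Qed.

Lemma si_Br x y z : P x -> P y -> P z -> ip z (x - y) = ip z x - ip z y.
Proof. by move=> Px Py Pz; rewrite sym ?si_Bl//; [rewrite (sym Px Pz) (sym Py Pz)|exact: si_memB]. Qed.

Lemma si_sqD x y : P x -> P y ->
  ip (x + y) (x + y) = ip x x + 2 * ip x y + ip y y.
Proof.
move=> Px Py; have Pxy := si_memD Px Py.
by rewrite si_Dl// !si_Dr// (sym Py Px); ring.
Qed.

Lemma si_sqB x y : P x -> P y ->
  ip (x - y) (x - y) = ip x x - 2 * ip x y + ip y y.
Proof.
move=> Px Py; have Pxy := si_memB Px Py.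
by rewrite si_Bl// !si_Br// (sym Py Px); ring.
Qed.

Lemma si_sqZ a x : P x -> ip (a *: x) (a *: x) = a ^+ 2 * ip x x.
Proof. by move=> Px; rewrite si_Zl ?si_Zr//; [ring|exact: si_memZ]. Qed.

Lemma si_cauchy_schwarz x y : P x -> P y -> ip x y ^+ 2 <= ip x x * ip y y.
Proof.
move=> Px Py; have Pz a b : P (a *: x - b *: y).
  by apply: si_memB; exact: si_memZ.
have key a b : 0 <= a ^+ 2 * ip x x - 2 * a * b * ip x y + b ^+ 2 * ip y y.
  have := ge0 (Pz a b); rewrite si_sqB ?si_sqZ; try exact: si_memZ; try by [].
  rewrite si_Zl ?si_Zr//; last exact: si_memZ.
  by rewrite !mulrA.
have [x0|xn0] := eqVneq (ip x x) 0; last first.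
  have xx : 0 < ip x x by rewrite lt_neqAle eq_sym xn0 ge0.
  have := key (ip x y) (ip x x).
  rewrite (_ : _ + _ = ip x x * (ip x x * ip y y - ip x y ^+ 2)); last by ring.
  by rewrite pmulr_rge0// subr_ge0.
rewrite x0 mul0r real_leNgt ?num_real//; apply/negP => xy0.
(* A null [x] need not be zero. With these weights the nonnegative form becomes
   [- (ip x y ^+ 2 * (ip y y + 2))], a contradiction. *)
have := key (ip y y + 1) (ip x y); rewrite x0.
rewrite (_ : _ + _ = - (ip x y ^+ 2 * (ip y y + 2))); last by ring.
rewrite oppr_ge0 leNgt mulr_gt0//.
by have := ge0 Py; lra.
Qed.

Lemma si_sqrt_cs x y : P x -> P y ->
  `|ip x y| <= Num.sqrt (ip x x) * Num.sqrt (ip y y).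
Proof.
move=> Px Py; rewrite -sqrtrM ?ge0// -sqrtr_sqr ler_sqrt ?mulr_ge0 ?ge0//.
exact: si_cauchy_schwarz.
Qed.

Lemma si_null_l x y : P x -> P y -> ip x x = 0 -> ip x y = 0.
Proof.
move=> Px Py x0; have := si_cauchy_schwarz Px Py; rewrite x0 mul0r.
by move=> h; apply/eqP; rewrite -sqrf_eq0 eq_le h sqr_ge0.
Qed.

Lemma si_le_sqD x y : P x -> P y ->
  ip (x + y) (x + y) <= 2 * ip x x + 2 * ip y y.
Proof.
move=> Px Py; have := ge0 (si_memB Px Py); rewrite si_sqB// si_sqD//.
by lra.
Qed.

Lemma si_sqBC x y : P x -> P y -> ip (x - y) (x - y) = ip (y - x) (y - x).
Proof. by move=> Px Py; rewrite !si_sqB// (sym Px Py); ring. Qed.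

Definition nrm x := Num.sqrt (ip x x).

Lemma nrm_eq0 x : ip x x = 0 -> nrm x = 0.
Proof. by rewrite /nrm => ->; rewrite sqrtr0. Qed.

Lemma nrm_ge0 x : 0 <= nrm x. Proof. exact: sqrtr_ge0. Qed.

Lemma nrmE x : P x -> nrm x ^+ 2 = ip x x.
Proof. by move=> Px; rewrite sqr_sqrtr ?ge0. Qed.

Lemma nrm_cs x y : P x -> P y -> `|ip x y| <= nrm x * nrm y.
Proof. exact: si_sqrt_cs. Qed.

Lemma nrmD x y : P x -> P y -> nrm (x + y) <= nrm x + nrm y.
Proof.
move=> Px Py; rewrite -ler_sqr ?nnegrE ?addr_ge0 ?nrm_ge0//.
rewrite nrmE ?si_sqD//; last exact: si_memD.
rewrite sqrrD !nrmE// lerD2r lerD2l mulr_natl lerMn2r /=.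
exact: le_trans (ler_norm _) (nrm_cs Px Py).
Qed.

Lemma nrmBC x y : P x -> P y -> nrm (x - y) = nrm (y - x).
Proof. by move=> Px Py; rewrite /nrm si_sqBC. Qed.

Lemma nrmZ a x : P x -> nrm (a *: x) = `|a| * nrm x.
Proof.
by move=> Px; rewrite /nrm si_sqZ// sqrtrM ?sqr_ge0// sqrtr_sqr.
Qed.

Lemma nrm_triangle x y z : P x -> P y -> P z -> nrm (x - z) <= nrm (x - y) + nrm (y - z).
Proof.
move=> Px Py Pz; have -> : x - z = (x - y) + (y - z) by rewrite addrA subrK.
by apply: nrmD; apply: si_memB.
Qed.

Lemma ip_limP u l : (forall n, P (u n)) -> P l ->
  ip_lim ip u l <-> nrm (u n - l) @[n --> \oo] --> 0.
Proof.
move=> Pu Pl; have Pul n : P (u n - l) by apply: si_memB.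
split=> [h|h e e0].
  apply/cvgrPdist_le => e e0; have [N hN] := h _ (exprn_gt0 2 e0).
  exists N => // n /= Nn; rewrite sub0r normrN ger0_norm ?nrm_ge0//.
  by rewrite -ler_sqr ?nnegrE ?nrm_ge0 ?(ltW e0)// nrmE// hN.
have se0 : 0 < Num.sqrt e by rewrite sqrtr_gt0.
have [N _ hN] := (cvgrPdist_le _ _).1 h _ se0.
exists N => n Nn; have := hN n Nn; rewrite sub0r normrN ger0_norm ?nrm_ge0//.
rewrite /nrm => hh; rewrite -(@ler_sqrt _ _ e) ?hh ?ltW//.
Qed.

Lemma ip_cauchyP u : (forall n, P (u n)) ->
  (forall e : R, 0 < e -> exists N, forall m n, (N <= m)%N -> (N <= n)%N ->
    nrm (u m - u n) <= e) -> ip_cauchy ip u.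
Proof.
move=> Pu h e e0; have se0 : 0 < Num.sqrt e by rewrite sqrtr_gt0.
have [N hN] := h _ se0; exists N => m n Nm Nn.
have Pmn : P (u m - u n) by apply: si_memB.
by rewrite -nrmE// -[leRHS](sqr_sqrtr (ltW e0)) ler_sqr ?nnegrE ?nrm_ge0 ?sqrtr_ge0 ?hN.
Qed.

Lemma ip_lim_cvg u l y : (forall n, P (u n)) -> P l -> P y ->
  nrm (u n - l) @[n --> \oo] --> 0 -> ip (u n) y @[n --> \oo] --> ip l y.
Proof.
move=> Pu Pl Py h; have Pul n : P (u n - l) by apply: si_memB.
apply: (@cvg_le_dist _ _ (fun n => nrm (u n - l) * nrm y)) => [n|].
  by rewrite -si_Bl// nrm_cs.
by rewrite -[X in _ --> X](mul0r (nrm y)); apply: cvgM => //; exact: cvg_cst.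
Qed.

Lemma nrm_lim_cvg u l : (forall n, P (u n)) -> P l ->
  nrm (u n - l) @[n --> \oo] --> 0 -> nrm (u n) @[n --> \oo] --> nrm l.
Proof.
move=> Pu Pl; apply: cvg_le_dist => n.
rewrite ler_norml; apply/andP; split.
  rewrite lerNl opprB lerBlDr nrmBC// -{1}(subrK (u n) l).
  by rewrite nrmD//; apply: si_memB.
by rewrite lerBlDr -{1}(subrK l (u n)) nrmD//; apply: si_memB.
Qed.

End theory.
End pre_hilbert.

(** * Riesz representation and symmetric operators *)

Section hilbert_ops.
Context {R : realType} {H : lmodType R}.
Variables (P : set H) (ip : H -> H -> R).
Hypothesis si : semi_inner P ip.
Hypothesis cpl : ip_complete P ip.

Let ge0 := si_ge0 si.
Let D := si_memD si.
Let Z := si_memZ si.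
Let B := si_memB si.
Local Notation nrm := (nrm ip).

(** Minimisation of J(x) = |x|^2 - 2 l(x): the parallelogram law makes a minimising sequence Cauchy,
    and the vanishing first variation at its limit is the claim. *)
Lemma riesz (l : H -> R) (C : R) :
  (forall a x y, P x -> P y -> l (a *: x + y) = a * l x + l y) ->
  (forall x, P x -> `|l x| <= C * nrm x) ->
  exists2 u, P u & forall v, P v -> ip u v = l v.
Proof.
move=> llin lC.
have l0 : l 0 = 0.
  by have := llin 1 0 0 (si_mem0 si) (si_mem0 si); rewrite scaler0 addr0 mul1r; lra.
have lZ a x : P x -> l (a *: x) = a * l x.
  by move=> Px; rewrite -[_ *: _]addr0 llin ?l0 ?addr0//; exact: (si_mem0 si).
have lD x y : P x -> P y -> l (x + y) = l x + l y.
  by move=> Px Py; rewrite -[x]scale1r llin// mul1r scale1r.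
pose J x := ip x x - 2 * l x.
pose S := [set J x | x in P].
have JC x : P x -> - C ^+ 2 <= J x.
  move=> Px; have := lC x Px; have := nrmE si Px; have := nrm_ge0 ip x.
  rewrite /J => n0 <- /ler_normlP[_ lx].
  have : 0 <= (nrm x - C) ^+ 2 by exact: sqr_ge0.
  by rewrite sqrrB; lra.
have hS : has_inf S.
  split; first by exists (J 0), 0 => //; exact: (si_mem0 si).
  by exists (- C ^+ 2) => _ [x Px <-]; exact: JC.
have infJ x : P x -> inf S <= J x.
  by move=> Px; apply: ge_inf; [case: hS|exists x].
have /choice[x /all_and2[Px xJ]] : forall n : nat, exists x, P x /\ J x < inf S + n.+1%:R^-1.
  move=> n; have e0 : 0 < n.+1%:R^-1 :> R by rewrite invr_gt0 ltr0n.
  by have [_ [x Px <-] ?] := inf_adherent e0 hS; exists x.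
have [u Pu ulim] : exists2 u, P u & ip_lim ip x u.
  apply: cpl => // e e0.
  (* The identity |x_m - x_n|^2 = 2 J(x_m) + 2 J(x_n) - 4 J((x_m + x_n) / 2) bounds the distance by
     twice the sum of the two excesses over [inf S], hence the quarter. *)
  have e4 : 0 < e / 4 by rewrite divr_gt0.
  have [N half2] := cvg0_le e4 (@cvg_harmonic R).
  exists N => m n Nm Nn.
  have := infJ _ (Z 2^-1 (D (Px m) (Px n))); rewrite /J lZ; last exact: D.
  rewrite lD// (si_sqZ si); last exact: D.
  rewrite (_ : 2^-1 ^+ 2 = 4^-1); last by field.
  rewrite (si_sqD si (Px m) (Px n)) (si_sqB si (Px m) (Px n)).
  have := xJ m; have := xJ n; rewrite /J => h1 h2.
  have := half2 _ Nm; have := half2 _ Nn; rewrite /=.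
  set q1 := (m.+1%:R^-1); set q2 := (n.+1%:R^-1). move: h1 h2; rewrite -/q1 -/q2. lra.
exists u => // v Pv.
(* J(u + t v) - J(u) >= 0, reached as a limit along [x], where the excess over the infimum is known,
   instead of by evaluating J at [u]. *)
have key t : 0 <= t * (2 * (ip u v - l v)) + t ^+ 2 * ip v v.
  have : (n.+1%:R^-1 + (t * (2 * (ip (x n) v - l v)) + t ^+ 2 * ip v v)) @[n --> \oo]
    --> 0 + (t * (2 * (ip u v - l v)) + t ^+ 2 * ip v v).
    apply: cvgD; first exact: cvg_harmonic.
    apply: cvgD; last exact: cvg_cst.
    apply: cvgMr; apply: cvgMr; apply: cvgB; last exact: cvg_cst.
    apply: (ip_lim_cvg si) => //; exact/(ip_limP si).
  rewrite add0r; apply: (@cvg_seq_le _ (fun=> 0)) => [n|]; last exact: cvg_cst.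
  have := infJ _ (D (Px n) (Z t Pv)); have := xJ n.
  rewrite /J (si_sqD si)//; last exact: Z.
  rewrite (si_sqZ si)// (si_Zr si)// lD ?lZ//; last exact: Z.
  by rewrite /=; set q := n.+1%:R^-1; lra.
have v0 := ge0 Pv; set a := ip u v - l v in key.
suff /eqP : a = 0 by rewrite subr_eq0 => /eqP.
have q0 : 0 < ip v v + 1 by lra.
(* The added 1 keeps this nearly optimal [t] defined when [v] is null. *)
have := key (- a / (ip v v + 1)).
rewrite (_ : _ + _ = - (a ^+ 2 * ((ip v v + 2) / (ip v v + 1) ^+ 2))); last by field; lra.
rewrite oppr_ge0 pmulr_lle0; last by rewrite divr_gt0 ?exprn_gt0//; lra.
by move=> a2; apply/eqP; rewrite -sqrf_eq0 eq_le a2 sqr_ge0.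
Qed.

Lemma si_eq_null x y : P x -> P y -> (forall z, P z -> ip x z = ip y z) ->
  nrm (x - y) = 0.
Proof.
by move=> Px Py h; apply: nrm_eq0; rewrite (si_Bl si) ?h ?subrr//; exact: B.
Qed.

(** Linearity is not asked for: an operator given by a choice of representatives is linear only
    modulo null vectors, and symmetry provides exactly that. *)
Definition sym_op (A : H -> H) := (forall x, P x -> P (A x)) /\
  (forall x y, P x -> P y -> ip (A x) y = ip x (A y)).

(** [A x - A y] and [A (x - y)] have the same pairing with every vector, so they differ by a null
    vector. *)
Lemma sym_opB A x y : sym_op A -> P x -> P y ->
  nrm (A x - A y) <= nrm (A (x - y)).
Proof.
move=> [PA symA] Px Py; have Pxy := B Px Py.
have P1 : P (A x - A y) by apply: B; exact: PA.
have P2 := PA _ Pxy.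
have h : nrm (A x - A y - A (x - y)) = 0.
  apply: si_eq_null => // z Pz; have PAz := PA _ Pz.
  by rewrite (si_Bl si (PA _ Px) (PA _ Py) Pz) !symA// (si_Bl si).
by have := nrmD si (B P1 P2) P2; rewrite subrK h add0r.
Qed.

Lemma sym_op_addl A x z y : sym_op A -> P x -> P z -> P y -> ip z (A y) = 0 ->
  ip (A (x + z)) y = ip (A x) y.
Proof.
move=> [PA symA] Px Pz Py z0; have PAy := PA _ Py.
rewrite (symA _ _ (si_memD si Px Pz) Py) (symA _ _ Px Py).
by rewrite (si_Dl si Px Pz PAy) z0 addr0.
Qed.

(** By symmetry the difference is <x - y, A x> + <x - y, A y>, so no expansion of A (x - y) is
    required. *)
Lemma sym_op_quad_dist A x y : sym_op A -> P x -> P y ->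
  `|ip (A x) x - ip (A y) y| <= nrm (x - y) * (nrm (A x) + nrm (A y)).
Proof.
move=> [PA symA] Px Py; have [PAx PAy Pxy] := And3 (PA _ Px) (PA _ Py) (B Px Py).
have -> : ip (A x) x - ip (A y) y = ip (x - y) (A x) + ip (x - y) (A y).
  rewrite (si_Bl si Px Py PAx) (si_Bl si Px Py PAy).
  rewrite (si_sym si Px PAx) (si_sym si Py PAx) (symA _ _ Px Py) (symA _ _ Py Py).
  by ring.
apply: le_trans (ler_normD _ _) _; rewrite mulrDr; apply: lerD; exact: (nrm_cs si).
Qed.

Lemma sym_op_form A : sym_op A -> (forall x, P x -> 0 <= ip (A x) x) ->
  semi_inner P (fun x y => ip (A x) y).
Proof.
move=> [PA symA] A0; split => //.
- exact: (si_mem si).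
- exact: (si_mem0 si).
- by move=> x y Px Py; rewrite symA// (si_sym si Px (PA _ Py)).
- move=> a x y z Px Py Pz; rewrite !symA//; last exact: (si_mem si).
  by rewrite (si_lin si)//; exact: PA.
Qed.

Lemma sym_op_iter A k : sym_op A -> sym_op (iter k A).
Proof.
move=> [PA symA]; elim: k => [|k [Pk symk]]; first by [].
split=> [x Px|x y Px Py] /=; first exact/PA/Pk.
by rewrite (symA _ _ (Pk _ Px) Py) (symk _ _ Px (PA _ Py)) -iterSr.
Qed.

(* The moments s_k = <A^k x, x> are log-convex, so their geometric growth rate
   bounds s_1 / s_0. *)
Lemma sym_op_moment_bound A x (K N : R) : sym_op A ->
  (forall y, P y -> 0 <= ip (A y) y) -> P x -> 0 <= N ->
  (forall k, ip (iter k A x) x <= K * N ^+ k) -> ip (A x) x <= N * ip x x.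
Proof.
move=> sA A0 Px N0 growth.
pose s k := ip (iter k A x) x.
have s2 k : s k ^+ 2 <= s 0%N * s (k + k)%N.
  have [Pk symk] := sym_op_iter k sA.
  rewrite /s iterD (symk _ _ (Pk _ Px) Px) mulrC.
  exact: (si_cauchy_schwarz si (Pk _ Px) Px).
have s0 : 0 <= s 0%N := ge0 Px.
have s1 : 0 <= s 1%N := A0 _ Px.
change (s 1%N <= N * s 0%N).
have [s00|s0n] := eqVneq (s 0%N) 0.
  by have := s2 1%N; rewrite s00 mulr0 mul0r => h; nra.
have s0p : 0 < s 0%N by rewrite lt_neqAle eq_sym s0n.
have [N00|Nn0] := eqVneq N 0.
  have := growth 2%N; rewrite N00 expr0n mulr0 mul0r -/(s 2%N) => h2.
  by have := s2 1%N; nra.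
have Np : 0 < N by rewrite lt_neqAle eq_sym Nn0.
rewrite leNgt; apply/negP => lt1.
pose q := s 1%N / s 0%N.
have Nq : N < q by rewrite ltr_pdivlMr.
have q0 : 0 <= q by rewrite divr_ge0.
(* Log-convexity is used at doubled indices only: s_k^2 <= s_0 s_(2k) squares the ratio at each
   step. *)
have pow j : q ^+ (2 ^ j) <= s (2 ^ j)%N / s 0%N.
  elim: j => [|j IH]; first by rewrite expr1.
  rewrite expnS mulnC exprM mulnC.
  apply: le_trans (_ : (s (2 ^ j)%N / s 0%N) ^+ 2 <= _).
    by rewrite ler_sqr// nnegrE ?exprn_ge0// (le_trans _ IH)// exprn_ge0.
  rewrite expr_div_n ler_pdivrMr ?exprn_gt0// mul2n -addnn.
  by rewrite (le_trans (s2 _))// expr2 mulrA divfK// mulrC.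
have p0 : 0 < q / N - 1 by rewrite subr_gt0 ltr_pdivlMr ?mul1r.
(* For [N < q], Bernoulli gives 2^j (q / N - 1) <= (q / N)^(2^j) <= K / s_0, so all integers j would
   be bounded. *)
have bound j : j%:R <= K / s 0%N / (q / N - 1).
  rewrite ler_pdivlMr//; apply: le_trans (_ : (q / N) ^+ (2 ^ j) <= _).
    apply: le_trans (_ : 1 + (2 ^ j)%:R * (q / N - 1) <= _); last first.
      by have := @bernoulli_ineq _ (q / N - 1) (2 ^ j) (ltW p0); rewrite subrKC.
    apply: le_trans (_ : (2 ^ j)%:R * (q / N - 1) <= _); last by rewrite lerDr.
    by rewrite ler_pM2r// ler_nat ltnW// ltn_expl.
  rewrite expr_div_n ler_pdivrMr ?exprn_gt0//; apply: le_trans (pow j) _.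
  by rewrite mulrAC ler_pM2r ?invr_gt0// growth.
by have := bound (Num.truncn (K / s 0%N / (q / N - 1))).+1; rewrite leNgt truncnS_gt.
Qed.

(** Cauchy-Schwarz for the form <A ., .> at x and A x: |A x|^4 <= <A x, x> <A A x, A x> <= <A x, x>
    c |A x|^2. *)
Lemma sym_op_sq_le A c x : sym_op A -> (forall x, P x -> 0 <= ip (A x) x) ->
  0 <= c -> (forall x, P x -> ip (A x) x <= c * ip x x) -> P x ->
  ip (A x) (A x) <= c * ip (A x) x.
Proof.
move=> sA A0 c0 Ac Px; have [PA symA] := sA; have PAx := PA _ Px.
have := si_cauchy_schwarz (sym_op_form sA A0) Px PAx.
rewrite /=; set a := ip (A x) (A x).
have a0 : 0 <= a := ge0 PAx.
move=> cs; have := Ac _ PAx; rewrite -/a => h.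
have [->|an] := eqVneq a 0; first by rewrite mulr_ge0// A0.
have ap : 0 < a by rewrite lt_neqAle eq_sym an.
rewrite -(ler_pM2r ap) -expr2; apply: le_trans cs _.
by rewrite (mulrC c) -mulrA ler_wpM2l ?A0.
Qed.

(** * Square root of a bounded nonnegative operator *)

Section sqrt_op.
Variables (A : H -> H) (c : R).
Hypothesis sA : sym_op A.
Hypothesis A0 : forall x, P x -> 0 <= ip (A x) x.
Hypothesis c0 : 0 < c.
Hypothesis Ac : forall x, P x -> ip (A x) x <= c * ip x x.

Let PA := sA.1.
Let symA := sA.2.

Let T x := x - c^-1 *: A x.

Let PT x : P x -> P (T x).
Proof. by move=> Px; apply: B => //; apply: Z; exact: PA. Qed.

Let symT : sym_op T.
Proof.
split=> // x y Px Py.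
have [PAx PAy] := (PA Px, PA Py).
rewrite /T (si_Bl si Px (Z _ PAx) Py) (si_Br si Py (Z _ PAy) Px).
by rewrite (si_Zl si _ PAx Py) (si_Zr si _ PAy Px) symA.
Qed.

(** In the expansion of |T x|^2 the term |A x|^2 / c^2 is at most <A x, x> / c, which leaves at most
    |x|^2 - <A x, x> / c. *)
Let T_le x : P x -> nrm (T x) <= nrm x.
Proof.
move=> Px; rewrite -ler_sqr ?nnegrE ?nrm_ge0// !(nrmE si)//; last exact: PT.
have PAx := PA Px.
rewrite /T (si_sqB si)//; last exact: Z.
rewrite (si_sqZ si)// (si_Zr si)//.
have := sym_op_sq_le sA A0 (ltW c0) Ac Px; rewrite (si_sym si Px PAx) => h.
have : c^-1 ^+ 2 * ip (A x) (A x) <= c^-1 * ip (A x) x.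
  rewrite exprS expr1 -mulrA ler_pM2l ?invr_gt0//.
  by rewrite mulrC ler_pdivrMr// mulrC.
have : 0 <= c^-1 * ip (A x) x by rewrite mulr_ge0 ?invr_ge0 ?A0// ltW.
by lra.
Qed.

Fixpoint sqrt_iter (n : nat) (x : H) : H :=
  if n is m.+1 then 2^-1 *: (T x + sqrt_iter m (sqrt_iter m x)) else 0.

(** Scalar majorant: the same recursion with the contraction [T] replaced by 1. It is nondecreasing
    and bounded by 1, and its convergence makes the operator iterates Cauchy. *)
Fixpoint sqrt_bound (n : nat) : R :=
  if n is m.+1 then 2^-1 * (1 + sqrt_bound m ^+ 2) else 0.

Let Y := sqrt_iter.
Let t := sqrt_bound.

Let t01 n : 0 <= t n <= 1.
Proof.
by elim: n => [|n /andP[h1 h2]] /=; rewrite ?lexx ?ler01//; apply/andP; split; nra.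
Qed.

Let t_ge0 n : 0 <= t n. Proof. by have /andP[] := t01 n. Qed.

Let tE n : t n.+1 = 2^-1 * (1 + t n ^+ 2). Proof. by []. Qed.

Let tS n : t n <= t n.+1.
Proof. by rewrite /=; have := sqr_ge0 (t n - 1); rewrite -/t; nra. Qed.

Let YS n x : Y n.+1 x = 2^-1 *: (T x + Y n (Y n x)). Proof. by []. Qed.

Let symY n : sym_op (Y n).
Proof.
elim: n => [|n [PY sY]].
  split=> [x Px|x y Px Py] /=; first exact: (si_mem0 si).
  by rewrite (si_0l si)// (si_sym si) ?(si_0l si)//; exact: (si_mem0 si).
have PTY x : P x -> P (T x + Y n (Y n x)) by move=> Px; apply: D; [exact: PT|exact/PY/PY].
split=> [x Px|x y Px Py] /=; first by apply: Z; exact: PTY.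
rewrite (si_Zl si _ (PTY _ Px) Py) (si_Zr si _ (PTY _ Py) Px).
have [P1 P2] := (PY _ Px, PY _ Py).
rewrite (si_Dl si (PT Px) (PY _ P1) Py) (si_Dr si (PT Py) (PY _ P2) Px).
by rewrite symT.2// !sY.
Qed.

Let PY n x : P x -> P (Y n x). Proof. exact: (symY n).1. Qed.

Let Y_le n x : P x -> nrm (Y n x) <= t n * nrm x.
Proof.
elim: n x => [|n IH] x Px /=.
  by rewrite mul0r (nrm_eq0 (si_0l si (si_mem0 si))).
rewrite (nrmZ si); last by apply: D; [exact: PT|exact/PY/PY].
rewrite ger0_norm// -mulrA ler_pM2l// mulrDl mul1r.
apply: le_trans (nrmD si (PT Px) (PY _ (PY _ Px))) _; apply: lerD; first exact: T_le.
apply: le_trans (IH _ (PY _ Px)) _.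
by rewrite expr2 -mulrA ler_wpM2l ?IH.
Qed.

Let Y_step n x : P x -> nrm (Y n.+1 x - Y n x) <= (t n.+1 - t n) * nrm x.
Proof.
elim: n x => [|n IH] x Px.
  rewrite [Y 0%N _]/= subr0 [t 0%N]/= subr0; exact: Y_le.
have PY1 := PY n.+1 Px; have PY0 := PY n Px.
(* The splitting Y' Y' - Y Y = (Y' - Y) Y' + Y (Y' - Y) avoids commuting the iterates and mirrors
   the increment of [t ^+ 2]. *)
have -> : Y n.+2 x - Y n.+1 x =
    2^-1 *: ((Y n.+1 (Y n.+1 x) - Y n (Y n.+1 x)) + (Y n (Y n.+1 x) - Y n (Y n x))).
  by rewrite subrKA (YS n.+1 x) [X in _ - X = _](YS n x) -scalerBr opprD addrACA subrr add0r.
have P1 : P (Y n.+1 (Y n.+1 x) - Y n (Y n.+1 x)) by apply: B; exact: PY.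
have P2 : P (Y n (Y n.+1 x) - Y n (Y n x)) by apply: B; exact: PY.
rewrite (nrmZ si) ?ger0_norm//; last exact: D.
apply: le_trans (_ : 2^-1 * ((t n.+1 - t n) * (t n.+1 * nrm x) + t n * ((t n.+1 - t n) * nrm x)) <= _).
  rewrite ler_pM2l//; apply: le_trans (nrmD si P1 P2) _; apply: lerD.
    apply: le_trans (IH _ PY1) _; rewrite ler_wpM2l ?subr_ge0 ?tS//; exact: Y_le.
  apply: le_trans (sym_opB (symY n) PY1 PY0) _.
  apply: le_trans (Y_le _ (B PY1 PY0)) _; rewrite ler_wpM2l//; exact: IH.
have -> : t n.+2 - t n.+1 = 2^-1 * (t n.+1 ^+ 2 - t n ^+ 2).
  by rewrite (tE n.+1) [X in _ - X = _](tE n); ring.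
by rewrite le_eqVlt; apply/orP; left; apply/eqP; ring.
Qed.

Let Y_dist m n x : (n <= m)%N -> P x -> nrm (Y m x - Y n x) <= (t m - t n) * nrm x.
Proof.
move=> nm Px; rewrite -(subnK nm); elim: (m - n)%N => [|k IH].
  by rewrite add0n !subrr mul0r (nrm_eq0 (si_0l si (si_mem0 si))).
apply: le_trans (nrm_triangle si (PY (k.+1 + n)%N Px) (PY (k + n)%N Px) (PY n Px)) _.
rewrite addSn; apply: le_trans (lerD (Y_step _ Px) IH) _.
by rewrite -mulrDl subrKA.
Qed.

(** The limit of the iterates is chosen vector by vector in the seminorm, so [C (C x)] and [A x] are
    compared only after pairing. *)
Lemma exists_sqrt_op : exists2 C, sym_op C & (forall x, P x -> 0 <= ip (C x) x) /\
  forall x y, P x -> P y -> ip (C (C x)) y = ip (A x) y.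
Proof.
have t_cvg : cvgn t.
  apply: nondecreasing_is_cvgn; last by exists 1 => _ [n _ <-]; have /andP[] := t01 n.
  by apply/nondecreasing_seqP.
have Y_lim x : P x -> exists2 l, P l & nrm (Y n x - l) @[n --> \oo] --> 0.
  move=> Px; have [l Pl hl] : exists2 l, P l & ip_lim ip (Y ^~ x) l.
    apply: cpl => [n|]; first exact: PY.
    apply: (ip_cauchyP si) => [n|e e0]; first exact: PY.
    have e1 : 0 < e / (nrm x + 1) by rewrite divr_gt0// ltr_wpDl ?nrm_ge0.
    have tl : (limn t - t n) @[n --> \oo] --> 0.
      by rewrite -[X in _ --> X](subrr (limn t)); apply: cvgB => //; exact: cvg_cst.
    have [N hN] := cvg0_le e1 tl.
    have t_lim n : t n <= limn t by apply: nondecreasing_cvgn_le => //; apply/nondecreasing_seqP.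
    have wl m n : (N <= n)%N -> (n <= m)%N -> nrm (Y m x - Y n x) <= e.
      move=> Nn nm; apply: le_trans (Y_dist nm Px) _.
      have h : t m - t n <= e / (nrm x + 1) by apply: le_trans (hN _ Nn); rewrite lerD2r.
      apply: le_trans (_ : e / (nrm x + 1) * (nrm x + 1) <= _); last by rewrite divfK// gt_eqF// ltr_wpDl ?nrm_ge0.
      apply: ler_pM => //; rewrite ?nrm_ge0 ?lerDl//.
      by rewrite subr_ge0; move/nondecreasing_seqP : tS => /(_ _ _ nm).
    exists N => m n Nm Nn; have [nm|mn] := leqP n m; first exact: wl.
    by rewrite (nrmBC si) ?wl//; [exact: ltnW|exact: PY..].
  by exists l => //; apply/(ip_limP si) => // n; exact: PY.
have /choice[Yo YoP] : forall x, exists l, P x -> P l /\ nrm (Y n x - l) @[n --> \oo] --> 0.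
  move=> x; have [Px|nPx] := pselect (P x); last by exists 0.
  by have [l Pl hl] := Y_lim _ Px; exists l.
have PYo x : P x -> P (Yo x) by move=> /YoP[].
have Ylim x y : P x -> P y -> ip (Y n x) y @[n --> \oo] --> ip (Yo x) y.
  by move=> Px Py; apply: (ip_lim_cvg si) (YoP _ Px).2 => // [n|]; [exact: PY|exact: PYo].
have symYo : sym_op Yo.
  split=> // x y Px Py; apply: cvg_seq_unique (Ylim _ _ Px Py) _.
  rewrite (si_sym si Px (PYo _ Py)).
  rewrite (_ : (fun n => _) = (fun n => ip (Y n y) x)); first exact: Ylim.
  by apply/funext => n; rewrite (symY _).2// (si_sym si Px (PY _ Py)).
have Yo_le x : P x -> nrm (Yo x) <= nrm x.
  move=> Px; apply: (@cvg_seq_le _ (fun n => nrm (Y n x)) (fun=> nrm x)) => [n||]; last exact: cvg_cst.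
    apply: le_trans (Y_le _ Px) _; rewrite -[leRHS]mul1r ler_wpM2r ?nrm_ge0//.
    by have /andP[] := t01 n.
  by apply: (nrm_lim_cvg si) (YoP _ Px).2 => // [n|]; [exact: PY|exact: PYo].
(* Weak limit of the recursion. Since <Y_n Y_n x, y> = <Y_n x, Y_n y>, convergence at the two fixed
   vectors [x] and [y] is enough. *)
have Yfix x y : P x -> P y -> ip (Yo x) y = 2^-1 * (ip (T x) y + ip (Yo (Yo x)) y).
  move=> Px Py.
  have h1 : ip (Y n.+1 x) y @[n --> \oo] --> ip (Yo x) y.
    by rewrite (@cvg_shiftS _ (fun n => ip (Y n x) y)); exact: Ylim.
  apply: cvg_seq_unique h1 _.
  rewrite (_ : (fun n => _) = (fun n => 2^-1 * (ip (T x) y + ip (Y n (Y n x)) y))); last first.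
    apply/funext => n; rewrite YS (si_Zl si)//; last by apply: D; [exact: PT|exact/PY/PY].
    by rewrite (si_Dl si (PT Px) (PY _ (PY _ Px)) Py).
  apply: cvgMr; apply: cvgD; first exact: cvg_cst.
  have PYx := PYo _ Px.
  rewrite (symYo.2 _ _ PYx Py).
  apply: (@cvg_le_dist _ _ (fun n => nrm (Y n x - Yo x) * nrm y + nrm x * nrm (Y n y - Yo y))) => [n|].
    rewrite ((symY n).2 _ _ (PY n Px) Py).
    have [P1 P2 P3 P4] : [/\ P (Y n x), P (Yo x), P (Y n y) & P (Yo y)] by split; [exact: PY|exact: PYo|exact: PY|exact: PYo].
    rewrite (_ : _ - _ = ip (Y n x - Yo x) (Y n y) + ip (Yo x) (Y n y - Yo y)); last first.
      by rewrite (si_Bl si)// (si_Br si)//; ring.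
    apply: le_trans (ler_normD _ _) _; apply: lerD.
      apply: le_trans (nrm_cs si (B P1 P2) P3) _; rewrite ler_wpM2l ?nrm_ge0//.
      apply: le_trans (Y_le n Py) _; rewrite -[leRHS]mul1r ler_wpM2r ?nrm_ge0//.
      by have /andP[] := t01 n.
    apply: le_trans (nrm_cs si P2 (B P3 P4)) _; rewrite ler_wpM2r ?nrm_ge0//.
    exact: Yo_le.
  rewrite [X in _ --> X](_ : _ = 0 * nrm y + nrm x * 0); last by rewrite mul0r mulr0 addr0.
  apply: cvgD; first by apply: cvgM; [exact: (YoP _ Px).2|exact: cvg_cst].
  by apply: cvgM; [exact: cvg_cst|exact: (YoP _ Py).2].
pose s := Num.sqrt c.
have P1 x : P x -> P (x - Yo x) by move=> Px; apply: B => //; exact: PYo.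
have symC : sym_op (fun x => s *: (x - Yo x)).
  split=> [x Px|x y Px Py]; first exact/Z/P1.
  rewrite (si_Zl si _ (P1 _ Px) Py) (si_Zr si _ (P1 _ Py) Px).
  by rewrite (si_Bl si Px (PYo _ Px) Py) (si_Br si Py (PYo _ Py) Px) symYo.2.
exists (fun x => s *: (x - Yo x)) => //; split=> [x Px|x y Px Py].
  rewrite (si_Zl si _ (P1 _ Px) Px) mulr_ge0 ?sqrtr_ge0//.
  rewrite (si_Bl si Px (PYo _ Px) Px) subr_ge0 (le_trans (ler_norm _))//.
  apply: le_trans (nrm_cs si (PYo _ Px) Px) _.
  by rewrite -(nrmE si Px) expr2 ler_wpM2r ?nrm_ge0// Yo_le.
have PYx := PYo _ Px; have PYy := PYo _ Py; have PAx := PA Px.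
rewrite (symC.2 _ _ (symC.1 _ Px) Py).
rewrite (si_Zl si _ (P1 _ Px) (Z _ (P1 _ Py))) (si_Zr si _ (P1 _ Py) (P1 _ Px)).
rewrite mulrA -expr2 sqr_sqrtr ?ltW//.
rewrite (si_Bl si Px PYx (P1 _ Py)) (si_Br si Py PYy Px) (si_Br si Py PYy PYx).
rewrite -(symYo.2 _ _ Px Py) -(symYo.2 _ _ PYx Py).
have := Yfix _ _ Px Py; rewrite /T (si_Bl si Px (Z _ PAx) Py) (si_Zl si _ PAx Py).
set a := ip (Yo x) y; set b := ip (Yo (Yo x)) y => ab.
have -> : b = 2 * a - (ip x y - c^-1 * ip (A x) y) by rewrite ab; field; rewrite gt_eqF.
by field; rewrite gt_eqF.
Qed.

End sqrt_op.
End hilbert_ops.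

(** * Square-integrable functions *)

Section square_integrable.
Context {d} {T : measurableType d} {R : realType}.
Variables (mu : {measure set T -> \bar R}) (D : set T).
Hypothesis mD : measurable D.
Hypothesis muD : (mu D < +oo)%E.
Implicit Types u v w f g : T -> R.

Definition intg f := mu.-integrable D (EFin \o f).

Definition sqint u := measurable_fun [set: T] u /\
  (\int[mu]_(x in D) ((u x) ^+ 2)%:E < +oo)%E.

Definition inn u v : R := \int[mu]_(x in D) (u x * v x).

Lemma intgD f g : intg f -> intg g -> intg (fun x => f x + g x).
Proof. by move=> i1 i2; exact: (integrableD mD i1 i2). Qed.

Lemma intgB f g : intg f -> intg g -> intg (fun x => f x - g x).
Proof. by move=> i1 i2; exact: (integrableB mD i1 i2). Qed.

Lemma intgZ (k : R) f : intg f -> intg (fun x => k * f x).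
Proof. by move=> intf; exact: (integrableZl mD k intf). Qed.

Lemma intg_cst (k : R) : intg (fun=> k).
Proof.
apply: measurable_bounded_integrable => //; exists `|k|; split; rewrite ?num_real//.
by move=> x kx y _ /=; exact: ltW.
Qed.

Lemma intg_sum (I : Type) (s : seq I) (F : I -> T -> R) : (forall i, intg (F i)) ->
  intg (fun x => \sum_(i <- s) F i x).
Proof.
move=> h; elim: s => [|i s IH].
  by under eq_fun do rewrite big_nil; exact: intg_cst.
by under eq_fun do rewrite big_cons; exact: intgD.
Qed.

Lemma le_intg f g : measurable_fun [set: T] f -> (forall x, D x -> `|f x| <= g x) ->
  intg g -> intg f.
Proof.
move=> mf fg ig; apply: (@le_integrable _ _ _ _ _ mD _ (EFin \o g)) => //.
  by apply/measurable_EFinP; exact: measurable_funTS.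
by move=> x Dx /=; rewrite lee_fin (le_trans (fg _ Dx))// ler_norm.
Qed.

Lemma sqintP u : sqint u <-> measurable_fun [set: T] u /\ intg (fun x => u x ^+ 2).
Proof.
have E : (\int[mu]_(x in D) `|((u x) ^+ 2)%:E| = \int[mu]_(x in D) ((u x) ^+ 2)%:E)%E.
  by apply: eq_integral => x _; rewrite gee0_abs// lee_fin sqr_ge0.
split=> -[mf h]; split=> //.
  apply/integrableP; split; last by rewrite E.
  by apply/measurable_EFinP/measurable_funX; exact: measurable_funTS.
by have /integrableP[_] := h; rewrite E.
Qed.

Lemma sqint_mf u : sqint u -> measurable_fun [set: T] u. Proof. by case. Qed.

Lemma sqint_sq u : sqint u -> intg (fun x => u x ^+ 2). Proof. by move/sqintP => []. Qed.

Lemma sqint_mul u v : sqint u -> sqint v -> intg (fun x => u x * v x).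
Proof.
move=> su sv; apply: (@le_intg _ (fun x => u x ^+ 2 + v x ^+ 2)).
- by apply: measurable_funM; apply: sqint_mf.
- by move=> x _; rewrite ler_norml; apply/andP; split; nra.
- by apply: intgD; exact: sqint_sq.
Qed.

Lemma le_sqint u g : measurable_fun [set: T] u -> (forall x, D x -> `|u x| <= g x) ->
  sqint g -> sqint u.
Proof.
move=> mfu ug sg; apply/sqintP; split=> //.
apply: (@le_intg _ (fun x => g x ^+ 2)); [exact: measurable_funX| |exact: sqint_sq].
move=> x Dx; rewrite normrX ler_sqr ?nnegrE ?ug//.
by apply: le_trans (ug _ Dx).
Qed.

Lemma sqint_cst k : sqint (fun=> k).
Proof. by apply/sqintP; split=> //; exact: intg_cst. Qed.

Lemma sqint_lin (a : R) u v : sqint u -> sqint v -> sqint (fun x => a * u x + v x).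
Proof.
move=> su sv; have mf : measurable_fun [set: T] (fun x => a * u x + v x).
  by apply: measurable_funD; [apply: measurable_funM => //|]; exact: sqint_mf.
apply/sqintP; split=> //.
apply: (@le_intg _ (fun x => 2 * a ^+ 2 * u x ^+ 2 + 2 * v x ^+ 2)).
- exact: measurable_funX.
- move=> x _; rewrite ger0_norm ?sqr_ge0//.
  by have := sqr_ge0 (a * u x - v x); nra.
- by apply: intgD; apply: intgZ; exact: sqint_sq.
Qed.

Lemma sqint_add u v : sqint u -> sqint v -> sqint (fun x => u x + v x).
Proof.
move=> su sv; rewrite (_ : (fun x => _) = fun x => 1 * u x + v x); first exact: sqint_lin.
by apply/funext => x; rewrite mul1r.
Qed.

Lemma sqint_scale k u : sqint u -> sqint (fun x => k * u x).
Proof.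
move=> su; rewrite (_ : (fun x => _) = fun x => k * u x + 0); last first.
  by apply/funext => x; rewrite addr0.
by apply: sqint_lin => //; exact: sqint_cst.
Qed.

Lemma sqint_sub u v : sqint u -> sqint v -> sqint (fun x => u x - v x).
Proof.
move=> su sv; rewrite (_ : (fun x => _) = fun x => -1 * v x + u x); first exact: sqint_lin.
by apply/funext => x; rewrite mulN1r addrC.
Qed.

Lemma sqint_abs u : sqint u -> sqint (fun x => `|u x|).
Proof.
move=> su; apply/sqintP; split.
  exact: measurableT_comp (sqint_mf su).
rewrite (_ : (fun x => _) = fun x => u x ^+ 2); first exact: sqint_sq.
by apply/funext => x; rewrite real_normK ?num_real.
Qed.

Lemma sqint_intg u : sqint u -> intg u.
Proof.
move=> su; rewrite (_ : u = fun x => 1 * u x).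
  by apply: sqint_mul => //; exact: sqint_cst.
by apply/funext => x; rewrite mul1r.
Qed.

Lemma sqint_bnd u K : measurable_fun [set: T] u -> (forall x, D x -> `|u x| <= K) -> sqint u.
Proof. by move=> mf uK; exact: le_sqint mf uK (sqint_cst K). Qed.

Lemma sqint_bndM u v K : measurable_fun [set: T] u -> (forall x, D x -> `|u x| <= K) ->
  sqint v -> sqint (fun x => u x * v x).
Proof.
move=> mf uK sv; apply: (@le_sqint _ (fun x => K * `|v x|)).
- by apply: measurable_funM => //; exact: sqint_mf.
- by move=> x Dx; rewrite normrM ler_wpM2r ?uK.
- by apply: sqint_scale; exact: sqint_abs.
Qed.

Lemma inn_semi : @semi_inner R (T -> R) sqint inn.
Proof.
split.
- by move=> a u v su sv; exact: sqint_lin.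
- exact: sqint_cst.
- by move=> u v _ _; apply: eq_Rintegral => x _; rewrite mulrC.
- move=> a u v w su sv sw; rewrite /inn.
  rewrite -RintegralZl//; last exact: sqint_mul.
  rewrite -RintegralD//; [|by apply: intgZ; exact: sqint_mul|exact: sqint_mul].
  by apply: eq_Rintegral => x _; rewrite mulrDl mulrA.
- by move=> u su; apply: Rintegral_ge0 => x _; rewrite -expr2 sqr_ge0.
Qed.

Lemma inn_EFin u v : sqint u -> sqint v ->
  (inn u v)%:E = (\int[mu]_(x in D) (u x * v x)%:E)%E.
Proof.
move=> su sv; rewrite /inn /Rintegral fineK//.
exact: (integrable_fin_num mD (sqint_mul su sv)).
Qed.

Lemma ae_eq_inn u u' v v' : measurable_fun [set: T] u -> measurable_fun [set: T] u' ->
  measurable_fun [set: T] v -> measurable_fun [set: T] v' ->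
  ae_eq mu D u u' -> ae_eq mu D v v' -> inn u v = inn u' v'.
Proof.
move=> mu1 mu2 mv1 mv2 uu vv; rewrite /inn /Rintegral; congr fine.
have mm (a b : T -> R) : measurable_fun [set: T] a -> measurable_fun [set: T] b ->
    measurable_fun D (fun x => (a x * b x)%:E).
  by move=> ma mb; apply/measurable_EFinP; apply: measurable_funTS; exact: measurable_funM.
apply: ae_eq_integral => //; [exact: mm|exact: mm|].
near=> x => Dx.
by rewrite (near uu x)// (near vv x).
Unshelve. all: by end_near. Qed.

Lemma inn_null u : sqint u -> inn u u = 0 -> ae_eq mu D u (fun=> 0).
Proof.
move=> su u0; have := inn_EFin su su; rewrite u0 => h.
have mf : measurable_fun D (fun x => (u x * u x)%:E).
  apply/measurable_EFinP; apply: measurable_funTS.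
  by apply: measurable_funM; exact: sqint_mf.
have /(ae_eq_integral_abs mu mD mf) h2 : (\int[mu]_(x in D) `|(u x * u x)%:E| = 0)%E.
  transitivity (\int[mu]_(x in D) (u x * u x)%:E)%E; last by rewrite -h.
  by apply: eq_integral => x _; rewrite gee0_abs// lee_fin -expr2 sqr_ge0.
near=> x => Dx; have : (u x * u x)%:E = 0%:E by exact: (near h2 x).
by case=> /eqP; rewrite mulf_eq0 orbb => /eqP.
Unshelve. all: by end_near. Qed.

Lemma null_inn u : measurable_fun [set: T] u -> ae_eq mu D u (fun=> 0) -> inn u u = 0.
Proof.
move=> mfu u0; rewrite (ae_eq_inn mfu _ mfu _ u0 u0)//.
by rewrite /inn Rintegral_cst// mulr0 mul0r.
Qed.

(** The k-th increment is at most s 2^-k, so the tail from k on is at most 2 s 2^-k. Both are kept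
    squared to match an integrated series of squares. *)
Lemma geometric_increments_cvg (v : nat -> R) (s : R) : 0 <= s ->
  (forall k, 4 ^+ k * (v k.+1 - v k) ^+ 2 <= s ^+ 2) ->
  cvgn v /\ forall k, (limn v - v k) ^+ 2 <= 4 * 4^-1 ^+ k * s ^+ 2.
Proof.
move=> s0 h.
have step k : `|v k.+1 - v k| <= s * 2^-1 ^+ k.
  rewrite -ler_sqr ?nnegrE ?mulr_ge0 ?exprn_ge0// real_normK ?num_real//.
  rewrite exprMn exprAC (_ : 2^-1 ^+ 2 = 4^-1); last by field.
  by rewrite exprVn ler_pdivlMr ?exprn_gt0// mulrC.
have dist k m : `|v (k + m)%N - v k| <= 2 * s * 2^-1 ^+ k.
  suff : `|v (k + m)%N - v k| <= 2 * s * 2^-1 ^+ k * (1 - 2^-1 ^+ m).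
    have a0 : 0 <= 2 * s * 2^-1 ^+ k by rewrite mulr_ge0 ?mulr_ge0 ?exprn_ge0.
    have b0 : 0 <= 2^-1 ^+ m :> R by rewrite exprn_ge0.
    by move=> /le_trans; apply; rewrite mulrBr mulr1 gerBl mulr_ge0.
  elim: m => [|m IH]; first by rewrite addn0 expr0 !subrr normr0 mulr0.
  rewrite addnS (_ : _ - _ = (v (k + m).+1 - v (k + m)%N) + (v (k + m)%N - v k)); last by rewrite subrKA.
  apply: le_trans (ler_normD _ _) _; apply: le_trans (lerD (step _) IH) _.
  rewrite exprD exprS le_eqVlt; apply/orP; left; apply/eqP.
  by field.
have c0 : (2 * s * 2^-1 ^+ k) @[k --> \oo] --> 0.
  rewrite -[X in _ --> X](mulr0 (2 * s)); apply: cvgMr; apply: cvg_expr.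
  by rewrite ger0_norm// invf_lt1// ltr1n.
have cv : cvgn v.
  (* Adding the tail bound makes the sequence nonincreasing, which reduces convergence to the
     monotone case. *)
  pose w k := v k + 2 * s * 2^-1 ^+ k.
  have cw : cvgn w.
    apply: nonincreasing_is_cvgn.
      apply/nonincreasing_seqP => k; rewrite /w exprS.
      by have /ler_normlP[_] := step k; lra.
    exists (v 0%N - 2 * s) => _ [k _ <-]; rewrite /w.
    have /ler_normlP[] := dist 0%N k; rewrite add0n expr0.
    have : 0 <= 2 * s * 2^-1 ^+ k by rewrite mulr_ge0 ?mulr_ge0 ?exprn_ge0.
    by lra.
  rewrite (_ : v = fun k => w k - 2 * s * 2^-1 ^+ k); last by apply/funext => k; rewrite addrK.
  by apply: is_cvgB => //; apply/cvg_ex; exists 0.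
split=> // k.
have : (limn v - v k) ^+ 2 <= (2 * s * 2^-1 ^+ k) ^+ 2.
  rewrite -real_normK ?num_real// ler_sqr ?nnegrE ?mulr_ge0 ?mulr_ge0 ?exprn_ge0//.
  apply: (@cvg_seq_le _ (fun m => `|v (k + m)%N - v k|) (fun=> 2 * s * 2^-1 ^+ k)) => //; last exact: cvg_cst.
  apply: cvg_norm; apply: cvgB; last exact: cvg_cst.
  rewrite (_ : (fun m => v (k + m)%N) = (fun m => v (m + k)%N)).
    by rewrite (@cvg_shiftn k _ v).
  by apply/funext => m; rewrite addnC.
have -> : 4^-1 ^+ k = (2^-1 ^+ k) ^+ 2 :> R.
  by rewrite exprAC; congr (_ ^+ _); field.
move=> /le_trans; apply; set q := 2^-1 ^+ k.
by rewrite le_eqVlt; apply/orP; left; apply/eqP; ring.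
Qed.

Local Notation nrm := (nrm inn).

(* Riesz-Fischer. The last clause makes limits of periodic functions periodic. *)
Lemma sqint_complete (u : nat -> T -> R) : (forall n, sqint (u n)) ->
  ip_cauchy inn u -> exists l, [/\ sqint l, ip_lim inn u l &
    forall g : T -> T, (forall n x, u n (g x) = u n x) -> forall x, l (g x) = l x].
Proof.
move=> su cu.
have /choice[N hN] : forall k : nat, exists N, forall m n, (N <= m)%N -> (N <= n)%N ->
    inn (u m - u n) (u m - u n) <= 8^-1 ^+ k.
  by move=> k; apply: cu; rewrite exprn_gt0// invr_gt0.
(* Partial sums give indices that increase, dominate [N k] and exceed [k]. *)
pose idx k := (\sum_(j < k.+1) (N j).+1)%N.
have Nidx k : (N k <= idx k)%N by rewrite /idx big_ord_recr /= (leq_trans _ (leq_addl _ _)).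
have idxS k : (idx k <= idx k.+1)%N by rewrite /idx [leqRHS]big_ord_recr leq_addr.
have idx_ge k : (k < idx k)%N.
  elim: k => [|k IH]; first by rewrite /idx big_ord_recr big_ord0.
  by rewrite /idx big_ord_recr /= addnS ltnS (leq_trans IH) ?leq_addr.
pose v k := u (idx k).
have sv k : sqint (v k) := su _.
(* The weight 4^k loses against the rate 8^-k of the subsequence, so [G] is integrable; where [G] is
   finite, the same weight forces geometric decay of the increments. *)
pose G x := (\sum_(0 <= k <oo) (4 ^+ k * (v k.+1 x - v k x) ^+ 2)%:E)%E.
have G0 k x : (0 <= (4 ^+ k * (v k.+1 x - v k x) ^+ 2)%:E)%E.
  by rewrite lee_fin mulr_ge0 ?sqr_ge0 ?exprn_ge0.
have mterm k : measurable_fun [set: T] (fun x => (4 ^+ k * (v k.+1 x - v k x) ^+ 2)%:E).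
  apply/measurable_EFinP; apply: measurable_funM => //; apply: measurable_funX.
  by apply: measurable_funB; exact: sqint_mf.
have mG : measurable_fun [set: T] G by apply: ge0_emeasurable_sum => // k x _ _; exact: G0.
have G_ge0 x : (0 <= G x)%E by apply: nneseries_ge0 => k _ _; exact: G0.
have iG : (\int[mu]_(x in D) G x < +oo)%E.
  rewrite integral_nneseries//; last by move=> k; exact: measurable_funTS.
  apply: (@le_lt_trans _ _ (\sum_(0 <= k <oo) (2^-1 ^+ k)%:E)%E).
    apply: lee_nneseries => [k _ _|k _]; first exact: integral_ge0.
    have Es : (\int[mu]_(x in D) (4 ^+ k * (v k.+1 x - v k x) ^+ 2)%:E =
       (4 ^+ k * inn (v k.+1 - v k) (v k.+1 - v k))%:E)%E.
      rewrite EFinM inn_EFin; [|exact: sqint_sub..].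
      rewrite -ge0_integralZl//.
      - apply/measurable_EFinP; apply: measurable_funTS.
        by apply: measurable_funM; apply: sqint_mf; exact: sqint_sub.
      - by move=> x _; rewrite lee_fin -expr2 sqr_ge0.

    rewrite [leLHS]Es lee_fin.
    apply: le_trans (_ : 4 ^+ k * 8^-1 ^+ k <= _).
      by rewrite ler_pM2l ?exprn_gt0// hN// (leq_trans (Nidx _)).
    by rewrite -exprMn (_ : 4 * 8^-1 = 2^-1)//; field.
  apply: (@le_lt_trans _ _ 2%:E); last exact: ltry.
  apply: lime_le; first by apply: is_cvg_nneseries => n _ _; rewrite lee_fin exprn_ge0.
  apply: nearW => n; rewrite sumEFin lee_fin.
  suff -> : \sum_(0 <= k < n) 2^-1 ^+ k = 2 - 2 * 2^-1 ^+ n :> R.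
    by rewrite gerBl mulr_ge0 ?exprn_ge0.
  elim: n => [|n IH]; first by rewrite big_geq// expr0; ring.
  by rewrite big_nat_recr//= IH exprS; field.
pose E := [set x | (G x < +oo)%E].
have mE : measurable E.
  by rewrite -[E]setTI; exact: emeasurable_fun_infty_o.
(* Setting the sequence to 0 where [G] is infinite makes the limit exist everywhere. As [E] depends
   only on the values [u n x], any transformation leaving all [u n] invariant leaves the limit
   invariant. *)
pose w k x := v k x * \1_E x.
have Gx x k : E x -> 4 ^+ k * (v k.+1 x - v k x) ^+ 2 <= fine (G x).
  move=> Ex; rewrite -lee_fin fineK ?ge0_fin_numE//.
  apply: le_trans (nneseries_lim_ge k.+1 _) => [|j _ _]; last exact: G0.
  by rewrite big_nat_recr//= leeDr// sume_ge0.
have wc x : cvgn (w ^~ x) /\ (E x -> forall k, (limn (w ^~ x) - v k x) ^+ 2 <= 4 * 4^-1 ^+ k * fine (G x)).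
  rewrite /w indicE; have [Ex|nEx] := boolP (x \in E); last first.
    split; last by move=> /mem_set; rewrite (negbTE nEx).
    by under eq_fun do rewrite mulr0; exact: is_cvg_cst.
  under eq_fun do rewrite mulr1.
  have := @geometric_increments_cvg (v ^~ x) (Num.sqrt (fine (G x))) (sqrtr_ge0 _).
  rewrite sqr_sqrtr ?fine_ge0// => h.
  have [h1 h2] := h (fun k => Gx x k (set_mem Ex)).
  by split.
pose l x := limn (w ^~ x).
have ml : measurable_fun [set: T] l.
  apply: (@measurable_fun_cvg _ _ _ _ w) => [k|x _]; last exact: (wc x).1.
  apply: measurable_funM; first exact: sqint_mf.
  exact: measurable_indic.
have IG0 : (0 <= \int[mu]_(x in D) G x)%E by apply: integral_ge0 => x _; exact: G_ge0.
pose I := fine (\int[mu]_(x in D) G x)%E.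
have IE : (\int[mu]_(x in D) G x = I%:E)%E by rewrite fineK// ge0_fin_numE.
have intG : mu.-integrable D G.
  apply/integrableP; split; first exact: measurable_funTS.
  by under eq_integral do rewrite gee0_abs//.
have lv k : sqint (fun x => l x - v k x) /\
    inn (fun x => l x - v k x) (fun x => l x - v k x) <= 4 * 4^-1 ^+ k * I.
  have c0 : 0 <= 4 * 4^-1 ^+ k :> R by rewrite mulr_ge0 ?exprn_ge0.
  have mlv : measurable_fun [set: T] (fun x => l x - v k x).
    by apply: measurable_funB => //; exact: sqint_mf.
  have le1 : (\int[mu]_(x in D) ((l x - v k x) ^+ 2)%:E <= (4 * 4^-1 ^+ k * I)%:E)%E.
    rewrite EFinM -IE -ge0_integralZl//; [|exact: measurable_funTS].
    apply: ae_ge0_le_integral => //.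
    - by move=> x _; rewrite lee_fin sqr_ge0.
    - by apply/measurable_EFinP; apply: measurable_funTS; exact: measurable_funX.
    - by move=> x _; rewrite mule_ge0.
    - by apply: measurable_funTS; exact: measurable_funeM.
    apply: filterS (integrable_ae mD intG) => x + Dx => /(_ Dx) fG.
    rewrite -(fineK fG) -EFinM lee_fin; apply: (wc x).2.
    by rewrite /E /= ltey_eq fG.
  have slv : sqint (fun x => l x - v k x).
    by split=> //; apply: le_lt_trans le1 _; exact: ltry.
  split=> //; rewrite -lee_fin inn_EFin//.
have sl : sqint l.
  rewrite (_ : l = fun x => (l x - v 0%N x) + v 0%N x); first by apply: sqint_add => //; exact: (lv _).1.
  by apply/funext => x /=; rewrite subrK.
exists l; split=> //.
  move=> e e0.
  have e4 : 0 < e / 4 by rewrite divr_gt0.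
  have [N1 hN1] := cu _ e4.
  have c0 : (4 * 4^-1 ^+ k * I) @[k --> \oo] --> 0.
    rewrite -[X in _ --> X](mul0r I); apply: cvgM; last exact: cvg_cst.
    rewrite -[X in _ --> X](mulr0 4); apply: cvgMr; apply: cvg_expr.
    by rewrite ger0_norm// invf_lt1// ltr1n.
  have [N2 hN2] := cvg0_le e4 c0.
  pose k := maxn N1 N2; have si := inn_semi.
  exists N1 => n nN1.
  have [slv hlv] := lv k.
  have su1 : sqint (u n - v k) := sqint_sub (su n) (sv k).
  have su2 : sqint (v k - l) := sqint_sub (sv k) sl.
  rewrite -(subrKA (v k) (u n) (- l)); apply: le_trans (si_le_sqD si su1 su2) _.
  have h1 : inn (u n - v k) (u n - v k) <= e / 4.
    by apply: hN1 => //; rewrite (leq_trans (leq_maxl N1 N2))// ltnW.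
  have h2 : inn (v k - l) (v k - l) <= e / 4.
    by rewrite (si_sqBC si (sv k) sl) (le_trans hlv)// hN2// leq_maxr.
  by lra.
move=> g ug x; rewrite /l; congr (limn _); apply/funext => k.
have Gg : G (g x) = G x by rewrite /G; apply: eq_eseriesr => j _; rewrite /v !ug.
rewrite /w /v ug !indicE (_ : (g x \in E) = (x \in E))//.
by apply/idP/idP; rewrite !inE /E /= Gg.
Qed.

End square_integrable.

(** * Lebesgue measure on boxes *)

Section tonelli.
Context {d1 d2} {T1 : measurableType d1} {T2 : measurableType d2} {R : realType}.
Variables (m1 : {measure set T1 -> \bar R}) (m2 : {sigma_finite_measure set T2 -> \bar R}).
Hypothesis sf1 : sigma_finite setT m1.
Variables (D1 : set T1) (D2 : set T2) (f : T1 * T2 -> \bar R).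
Hypothesis mD1 : measurable D1.
Hypothesis mD2 : measurable D2.
Hypothesis mf : measurable_fun setT f.
Hypothesis f0 : forall x, (0 <= f x)%E.
Local Open Scope ereal_scope.

(** Sigma-finiteness of [m1] is given as the proposition [sf1], as suits the recursively defined
    [leb n]; the bundled structure is assembled from it. *)
Let m1s : {sigma_finite_measure set T1 -> \bar R} :=
  SigmaFiniteMeasure.Pack (@SigmaFiniteMeasure.Class _ _ _ m1 _
    (Measure.measure_function_Content_isMeasure_mixin (Measure.class m1))
    {| isSFinite.s_finite := sfinite_measure_sigma_finite sf1 |}
    {| isSigmaFinite.sigma_finiteT := sf1 |}).

Let g := f \_ (D1 `*` D2).

Let mg : measurable_fun setT g.
Proof.
apply/(measurable_restrictT _ _).1; first exact: measurableX.
exact: measurable_funTS.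
Qed.

Let g0 x : 0 <= g x. Proof. by rewrite /g patchE; case: ifP. Qed.

Let gE x y : g (x, y) = ((fun x => ((fun y => f (x, y)) \_ D2) y) \_ D1) x.
Proof.
rewrite /g !patchE /= in_setX /=.
by case: (x \in D1); case: (y \in D2).
Qed.

Let FE x : fubini_F m2 g x = ((fun x => \int[m2]_(y in D2) f (x, y)) \_ D1) x.
Proof.
rewrite /fubini_F patchE; case: ifPn => xD.
  by rewrite [RHS]integral_mkcond; apply: eq_integral => y _; rewrite gE patchE xD.
by apply: integral0_eq => y _; rewrite gE patchE (negbTE xD).
Qed.

Let GE y : fubini_G m1 g y = ((fun y => \int[m1]_(x in D1) f (x, y)) \_ D2) y.
Proof.
rewrite /fubini_G patchE; case: ifPn => yD.
  rewrite [RHS]integral_mkcond; apply: eq_integral => x _; rewrite gE !patchE.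
  by case: ifP => // _; rewrite yD.
apply: integral0_eq => x _; rewrite gE !patchE; case: ifP => // _.
by rewrite (negbTE yD).
Qed.

Lemma tonelli_rect1 : \int[m1 \x m2]_(z in D1 `*` D2) f z =
  \int[m1]_(x in D1) \int[m2]_(y in D2) f (x, y).
Proof.
rewrite [LHS]integral_mkcond [RHS]integral_mkcond.
transitivity (\int[m1]_x fubini_F m2 g x); last by apply: eq_integral => x _; rewrite FE.
exact: (@fubini_tonelli1 _ _ _ _ _ m1s m2).
Qed.

Lemma tonelli_rect2 : \int[m1 \x m2]_(z in D1 `*` D2) f z =
  \int[m2]_(y in D2) \int[m1]_(x in D1) f (x, y).
Proof.
rewrite [LHS]integral_mkcond [RHS]integral_mkcond.
transitivity (\int[m2]_x fubini_G m1 g x); last by apply: eq_integral => x _; rewrite GE.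
exact: (@fubini_tonelli2 _ _ _ _ _ m1s m2).
Qed.

Lemma measurable_tonelli_rect2 :
  measurable_fun D2 (fun y => \int[m1]_(x in D1) f (x, y)).
Proof.
apply/(measurable_restrictT _ _).2 => //.
rewrite (_ : _ \_ _ = fubini_G m1 g); last by apply/funext => y; rewrite GE.
exact: (@measurable_fun_fubini_tonelli_G _ _ _ _ _ m1s).
Qed.

Lemma measurable_tonelli_rect1 :
  measurable_fun D1 (fun x => \int[m2]_(y in D2) f (x, y)).
Proof.
apply/(measurable_restrictT _ _).2 => //.
rewrite (_ : _ \_ _ = fubini_F m2 g); last by apply/funext => y; rewrite FE.
exact: (@measurable_fun_fubini_tonelli_F _ _ _ _ _ m2).
Qed.

End tonelli.

Section lebesgue_cuboid.
Context {R : realType}.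
Local Notation leb := (@leb R).
Local Notation lam := (@lebesgue_measure R).

Definition cuboid n (S : 'I_n -> set R) : set 'rV[R]_n :=
  [set x | forall i, S i (x ord0 i)].

Lemma measurable_cuboid n (S : 'I_n -> set R) : (forall i, measurable (S i)) ->
  measurable (cuboid S : set 'rV[measurableTypeR R]_n).
Proof.
move=> mS; rewrite (_ : cuboid S = \bigcap_(i in setT)
    ((fun x : 'rV[measurableTypeR R]_n => x ord0 i) @^-1` S i)); last first.
  by apply/seteqP; split=> x h i; [move=> _|]; exact: h.
apply: fin_bigcap_measurable => // i _.
by rewrite -[X in measurable X]setTI; exact: (@measurable_row_coord _ (measurableTypeR R) n i measurableT _ (mS i)).
Qed.

Lemma row_rcons_lift n (x : 'rV[R]_n) (t : R) j :
  row_rcons (x, t) ord0 (lift ord_max j) = x ord0 j.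
Proof. by rewrite mxE liftK. Qed.

Lemma row_rcons_max n (x : 'rV[R]_n) (t : R) : row_rcons (x, t) ord0 ord_max = t.
Proof. by rewrite mxE unlift_none. Qed.

Lemma preimage_row_rcons_cuboid n (S : 'I_n.+1 -> set R) :
  @row_rcons R n @^-1` cuboid S = cuboid (fun j => S (lift ord_max j)) `*` S ord_max.
Proof.
apply/seteqP; split=> -[x t] /=.
  move=> h; split=> [j|]; first by have := h (lift ord_max j); rewrite row_rcons_lift.
  by have := h ord_max; rewrite row_rcons_max.
move=> [hx ht] i; case: (unliftP ord_max i) => [j ->|->].
  by rewrite row_rcons_lift.
by rewrite row_rcons_max.
Qed.

Lemma leb0_cuboid (S : 'I_0 -> set R) : leb 0 (cuboid S) = 1%E.
Proof.
by rewrite /= diracE mem_set// => -[].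
Qed.

Lemma lebS_cuboid n (S : 'I_n.+1 -> set R) : (forall i, measurable (S i)) ->
  leb n.+1 (cuboid S) = (leb n (cuboid (fun j => S (lift ord_max j))) * lam (S ord_max))%E.
Proof.
move=> mS; rewrite [LHS]/= /leb_rcons /pushforward preimage_row_rcons_cuboid.
apply: product_measure1E; last exact: mS.
by apply: measurable_cuboid => j; exact: mS.
Qed.

Lemma leb_cuboid_lty n (S : 'I_n -> set R) : (forall i, measurable (S i)) ->
  (forall i, lam (S i) < +oo)%E -> (leb n (cuboid S) < +oo)%E.
Proof.
elim: n S => [|n IH] S mS fS; first by rewrite leb0_cuboid ltry.
by rewrite lebS_cuboid// lte_mul_pinfty// ?IH// ge0_fin_numE// IH.
Qed.

Lemma leb_cuboid_gt0 n (S : 'I_n -> set R) : (forall i, measurable (S i)) ->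
  (forall i, 0 < lam (S i))%E -> (0 < leb n (cuboid S))%E.
Proof.
elim: n S => [|n IH] S mS fS; first by rewrite leb0_cuboid.
by rewrite lebS_cuboid// mule_gt0// IH.
Qed.

Lemma leb_sigma_finite n : sigma_finite setT (leb n).
Proof.
exists (fun k => cuboid (fun=> `[- k%:R, k%:R]%classic)); last first.
  move=> k; split; first by apply: measurable_cuboid.
  by apply: leb_cuboid_lty => // i; rewrite lebesgue_measure_itv; case: ifP; rewrite ?ltry.
apply/seteqP; split=> // x _.
pose m := (\sum_(i < n) (Num.truncn `|x ord0 i|).+1)%N.
exists m => // i /=; rewrite in_itv /= -ler_norml.
apply: ltW; apply: lt_le_trans (truncnS_gt _) _.
by rewrite ler_nat /m (bigD1 i)//= leq_addr.
Qed.

Lemma leb_rcons_int n (D : set 'rV[R]_n.+1) (D1 : set 'rV[R]_n) (D2 : set R)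
    (f : 'rV[R]_n.+1 -> \bar R) :
  measurable (D : set 'rV[measurableTypeR R]_n.+1) ->
  @row_rcons R n @^-1` D = D1 `*` D2 ->
  measurable_fun [set: 'rV[measurableTypeR R]_n.+1] f -> (forall x, 0 <= f x)%E ->
  (\int[leb n.+1]_(x in D) f x = \int[leb n \x lam]_(z in D1 `*` D2) f (row_rcons z))%E.
Proof.
move=> mD DE mf f0; rewrite -DE /=.
have := @ge0_integral_pushforward _ _ _ _ _ _ (@measurable_row_rcons R n)
  (leb n \x lam)%E D f mD (measurable_funTS mf) (fun x _ => f0 x).
exact.
Qed.

End lebesgue_cuboid.

(** * Continuous functions on row vectors *)

Section continuous_row.
Context {R : realType} {n : nat}.
Local Notation V := 'rV[R]_n.
Local Notation MV := 'rV[measurableTypeR R]_n.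

Definition grid (k : nat) (x : V) : 'rV[int]_n := \row_i Num.floor (k.+1%:R * x ord0 i).

Definition grid_point (k : nat) (z : 'rV[int]_n) : V := \row_i ((z ord0 i)%:~R / k.+1%:R).

Lemma measurable_grid_preimage k (z : 'rV[int]_n) :
  measurable (grid k @^-1` [set z] : set MV).
Proof.
rewrite (_ : _ @^-1` _ = cuboid (fun i =>
    `[(z ord0 i)%:~R / k.+1%:R, (z ord0 i + 1)%:~R / k.+1%:R[%classic)).
  by apply: measurable_cuboid => i; exact: measurable_itv.
have floorP (t : R) (m : int) : (Num.floor (k.+1%:R * t) = m) <->
    t \in `[m%:~R / k.+1%:R, (m + 1)%:~R / k.+1%:R[.
  rewrite in_itv /= ler_pdivrMr ?ltr0n// ltr_pdivlMr ?ltr0n// (mulrC t) -floor_eq.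
  by split=> /eqP.
apply/seteqP; split=> x /=.
  by move=> xz i /=; apply/floorP; rewrite -xz mxE.
by move=> xz; apply/rowP => i; rewrite mxE; apply/floorP; exact: xz.
Qed.

Lemma measurable_grid k (P : set 'rV[int]_n) : measurable (grid k @^-1` P : set MV).
Proof.
(* Integer vectors are countable, so any set of them pulls back to a countable union of cells. *)
rewrite (_ : _ @^-1` _ = \bigcup_(j : nat) if (unpickle j : option 'rV[int]_n) is Some z
    then (if `[< P z >] then grid k @^-1` [set z] else set0) else set0); last first.
  apply/seteqP; split=> x /=.
    by move=> Px; exists (pickle (grid k x)) => //; rewrite pickleK asboolT.
  by move=> [j _]; case: unpickle => // z; case: asboolP => //= Pz ->.
apply: bigcupT_measurable => j; case: unpickle => [z|]; last exact: measurable0.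
by case: ifP => _; [exact: measurable_grid_preimage|exact: measurable0].
Qed.

Lemma grid_cvg (x : V) : grid_point k (grid k x) @[k --> \oo] --> x.
Proof.
apply/cvg_ballP => e e0.
have e2 : 0 < e / 2 by rewrite divr_gt0.
have [N hN] := cvg0_le e2 (@cvg_harmonic R).
exists N => // k /= Nk; split=> // i j; rewrite [i]ord1 !mxE /ball /=.
have k0 : 0 < k.+1%:R :> R by rewrite ltr0n.
have -> : x ord0 j - (Num.floor (k.+1%:R * x ord0 j))%:~R / k.+1%:R =
    (k.+1%:R * x ord0 j - (Num.floor (k.+1%:R * x ord0 j))%:~R) / k.+1%:R.
  by rewrite mulrBl mulrAC mulfV ?gt_eqF// mul1r.
have /andP[h1 h2] := floor_itv (k.+1%:R * x ord0 j).
rewrite ger0_norm; last by rewrite divr_ge0 ?subr_ge0// ltW.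
apply: (@le_lt_trans _ _ (e / 2)); last by rewrite ltr_pdivrMr// ltr_pMr// ltr1n.
apply: le_trans (hN _ Nk); rewrite /= ler_pdivrMr// mulVf ?gt_eqF//.
by rewrite lerBlDr addrC ltW// (lt_le_trans h2)// intrD.
Qed.

(** The sigma-algebra is generated by the coordinates rather than by open sets. So [u] is
    approximated by its values at points rounded to the grid of mesh 1/(k+1), which form
    countably-valued measurable functions. *)
Lemma continuous_measurable_row (u : V -> R) : continuous u ->
  measurable_fun [set: MV] u.
Proof.
move=> cu; apply: (@measurable_fun_cvg _ _ _ _ (fun k x => u (grid_point k (grid k x)))).
  move=> k _ B _; rewrite setTI.
  exact: (measurable_grid k ((u \o grid_point k) @^-1` B)).
move=> x _.
have h : u (grid_point k (grid k (x : V))) @[k --> \oo] --> u (x : V).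
  by apply: continuous_cvg; [exact: cu|exact: grid_cvg].
exact: h.
Qed.

(** Stated on the closed box, because compactness fails for the half-open one. *)
Lemma continuous_bounded_box (X : 'I_n -> R) (u : V -> R) : continuous u ->
  exists K : R, forall x : V, (forall i, x ord0 i \in `[- X i, X i]) -> `|u x| <= K.
Proof.
move=> cu; have cB : compact [set x : V | forall i, `[- X i, X i]%classic (x ord0 i)].
  by apply: (@rV_compact R n (fun i => `[- X i, X i]%classic)) => i; exact: segment_compact.
have /compact_bounded[M [_ hM]] : compact (u @` [set x : V | forall i, `[- X i, X i]%classic (x ord0 i)]).
  by apply: continuous_compact => //; exact: continuous_subspaceT.
exists (M + 1) => x hx; apply: (hM (M + 1)); first by rewrite ltrDl.
by exists x.
Qed.

End continuous_row.

Section box_measure.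
Context {R : realType} {n : nat}.
Variable X : 'I_n -> R.
Hypothesis X0 : forall i, 0 < X i.
Local Notation mu := (@leb R n).

Lemma boxE : box X = cuboid (fun i => `[- X i, X i[%classic).
Proof. by []. Qed.

Lemma measurable_box : measurable (box X : set 'rV[measurableTypeR R]_n).
Proof. exact: (@measurable_cuboid R n (fun i => `[- X i, X i[%classic) (fun i => measurable_itv _)). Qed.

Lemma leb_box_lty : (mu (box X) < +oo)%E.
Proof.
rewrite boxE; apply: leb_cuboid_lty => i; first exact: measurable_itv.
by rewrite lebesgue_measure_itv; case: ifP; rewrite ?ltry.
Qed.

Lemma leb_box_gt0 : (0 < mu (box X))%E.
Proof.
rewrite boxE; apply: leb_cuboid_gt0 => i; first exact: measurable_itv.
rewrite lebesgue_measure_itv /= lte_fin gtrN// -EFinD lte_fin opprK.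
by rewrite addr_gt0.
Qed.

Lemma vol_gt0 : 0 < vol X.
Proof. by rewrite /vol fine_gt0// leb_box_gt0 leb_box_lty. Qed.

Lemma volE : (vol X)%:E = mu (box X).
Proof. by rewrite /vol fineK// ge0_fin_numE// leb_box_lty. Qed.

Lemma L2perP u : L2per X u <-> (sqint mu (box X) u /\ Defs.periodic X u).
Proof.
by split; [move=> [a b c]; split=> //|move=> [[a b] c]; split].
Qed.

Lemma continuous_sqint u : continuous u -> sqint mu (box X) u.
Proof.
move=> cu; have [K hK] := continuous_bounded_box X cu.
apply: (sqint_bnd measurable_box leb_box_lty (K := K)) => [|x Bx].
  exact: continuous_measurable_row.
apply: hK => i; have := Bx i.
by rewrite !in_itv /= => /andP[-> /ltW].
Qed.

End box_measure.

(** * Smooth periodic functions *)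

Section smooth_functions.
Context {R : realType} {n : nat}.
Variable X : 'I_n -> R.
Local Notation V := 'rV[R]_n.
Implicit Types u v : V -> R.

Lemma partials_lin s (a : R) u v : smooth u -> smooth v ->
  partials s (a *: u + v) = a *: partials s u + partials s v.
Proof.
move=> su sv; elim: s => [//|i s IH] /=; rewrite IH; apply/funext => x.
have [_ du] := su s; have [_ dv] := sv s.
rewrite /partial deriveD//; last exact: derivableZ.
by rewrite deriveZ.
Qed.

Lemma smooth_lin (a : R) u v : smooth u -> smooth v -> smooth (a *: u + v).
Proof.
move=> su sv s; rewrite partials_lin//; have [cu du] := su s; have [cv dv] := sv s.
split=> [x|i x]; last by apply: derivableD => //; exact: derivableZ.
apply: continuousD; last exact: cv.
rewrite (_ : a *: partials s u = fun y => a * partials s u y)//.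
by apply: continuousM; [exact: cst_continuous|exact: cu].
Qed.

Lemma partials_cst s (c : R) : partials s (fun=> c : R^o) = (fun=> if s is [::] then c else 0) :> (V -> R).
Proof.
elim: s => [//|i s IH] /=; rewrite IH; apply/funext => x.
exact: derive_cst.
Qed.

Lemma smooth_cst (c : R) : smooth (fun _ : V => c).
Proof.
move=> s; rewrite partials_cst; split=> [|i] x; first exact: cst_continuous.
exact: derivable_cst.
Qed.

Lemma smooth_per_lin (a : R) u v : smooth_per X u -> smooth_per X v ->
  smooth_per X (a *: u + v).
Proof.
move=> [su pu] [sv pv]; split; first exact: smooth_lin.
by move=> x i /=; rewrite !fctE /= pu pv.
Qed.

Lemma smooth_per_cst (c : R) : smooth_per X (fun=> c).
Proof. by split; [exact: smooth_cst|]. Qed.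

Lemma periodic_partial i u : Defs.periodic X u -> Defs.periodic X (partial i u).
Proof.
move=> pu x j; rewrite /partial /derive.
rewrite (_ : (fun h : R => h^-1 *: ((u \o shift (x + _)) (h *: delta_mx ord0 i) - u (x + _))) =
  (fun h : R => h^-1 *: ((u \o shift x) (h *: delta_mx ord0 i) - u x)))//.
by apply/funext => h /=; rewrite /shift /= addrA !pu.
Qed.

Lemma partial_lin i (a : R) u v : smooth u -> smooth v ->
  partial i (a *: u + v) = a *: partial i u + partial i v.
Proof. by move=> su sv; have /= := @partials_lin [:: i] a u v su sv. Qed.

Hypothesis X0 : forall i, 0 < X i.

Lemma smooth_per_L2per u : smooth_per X u -> L2per X u.
Proof.
by move=> [su pu]; apply/L2perP; split=> //; apply: continuous_sqint => //; exact: (su [::]).1.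
Qed.

Lemma partial_L2per i u : smooth_per X u -> L2per X (partial i u).
Proof.
move=> [su pu]; apply/L2perP; split; last exact: periodic_partial.
by apply: continuous_sqint => //; exact: (su [:: i]).1.
Qed.

End smooth_functions.

(** * Poincare inequality and integration by parts *)

Section one_dimensional.
Context {R : realType}.
Local Notation lam := (@lebesgue_measure R).

(** Fundamental theorem of calculus between [s] and [t], Cauchy-Schwarz against the constant 1, then
    enlargement of the interval. *)
Lemma sq_increment_le (g g' : R -> R) (a b s t : R) :
  (forall x, derivable g x 1) -> (forall x, derive1 g x = g' x) -> continuous g' ->
  s \in `[a, b[ -> t \in `[a, b[ ->
  (((g t - g s) ^+ 2)%:E <= (b - a)%:E * \int[lam]_(x in `[a, b[) ((g' x) ^+ 2)%:E)%E.
Proof.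
move=> dg g'E cg' sab tab.
wlog st : s t sab tab / s <= t.
  move=> W; have [|/ltW] := leP s t; first exact: W.
  by move=> ts; rewrite -sqrrN opprB; exact: W.
have I0 : (0 <= \int[lam]_(x in `[a, b[) ((g' x) ^+ 2)%:E)%E.
  by apply: integral_ge0 => x _; rewrite lee_fin sqr_ge0.
move: sab tab; rewrite !in_itv /= => /andP[as_ sb] /andP[at_ tb].
have ba : 0 <= b - a by rewrite subr_ge0 (le_trans as_)// ltW.
have [->|sn] := eqVneq s t.
  by rewrite subrr expr0n /= mule_ge0// lee_fin.
have {}st : s < t by rewrite lt_neqAle sn.
have mD : measurable (`[s, t]%classic : set (measurableTypeR R)) by exact: measurable_itv.
have muE : lam `[s, t]%classic = (t - s)%:E.
  by rewrite lebesgue_measure_itv /= lte_fin st -EFinD.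
have muD : (lam `[s, t]%classic < +oo)%E by rewrite muE ltry.
have mg' : measurable_fun [set: R] g' by exact: continuous_measurable_fun.
have [M [_ hM]] : bounded_set (g' @` `[s, t]%classic).
  apply: compact_bounded; apply: continuous_compact; last exact: segment_compact.
  exact: continuous_subspaceT.
have sg' : sqint lam `[s, t]%classic g'.
  apply: (@sqint_bnd _ (measurableTypeR R) R lam _ mD muD _ (M + 1)) => // x xst.
  by apply: (hM (M + 1)); [rewrite ltrDl|exists x].
have s1 : sqint lam `[s, t]%classic (fun=> 1 : R) := sqint_cst mD muD 1.
have ftc : inn lam `[s, t]%classic g' (fun=> 1) = g t - g s.
  rewrite /inn /Rintegral; under eq_integral do rewrite mulr1.
  rewrite (@continuous_FTC2 _ g' g s t)//.
  - exact: continuous_subspaceT.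
  - have cg x : {for x, continuous g} by exact/differentiable_continuous/derivable1_diffP.
    split=> [x _||]; first exact: dg.
      by apply: cvg_at_right_filter; exact: cg.
    by apply: cvg_at_left_filter; exact: cg.
have := si_cauchy_schwarz (inn_semi mD muD) sg' s1.
rewrite ftc [X in _ * X](_ : _ = t - s); last first.
  rewrite /inn; under eq_Rintegral do rewrite mulr1.
  by rewrite Rintegral_cst// mul1r; exact: (congr1 fine muE).
move=> cs; apply: (@le_trans _ _ ((inn lam `[s, t]%classic g' g' * (t - s))%:E)).
  by rewrite lee_fin.
rewrite mulrC EFinM; apply: lee_pmul.
- by rewrite lee_fin subr_ge0 ltW.
- by rewrite lee_fin; exact: (si_ge0 (inn_semi mD muD)).
- by rewrite lee_fin lerB// ltW.
rewrite (inn_EFin mD sg' sg'); under eq_integral do rewrite -expr2.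
apply: ge0_subset_integral => //.
- apply/measurable_EFinP; apply: measurable_funTS; exact: measurable_funX.
- by move=> x _; rewrite lee_fin sqr_ge0.
- move=> x /=; rewrite !in_itv /= => /andP[sx xt].
  by rewrite (le_trans as_)// (le_lt_trans xt).
Qed.

End one_dimensional.

Section C1.
Context {R : realType}.

(** This regularity passes to slices with the last coordinate fixed and to products, as the
    inductions on the dimension require. *)
Definition C1 n (u : 'rV[R]_n -> R) := continuous u /\
  forall i, continuous (partial i u) /\ forall x, derivable u x (delta_mx ord0 i).

Lemma row_rconsD n (x : 'rV[R]_n) (t h : R) j :
  row_rcons (h *: delta_mx ord0 j + x, t) =
  h *: delta_mx ord0 (lift ord_max j) + row_rcons (x, t) :> 'rV[R]_n.+1.
Proof.
apply/rowP => i; rewrite !mxE /=; case: unliftP => [k ->|->] /=.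
  by rewrite !mxE /= (inj_eq lift_inj).
by rewrite (negbTE (neq_lift _ _)) mulr0 add0r.
Qed.

Lemma row_rconsDmax n (x : 'rV[R]_n) (t h : R) :
  row_rcons (x, h + t) = h *: delta_mx ord0 ord_max + row_rcons (x, t) :> 'rV[R]_n.+1.
Proof.
apply/rowP => i; rewrite !mxE /=; case: unliftP => [k ->|->] /=.
  by rewrite eq_sym (negbTE (neq_lift _ _)) mulr0 add0r.
by rewrite eqxx mulr1.
Qed.

Lemma continuous_row_rcons_l n (t : R) :
  continuous (fun x : 'rV[R]_n => row_rcons (x, t) : 'rV[R]_n.+1).
Proof.
move=> x A /nbhs_ballP[e e0 eA]; apply/nbhs_ballP; exists e => //= y [_ xy]; apply: eA.
split=> // i j; rewrite !mxE /=; case: unliftP => [k _|_] /=; last exact: ballxx.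
exact: xy.
Qed.

Lemma continuous_row_rcons_r n (x : 'rV[R]_n) :
  continuous (fun t : R => row_rcons (x, t) : 'rV[R]_n.+1).
Proof.
move=> t A /nbhs_ballP[e e0 eA]; apply/nbhs_ballP; exists e => //= s ts; apply: eA.
by split=> // i j; rewrite !mxE /=; case: unliftP => [k _|_] //=; exact: ballxx.
Qed.

Lemma slice_quotient n (u : 'rV[R]_n.+1 -> R) (x : 'rV[R]_n) (t : R) j :
  (fun h => h^-1 *: (((fun y : 'rV[R]_n => u (row_rcons (y, t))) \o shift x) (h *: delta_mx ord0 j)
     - u (row_rcons (x, t)))) =
  (fun h => h^-1 *: ((u \o shift (row_rcons (x, t))) (h *: delta_mx ord0 (lift ord_max j))
     - u (row_rcons (x, t)))).
Proof. by apply/funext => h /=; rewrite /shift /= row_rconsD. Qed.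

Lemma partial_slice n (u : 'rV[R]_n.+1 -> R) (x : 'rV[R]_n) (t : R) j :
  partial j (fun y : 'rV[R]_n => u (row_rcons (y, t))) x =
  partial (lift ord_max j) u (row_rcons (x, t)).
Proof. by rewrite /partial /derive slice_quotient. Qed.

Lemma C1_slice n (u : 'rV[R]_n.+1 -> R) (t : R) : C1 u ->
  C1 (fun x : 'rV[R]_n => u (row_rcons (x, t))).
Proof.
move=> [cu du]; split=> [x|j].
  exact: (continuous_comp (@continuous_row_rcons_l _ t x) (cu _)).
have [cd dd] := du (lift ord_max j); split=> x.
  rewrite (_ : partial j _ = fun x => partial (lift ord_max j) u (row_rcons (x, t))).
    exact: (continuous_comp (@continuous_row_rcons_l _ t x) (cd _)).
  by apply/funext => y; rewrite partial_slice.
by rewrite /derivable slice_quotient; exact: dd.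
Qed.

Lemma line_quotient n (u : 'rV[R]_n.+1 -> R) (x : 'rV[R]_n) (t : R) :
  (fun h : R => h^-1 *: (((fun s : R => u (row_rcons (x, s))) \o shift t) (h *: 1)
     - u (row_rcons (x, t)))) =
  (fun h => h^-1 *: ((u \o shift (row_rcons (x, t))) (h *: delta_mx ord0 ord_max)
     - u (row_rcons (x, t)))).
Proof.
apply/funext => h /=; rewrite /shift /= -row_rconsDmax.
by rewrite [h *: 1]mulr1.
Qed.

Lemma derivable_line n (u : 'rV[R]_n.+1 -> R) (x : 'rV[R]_n) (t : R) : C1 u ->
  derivable (fun s : R => u (row_rcons (x, s))) t 1.
Proof.
by move=> [_ du]; rewrite /derivable line_quotient; exact: (du ord_max).2.
Qed.

Lemma derive1_line n (u : 'rV[R]_n.+1 -> R) (x : 'rV[R]_n) (t : R) :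
  derive1 (fun s : R => u (row_rcons (x, s))) t = partial ord_max u (row_rcons (x, t)).
Proof. by rewrite derive1E /partial /derive line_quotient. Qed.

End C1.

Section poincare.
Context {R : realType}.
Local Notation lam := (@lebesgue_measure R).
Local Notation leb := (@leb R).

Lemma sum_lift_max (V : nmodType) n (F : 'I_n.+1 -> V) :
  \sum_(i < n.+1) F i = \sum_(j < n) F (lift ord_max j) + F ord_max.
Proof.
rewrite big_ord_recr; congr (_ + _); apply: eq_bigr => j _; congr F.
by apply: val_inj; rewrite /= /bump leqNgt ltn_ord.
Qed.

(** [u - mean X u] is orthogonal to constants. In the induction for Poincare this lets the mean over
    the box be replaced by the mean of one slice. *)
Lemma mean_min n (X : 'I_n -> R) (X0 : forall i, 0 < X i) (u : 'rV[R]_n -> R) (c : R) :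
  sqint (leb n) (box X) u ->
  (\int[leb n]_(x in box X) ((u x - mean X u) ^+ 2)%:E <=
   \int[leb n]_(x in box X) ((u x - c) ^+ 2)%:E)%E.
Proof.
move=> su; have mD := measurable_box X; have muD := leb_box_lty X.
have si := inn_semi mD muD.
have sc (k : R) : sqint (leb n) (box X) (fun=> k) := sqint_cst mD muD k.
have suk (k : R) : sqint (leb n) (box X) (fun x => u x - k) := sqint_sub mD su (sc k).
have E (k : R) : (\int[leb n]_(x in box X) ((u x - k) ^+ 2)%:E)%E =
    (inn (leb n) (box X) (fun x => u x - k) (fun x => u x - k))%:E.
  by rewrite (inn_EFin mD (suk k) (suk k)).
rewrite !E lee_fin; set m := mean X u.
have -> : (fun x => u x - c) = (fun x => u x - m) + (fun=> m - c) :> ('rV[R]_n -> R).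
  by apply/funext => x; rewrite fctE subrKA.
rewrite (si_sqD si (suk m) (sc (m - c))).
suff -> : inn (leb n) (box X) (fun x => u x - m) (fun=> m - c) = 0.
  by rewrite mulr0 addr0 lerDl; exact: (si_ge0 si).
rewrite /inn RintegralZr//; last exact: sqint_intg (suk m).
rewrite RintegralB//; [|exact: sqint_intg su|exact: sqint_intg (sc m)].
rewrite Rintegral_cst// /m /mean divfK ?subrr ?mul0r// gt_eqF//.
exact: vol_gt0.
Qed.

(** Closing arithmetic of the induction below: [e] is the energy in the last direction, [s] the
    energy in the others, and 2 l the length of the last side. *)
Lemma poincare_step (l C : R) (e s : \bar R) : 0 < l -> 0 <= C ->
  (0 <= e)%E -> (0 <= s)%E ->
  ((2 * l)%:E * ((8 * l ^+ 2)%:E * e) + (4 * l * C)%:E * s <=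
   (2 * l)%:E * ((8 * l ^+ 2 + 2 * C)%:E * (s + e)))%E.
Proof.
move=> l0 C0 e0 s0.
have h8 : 0 <= 8 * l ^+ 2 by rewrite mulr_ge0// sqr_ge0.
have h28 : 0 <= 2 * l by rewrite mulr_ge0// ltW.
have l3 : 0 <= l * l ^+ 2 by rewrite mulr_ge0 ?sqr_ge0// ltW.
have lC : 0 <= l * C by rewrite mulr_ge0// ltW.
rewrite (@ge0_muleDr _ (8 * l ^+ 2 + 2 * C)%:E)// ge0_muleDr; last 2 first.
- by rewrite mule_ge0// lee_fin addr_ge0// mulr_ge0.
- by rewrite mule_ge0// lee_fin addr_ge0// mulr_ge0.
rewrite addeC !muleA -!EFinM; apply: leeD; apply: lee_wpmul2r => //; rewrite lee_fin.
  have -> : 2 * l * (8 * l ^+ 2 + 2 * C) = 16 * (l * l ^+ 2) + 4 * (l * C) by ring.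
  by rewrite -mulrA; lra.
have -> : 2 * l * (8 * l ^+ 2 + 2 * C) = 16 * (l * l ^+ 2) + 4 * (l * C) by ring.
have -> : 2 * l * (8 * l ^+ 2) = 16 * (l * l ^+ 2) by ring.
by lra.
Qed.

(** Induction on the dimension. For a height t0, the difference of u(x, t) and the mean of the slice
    t0 is an increment along the last axis, bounded by [sq_increment_le], plus the fluctuation of
    that slice, bounded by the induction hypothesis. *)
Lemma poincare n (X : 'I_n -> R) : (forall i, 0 < X i) ->
  exists2 C : R, 0 <= C & forall u, C1 u ->
    (\int[leb n]_(x in box X) ((u x - mean X u) ^+ 2)%:E <=
     C%:E * \sum_(i < n) \int[leb n]_(x in box X) ((partial i u x) ^+ 2)%:E)%E.
Proof.
elim: n X => [|n IHn] X X0.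
  exists 0 => // u cu; rewrite mul0e.
  (* In dimension 0 there is a single point, so the constant [u 0] makes the integrand vanish. *)
  apply: le_trans (mean_min X0 (u 0) (continuous_sqint X cu.1)) _.
  rewrite integral0_eq// => x _; rewrite (_ : x = 0) ?subrr ?expr0n//.
  by apply/rowP => -[].
pose X' (j : 'I_n) := X (lift ord_max j); pose l := X ord_max.
pose I := `[- l, l[%classic : set (measurableTypeR R).
have l0 : 0 < l by exact: X0.
have X'0 j : 0 < X' j by exact: X0.
have [C C0 IH] := IHn X' X'0.
exists (8 * l ^+ 2 + 2 * C) => [|u cu].
  by rewrite addr_ge0// mulr_ge0// sqr_ge0.
have mI : measurable I by exact: measurable_itv.
have lI : lam I = (2 * l)%:E.
  rewrite /I lebesgue_measure_itv /= lte_fin gtrN// -EFinD; congr EFin; ring.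
have icst (c : \bar R) : (\int[lam]_(t in I) c = (2 * l)%:E * c)%E.
  by rewrite integral_cst// muleC; congr (_ * _)%E; exact: lI.
have mB := measurable_box X; have mB' := measurable_box X'.
have preB : @row_rcons R n @^-1` box X = box X' `*` I :=
  preimage_row_rcons_cuboid (fun i => `[- X i, X i[%classic).
have sfl := @leb_sigma_finite R n.
have mrc (f : 'rV[R]_n.+1 -> \bar R) : measurable_fun [set: 'rV[measurableTypeR R]_n.+1] f ->
    measurable_fun setT (fun z : 'rV[measurableTypeR R]_n * measurableTypeR R => f (row_rcons z)).
  by move=> mf; apply: measurableT_comp mf (@measurable_row_rcons R n).
have T1 (f : 'rV[R]_n.+1 -> \bar R) : measurable_fun [set: 'rV[measurableTypeR R]_n.+1] f ->
    (forall x, 0 <= f x)%E -> (\int[leb n.+1]_(x in box X) f x =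
    \int[leb n]_(x in box X') \int[lam]_(t in I) f (row_rcons (x, t)))%E.
  move=> mf f0; rewrite (leb_rcons_int mB preB mf f0).
  by rewrite (tonelli_rect1 lam sfl mB' mI (mrc _ mf) (fun z => f0 (row_rcons z))).
have T2 (f : 'rV[R]_n.+1 -> \bar R) : measurable_fun [set: 'rV[measurableTypeR R]_n.+1] f ->
    (forall x, 0 <= f x)%E -> (\int[leb n.+1]_(x in box X) f x =
    \int[lam]_(t in I) \int[leb n]_(x in box X') f (row_rcons (x, t)))%E.
  move=> mf f0; rewrite (leb_rcons_int mB preB mf f0).
  by rewrite (tonelli_rect2 lam sfl mB' mI (mrc _ mf) (fun z => f0 (row_rcons z))).
have mE m (v : 'rV[R]_m -> R) (c : R) : continuous v ->
    measurable_fun [set: 'rV[measurableTypeR R]_m] (fun x => ((v x - c) ^+ 2)%:E).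
  move=> cv; apply/measurable_EFinP; apply: measurable_funX; apply: measurable_funB => //.
  exact: continuous_measurable_row.
have sq0 (r : R) : (0 <= (r ^+ 2)%:E)%E by rewrite lee_fin sqr_ge0.
have mP i : measurable_fun [set: 'rV[measurableTypeR R]_n.+1] (fun x => ((partial i u x) ^+ 2)%:E).
  by have := mE _ _ 0 (cu.2 i).1; under eq_fun do rewrite subr0.
pose e i := (\int[leb n.+1]_(x in box X) ((partial i u x) ^+ 2)%:E)%E.
have e0 i : (0 <= e i)%E by exact: integral_ge0.
pose S t := (\sum_(j < n) \int[leb n]_(x in box X')
   ((partial (lift ord_max j) u (row_rcons (x, t))) ^+ 2)%:E)%E.
have S0 t : (0 <= S t)%E by apply: sume_ge0 => j _; exact: integral_ge0.
have mS : measurable_fun I S.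
  apply: emeasurable_sum => j.
  exact: (measurable_tonelli_rect2 sfl mB' mI (mrc _ (mP _)) (fun z => sq0 _)).
have iS : (\int[lam]_(t in I) S t = \sum_(j < n) e (lift ord_max j))%E.
  rewrite ge0_integral_sum//.
  - by apply: eq_bigr => j _; rewrite /e T2.
  - by move=> j; exact: (measurable_tonelli_rect2 sfl mB' mI (mrc _ (mP _)) (fun z => sq0 _)).
  - by move=> j t _; exact: integral_ge0.
pose Tn (x : 'rV[R]_n) := (\int[lam]_(t in I) ((partial ord_max u (row_rcons (x, t))) ^+ 2)%:E)%E.
have Tn0 x : (0 <= Tn x)%E by exact: integral_ge0.
have mTn : measurable_fun (box X' : set 'rV[measurableTypeR R]_n) Tn.
  exact: (measurable_tonelli_rect1 lam mB' mI (mrc _ (mP _)) (fun z => sq0 _)).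
have iTn : (\int[leb n]_(x in box X') Tn x = e ord_max)%E by rewrite /e T1.
set Var := (\int[_]_(x in _) _)%E.
have Var0 : (0 <= Var)%E by exact: integral_ge0.
have key t0 : I t0 -> (Var <= (8 * l ^+ 2)%:E * e ord_max + (4 * l * C)%:E * S t0)%E.
  move=> It0; pose ut (x : 'rV[R]_n) := u (row_rcons (x, t0)).
  have cut : C1 ut by exact: C1_slice.
  pose m0 := mean X' ut.
  pose w x := ((ut x - m0) ^+ 2)%:E.
  have mw : measurable_fun (box X' : set 'rV[measurableTypeR R]_n) w.
    by apply: measurable_funTS; apply: mE; exact: cut.1.
  have iw : (\int[leb n]_(x in box X') w x <= C%:E * S t0)%E.
    suff <- : (\sum_(j < n) \int[leb n]_(x in box X') ((partial j ut x) ^+ 2)%:E)%E = S t0.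
      exact: IH.
    by apply: eq_bigr => j _; apply: eq_integral => x _; rewrite partial_slice.
  apply: le_trans (mean_min X0 m0 (continuous_sqint X cu.1)) _.
  rewrite T1//; last exact: mE cu.1.
  pose k x := ((4 * l)%:E * Tn x + 2%:E * w x)%E.
  have w0 x : (0 <= w x)%E by exact: sq0.
  have c2 : (0 <= 2%:E :> \bar R)%E by rewrite lee_fin.
  have c2l : (0 <= (2 * l)%:E)%E by rewrite lee_fin mulr_ge0// ltW.
  have c4l : (0 <= (4 * l)%:E)%E by rewrite lee_fin mulr_ge0// ltW.
  have c4w x : (0 <= (4 * l)%:E * Tn x)%E by rewrite mule_ge0.
  have c2w x : (0 <= 2%:E * w x)%E by rewrite mule_ge0.
  have k0 x : (0 <= k x)%E by rewrite adde_ge0.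
  have mk1 : measurable_fun (box X' : set 'rV[measurableTypeR R]_n) (fun x => (4 * l)%:E * Tn x)%E.
    exact: measurable_funeM.
  have mk2 : measurable_fun (box X' : set 'rV[measurableTypeR R]_n) (fun x => 2%:E * w x)%E.
    exact: measurable_funeM.
  have mk : measurable_fun (box X' : set 'rV[measurableTypeR R]_n) k by exact: emeasurable_funD.
  apply: (@le_trans _ _ (\int[leb n]_(x in box X') ((2 * l)%:E * k x))%E).
    apply: ge0_le_integral => //.
    - by move=> x _; exact: integral_ge0.
    - exact: (measurable_tonelli_rect1 lam mB' mI (mrc _ (mE _ _ m0 cu.1)) (fun z => sq0 _)).
    - exact: measurable_funeM.
    move=> x _; apply: (@le_trans _ _ (\int[lam]_(t in I) (k x))%E); last first.
      by rewrite icst.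
    apply: ge0_le_integral => //.
      apply: measurable_funTS.
      have := mrc _ (mE _ _ m0 cu.1) => h.
      exact: (measurableT_comp h (pair1_measurable x)).
    move=> t It.
    have h1 : (((u (row_rcons (x, t)) - u (row_rcons (x, t0))) ^+ 2)%:E <= (2 * l)%:E * Tn x)%E.
      rewrite (_ : 2 * l = l - - l); last by ring.
      apply: (sq_increment_le (g := fun s => u (row_rcons (x, s)))
        (g' := fun s => partial ord_max u (row_rcons (x, s)))) => //.
      - by move=> s; exact: derivable_line.
      - by move=> s; exact: derive1_line.
      - by move=> s; exact: (continuous_comp (@continuous_row_rcons_r _ _ x s) ((cu.2 ord_max).1 _)).
    apply: (@le_trans _ _ (2%:E * ((u (row_rcons (x, t)) - u (row_rcons (x, t0))) ^+ 2)%:E + 2%:E * w x)%E).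
      rewrite /w -!EFinM -EFinD lee_fin /ut.
      set a := u (row_rcons (x, t)); set b := u (row_rcons (x, t0)).
      by have := sqr_ge0 ((a - b) - (b - m0)); nra.
    rewrite /k leeD2r// (_ : (4 * l)%:E = 2%:E * (2 * l)%:E)%E; last by rewrite -EFinM; congr EFin; ring.
    by rewrite -muleA; apply: lee_wpmul2l.
  rewrite ge0_integralZl// ge0_integralD// ge0_integralZl// ge0_integralZl// iTn.
  apply: (@le_trans _ _ ((2 * l)%:E * ((4 * l)%:E * e ord_max + 2%:E * (C%:E * S t0)))%E).
    by apply: lee_wpmul2l => //; apply: leeD2l; exact: lee_wpmul2l.
  have CS0 : (0 <= C%:E * S t0)%E by rewrite mule_ge0.
  rewrite ge0_muleDr ?mule_ge0//.
  rewrite !muleA -!EFinM (_ : 2 * l * (4 * l) = 8 * l ^+ 2); last by ring.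
  by rewrite (_ : 2 * l * 2 * C = 4 * l * C); last by ring.
have l2 : (0 < (2 * l)%:E)%E by rewrite lte_fin mulr_gt0.
(* The slice energy [S t0] is controlled on average only, so [key] is integrated over all t0 in [I],
   which multiplies the left side by 2 l. *)
rewrite -(@lee_pmul2l _ (2 * l)%:E)//.
have -> : ((2 * l)%:E * Var = \int[lam]_(t in I) Var)%E by rewrite icst.
have h8 : (0 <= (8 * l ^+ 2)%:E)%E by rewrite lee_fin mulr_ge0// sqr_ge0.
have h4 : (0 <= (4 * l * C)%:E)%E by rewrite lee_fin mulr_ge0// mulr_ge0// ltW.
apply: (@le_trans _ _ (\int[lam]_(t in I) ((8 * l ^+ 2)%:E * e ord_max + (4 * l * C)%:E * S t))%E).
  apply: ge0_le_integral => //; apply: emeasurable_funD => //.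
  exact: measurable_funeM.
rewrite ge0_integralD//; last 3 first.
- by move=> t _; rewrite mule_ge0.
- by move=> t _; rewrite mule_ge0.
- exact: measurable_funeM.
rewrite icst ge0_integralZl// iS.
have -> : (\sum_(i < n.+1) \int[leb n.+1]_(x in box X) ((partial i u x) ^+ 2)%:E =
   \sum_(j < n) e (lift ord_max j) + e ord_max)%E.
  exact: (sum_lift_max e).
set s := (\sum_(j < n) _)%E.
have s0 : (0 <= s)%E by apply: sume_ge0.
exact: poincare_step.
Qed.

End poincare.

(** * Integration by parts for periodic functions *)

Section integration_by_parts.
Context {R : realType}.
Local Notation lam := (@lebesgue_measure R).
Local Notation leb := (@leb R).

Lemma row_rcons_period n (X : 'I_n.+1 -> R) (x : 'rV[R]_n) (t : R) j :
  row_rcons (x + (2 * X (lift ord_max j)) *: delta_mx ord0 j, t) =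
  row_rcons (x, t) + (2 * X (lift ord_max j)) *: delta_mx ord0 (lift ord_max j) :> 'rV[R]_n.+1.
Proof. by rewrite addrC row_rconsD addrC. Qed.

Lemma row_rcons_period_max n (X : 'I_n.+1 -> R) (x : 'rV[R]_n) (t : R) :
  row_rcons (x, t + 2 * X ord_max) =
  row_rcons (x, t) + (2 * X ord_max) *: delta_mx ord0 ord_max :> 'rV[R]_n.+1.
Proof. by rewrite addrC row_rconsDmax addrC. Qed.

(* The derivative is shifted by a constant to make it nonnegative on the box, so
   that Tonelli applies. *)
Lemma int_partial_periodic n (X : 'I_n -> R) : (forall i, 0 < X i) ->
  forall w i (K : R), C1 w -> Defs.periodic X w ->
    (forall x, box X x -> 0 <= partial i w x + K) ->
    (\int[leb n]_(x in box X) (partial i w x + K)%:E = K%:E * leb n (box X))%E.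
Proof.
elim: n X => [|n IHn] X X0 w i K cw pw wK; first by case: i {wK}.
pose X' (j : 'I_n) := X (lift ord_max j); pose l := X ord_max.
pose I := `[- l, l[%classic : set (measurableTypeR R).
have l0 : 0 < l by exact: X0.
have X'0 j : 0 < X' j by exact: X0.
have mI : measurable I by exact: measurable_itv.
have lI : lam I = (2 * l)%:E.
  rewrite /I lebesgue_measure_itv /= lte_fin gtrN// -EFinD; congr EFin; ring.
have mB := measurable_box X; have mB' := measurable_box X'.
have preB : @row_rcons R n @^-1` box X = box X' `*` I :=
  preimage_row_rcons_cuboid (fun i => `[- X i, X i[%classic).
have sfl := @leb_sigma_finite R n.
have volB : leb n.+1 (box X) = (leb n (box X') * (2 * l)%:E)%E.
  by rewrite -lI; apply: (lebS_cuboid (S := fun i => `[- X i, X i[%classic)) => j; exact: measurable_itv.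
pose f x := (`|partial i w x + K|)%:E.
have f0 x : (0 <= f x)%E by rewrite lee_fin.
have mf : measurable_fun [set: 'rV[measurableTypeR R]_n.+1] f.
  apply/measurable_EFinP; apply: measurableT_comp => //; apply: measurable_funD => //.
  by apply: continuous_measurable_row; exact: (cw.2 i).1.
have mrf : measurable_fun setT (fun z : 'rV[measurableTypeR R]_n * measurableTypeR R => f (row_rcons z)).
  exact: measurableT_comp mf (@measurable_row_rcons R n).
have fE x : box X x -> f x = (partial i w x + K)%:E by move=> /wK h; rewrite /f ger0_norm.
have inB x t : box X' x -> I t -> box X (row_rcons (x, t)).
  move=> Bx It; have : (box X' `*` I) (x, t) by [].
  by rewrite -preB.
transitivity (\int[leb n.+1]_(x in box X) f x)%E.
  by apply: eq_integral => x /set_mem Bx; rewrite fE.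
rewrite (leb_rcons_int mB preB mf f0).
(* For the first n directions the induction hypothesis applies to each slice; for the last one, the
   fundamental theorem of calculus applies to each line, whose endpoints differ by a period. *)
case: (unliftP ord_max i) => [j|] iE.
- rewrite (tonelli_rect2 lam sfl mB' mI mrf (fun z => f0 _)) /=.
  transitivity (\int[lam]_(t in I) (K%:E * leb n (box X')))%E.
    apply: eq_integral => t /set_mem It.
    rewrite -(IHn X' X'0 (fun x => w (row_rcons (x, t))) j K).
    + apply: eq_integral => x /set_mem Bx; rewrite fE; last exact: inB.
      by rewrite iE partial_slice.
    + exact: C1_slice.
    + by move=> x k; rewrite row_rcons_period pw.
    + by move=> x Bx; rewrite partial_slice -iE; apply: wK; exact: inB.
  rewrite integral_cst// volB muleA; congr (_ * _)%E; exact: lI.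
- rewrite (tonelli_rect1 lam sfl mB' mI mrf (fun z => f0 _)) /=.
  transitivity (\int[leb n]_(x in box X') (K * (2 * l))%:E)%E; last first.
    by rewrite integral_cst// volB EFinM -muleA (muleC (leb n _)).
  apply: eq_integral => x /set_mem Bx.
  pose G (t : R) := w (row_rcons (x, t)) + K * t.
  pose g (t : R) := partial ord_max w (row_rcons (x, t)) + K.
  have cg : continuous g.
    move=> t; have c1 := continuous_comp (@continuous_row_rcons_r _ _ x t) ((cw.2 ord_max).1 _).
    exact: (continuousD c1 (@cst_continuous _ _ K t)).
  have dG (t : R) : is_derive t (1 : R) G (g t).
    apply: is_deriveD.
      apply: DeriveDef; first exact: derivable_line.
      by rewrite -derive1E derive1_line.
    by apply: is_derive_eq; rewrite scaler1.
  transitivity (\int[lam]_(t in I) (g t)%:E)%E.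
    by apply: eq_integral => t /set_mem It; rewrite fE ?iE//; exact: inB.
  rewrite /I integral_itv_bndo_bndc; last first.
    by apply/measurable_EFinP; apply: measurable_funTS; exact: continuous_measurable_fun.
  rewrite (@continuous_FTC2 _ g G (- l) l)//.
  + rewrite -EFinB; congr EFin; rewrite /G.
    have -> : w (row_rcons (x, l)) = w (row_rcons (x, - l)).
      by rewrite -(pw (row_rcons (x, - l)) ord_max) -row_rcons_period_max; congr (w (row_rcons (_, _))); rewrite /l; ring.
    ring.
  + by rewrite gtrN.
  + exact: continuous_subspaceT.
  + have cG t : {for t, continuous G}.
      by apply/differentiable_continuous/derivable1_diffP; have [] := dG t.
    split=> [t _||]; first by have [] := dG t.
      by apply: cvg_at_right_filter; exact: cG.
    by apply: cvg_at_left_filter; exact: cG.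
  + by move=> t _; rewrite derive1E; case: (dG t).
Qed.

Lemma C1M n (u v : 'rV[R]_n -> R) : C1 u -> C1 v -> C1 (u * v) /\
  forall i x, partial i (u * v) x = u x * partial i v x + v x * partial i u x.
Proof.
move=> [cu du] [cv dv].
have E i x : partial i (u * v) x = u x * partial i v x + v x * partial i u x.
  by rewrite /partial deriveM//; [exact: (du i).2|exact: (dv i).2].
split; last exact: E.
split; first by move=> x; apply: continuousM; [exact: cu|exact: cv].
move=> i; split=> x; last by apply: derivableM; [exact: (du i).2|exact: (dv i).2].
rewrite (_ : partial i (u * v) = fun x => u x * partial i v x + v x * partial i u x); last first.
  by apply/funext => y; rewrite E.
have c1 := continuousM (cu x) ((dv i).1 x); have c2 := continuousM (cv x) ((du i).1 x).
exact: (continuousD c1 c2).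
Qed.

Lemma smooth_C1 n (u : 'rV[R]_n -> R) : smooth u -> C1 u.
Proof.
move=> su; split; first exact: (su [::]).1.
by move=> i; split; [exact: (su [:: i]).1|exact: (su [::]).2].
Qed.

(** The partial derivative of the periodic product [u * v] integrates to 0; its bound on the closed
    box supplies the shift [K]. *)
Lemma inner_partial_by_parts n (X : 'I_n -> R) (X0 : forall i, 0 < X i) u v i :
  C1 u -> C1 v -> Defs.periodic X u -> Defs.periodic X v ->
  inner X (partial i u) v = - inner X u (partial i v).
Proof.
move=> cu cv pu pv; have mD := measurable_box X; have muD := leb_box_lty X.
have [cw wE] := C1M cu cv.
have pw : Defs.periodic X (u * v) by move=> x j; rewrite !fctE pu pv.
have [K hK] := continuous_bounded_box X (cw.2 i).1.
have wK x : box X x -> 0 <= partial i (u * v) x + K.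
  move=> Bx; have /hK : forall j, x ord0 j \in `[- X j, X j].
    by move=> j; have := Bx j; rewrite !in_itv /= => /andP[-> /ltW].
  by rewrite ler_norml => /andP[h _]; rewrite -lerBlDr sub0r.
have sq z : continuous z -> sqint (leb n) (box X) z by exact: continuous_sqint.
have i1 : intg (leb n) (box X) (fun x => partial i u x * v x).
  by apply: sqint_mul => //; apply: sq; [exact: (cu.2 i).1|exact: cv.1].
have i2 : intg (leb n) (box X) (fun x => u x * partial i v x).
  by apply: sqint_mul => //; apply: sq; [exact: cu.1|exact: (cv.2 i).1].
have := int_partial_periodic X0 cw pw wK.
move=> /(congr1 fine); rewrite -volE -EFinM /= => h.
have : (\int[leb n]_(x in box X) (partial i (u * v) x + K) = K * vol X)%R by [].
have -> : (\int[leb n]_(x in box X) (partial i (u * v) x + K) =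
    \int[leb n]_(x in box X) (partial i u x * v x + u x * partial i v x + K))%R.
  by apply: eq_Rintegral => x _; rewrite wE addrC (mulrC (v x)) addrC (addrC (u x * _)).
rewrite RintegralD//; [|exact: intgD|exact: (intg_cst mD muD)].
rewrite RintegralD// Rintegral_cst// -/(vol X) -/(inner X u _) -/(inner X _ v).
by lra.
Qed.

End integration_by_parts.

Lemma cvg_sum_seq {R : realType} (I : Type) (s : seq I) (F : I -> nat -> R) (l : I -> R) :
  (forall i, F i k @[k --> \oo] --> l i) ->
  (\sum_(i <- s) F i k) @[k --> \oo] --> \sum_(i <- s) l i.
Proof.
move=> h; elim: s => [|i s IH].
  by under eq_fun do rewrite big_nil; rewrite big_nil; exact: cvg_cst.
by under eq_fun do rewrite big_cons; rewrite big_cons; apply: cvgD.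
Qed.

(** * Periodic gradients and the inverse Laplacian *)

Section periodic_L2.
Context {R : realType} {d : nat}.
Variable X : 'I_d -> R.
Hypothesis X0 : forall i, 0 < X i.
Local Notation V := 'rV[R]_d.
Local Notation mu := (@leb R d).
Implicit Types (u v w g h : V -> R).

Let mD := measurable_box X.
Let muD := leb_box_lty X.

Lemma L2per_semi : @semi_inner R (V -> R) (L2per X) (inner X).
Proof.
have si := inn_semi mD muD; split.
- move=> a u v /L2perP[su pu] /L2perP[sv pv]; apply/L2perP; split.
    exact: (si_mem si).
  by move=> x i; rewrite !fctE pu pv.
- by apply/L2perP; split; [exact: (si_mem0 si)|].
- by move=> u v /L2perP[su _] /L2perP[sv _]; exact: (si_sym si).
- by move=> a u v w /L2perP[su _] /L2perP[sv _] /L2perP[sw _]; exact: (si_lin si).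
- by move=> u /L2perP[su _]; exact: (si_ge0 si).
Qed.

Lemma L2per_complete : ip_complete (L2per X : set (V -> R)) (inner X).
Proof.
move=> u Pu cu.
have su n : sqint mu (box X) (u n) by have /L2perP[] := Pu n.
have [l [sl ll pl]] := sqint_complete mD muD su cu.
exists l => //; apply/L2perP; split=> // x i.
by apply: (pl (fun x => x + (2 * X i) *: delta_mx ord0 i)) => n y; have /L2perP[_ ->] := Pu n.
Qed.

Let L2 := L2per X : set (V -> R).
Let si := L2per_semi.

Lemma L2per_sqint u : L2per X u -> sqint mu (box X) u. Proof. by move=> /L2perP[]. Qed.

Lemma L2per_cst (c : R) : L2per X (fun=> c).
Proof. by apply/L2perP; split; [exact: sqint_cst|]. Qed.

Lemma L2per_addc u (c : R) : L2per X u -> L2per X (fun x => u x + c).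
Proof. by move=> Lu; apply: (si_memD si Lu); exact: L2per_cst. Qed.

Lemma L2per_subc u (c : R) : L2per X u -> L2per X (fun x => u x - c).
Proof. exact: L2per_addc. Qed.

Lemma L2per_comp (f : R -> R) u : measurable_fun [set: R] f ->
  (exists a b : R, forall s, `|f s| <= a + b * `|s|) -> L2per X u -> L2per X (f \o u).
Proof.
move=> mf [a [b fab]] /L2perP[su pu]; apply/L2perP; split; last by move=> x i /=; rewrite pu.
apply: (@le_sqint _ _ _ _ _ mD _ (fun x => b * `|u x| + a)).
- by apply: measurableT_comp mf _; exact: sqint_mf su.
- by move=> x _ /=; rewrite addrC.
- by apply: sqint_lin => //; [exact: sqint_abs|exact: sqint_cst].
Qed.

Lemma inner_cst1 u : L2per X u -> inner X u (fun=> 1) = mean X u * vol X.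
Proof.
move=> _; rewrite /mean divfK ?gt_eqF ?vol_gt0// /inner.
by apply: eq_Rintegral => x _; rewrite mulr1.
Qed.

Lemma inner_cst u (c : R) : L2per X u -> inner X u (fun=> c) = c * (mean X u * vol X).
Proof.
move=> Lu; rewrite -inner_cst1//.
rewrite -(si_Zr si _ (L2per_cst 1) Lu); congr (inner _ _ _).
by apply/funext => x; rewrite fctE /GRing.scale /= mulr1.
Qed.

Lemma mean_lin (a : R) u v : L2per X u -> L2per X v ->
  mean X (a *: u + v) = a * mean X u + mean X v.
Proof.
move=> Lu Lv; have v0 := vol_gt0 X0; have L1 := L2per_cst 1.
apply: (mulIf (lt0r_neq0 v0)).
rewrite (_ : (a * _ + _) * _ = a * (mean X u * vol X) + mean X v * vol X); last by ring.
rewrite -(inner_cst1 Lu) -(inner_cst1 Lv) -(inner_cst1 (si_mem si a Lu Lv)).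
exact: (si_lin si a Lu Lv L1).
Qed.

Lemma mean_cst (c : R) : mean X (fun=> c) = c.
Proof. by rewrite /mean Rintegral_cst// -/(vol X) mulfK// gt_eqF// vol_gt0. Qed.

Lemma nrm_sub_mean u : L2per X u -> nrm (inner X) (fun x => u x - mean X u) <= nrm (inner X) u.
Proof.
move=> Lu; rewrite ler_wsqrtr//.
have su := L2per_sqint Lu.
have := mean_min X0 0 su.
have E (k : R) : (\int[mu]_(x in box X) ((u x - k) ^+ 2)%:E)%E =
    (inner X (fun x => u x - k) (fun x => u x - k))%:E.
  have suk : sqint mu (box X) (fun x => u x - k) := sqint_sub mD su (sqint_cst mD muD k).
  by rewrite (inn_EFin mD suk suk).
rewrite !E lee_fin; congr (_ <= inner _ _ _); by apply/funext => x; rewrite subr0.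
Qed.

Section gradients.

Lemma smooth_semi_is_grad psi : smooth_per X psi -> is_grad X psi (partial^~ psi).
Proof.
move=> sp; split; [exact: smooth_per_L2per|by move=> i; exact: partial_L2per|].
have z (f : V -> R) : inner X (f \- f) (f \- f) = 0.
  rewrite (_ : f \- f = 0); first exact: (si_0l si (si_mem0 si)).
  by apply/funext => x /=; rewrite subrr.
by exists (fun=> psi); split=> [//||i]; rewrite z; exact: cvg_cst.
Qed.

(** With a tolerance instead of a sequence, one smooth function serves [u] and all components of
    [g], and linear combinations and limits are formed without extracting subsequences. *)
Lemma is_gradP u (g : 'I_d -> V -> R) : is_grad X u g <->
  [/\ L2per X u, forall i, L2per X (g i) &
    forall e : R, 0 < e -> exists psi, [/\ smooth_per X psi, nrm (inner X) (psi - u) <= e &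
      forall i, nrm (inner X) (partial i psi - g i) <= e]].
Proof.
split=> -[Lu Lg].
  move=> [psi [sp cu cg]]; split=> // e e0.
  have c2 : (inner X (psi k - u) (psi k - u) +
      \sum_(i < d) inner X (partial i (psi k) - g i) (partial i (psi k) - g i)) @[k --> \oo] --> 0.
    rewrite -[X in _ --> X](addr0 0); apply: cvgD => //.
    rewrite -[X in _ --> X](_ : \sum_(i < d) 0 = 0); last by rewrite big1.
    by apply: cvg_sum_seq => i; exact: cg.
  have [N hN] := cvg0_le (exprn_gt0 2 e0) c2.
  have g0 i : 0 <= inner X (partial i (psi N) - g i) (partial i (psi N) - g i).
    by apply: (si_ge0 si); apply: (si_memB si) => //; exact: partial_L2per.
  have u0 : 0 <= inner X (psi N - u) (psi N - u).
    by apply: (si_ge0 si); apply: (si_memB si) => //; exact: smooth_per_L2per.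
  exists (psi N); split=> // [|i].
    rewrite -(ger0_norm (ltW e0)) -sqrtr_sqr ler_wsqrtr//; apply: le_trans (hN _ (leqnn N)).
    by rewrite lerDl sumr_ge0.
  rewrite -(ger0_norm (ltW e0)) -sqrtr_sqr ler_wsqrtr//; apply: le_trans (hN _ (leqnn N)).
  by rewrite (bigD1 i)//= addrCA lerDl addr_ge0// sumr_ge0.
move=> H; split=> //.
have /choice[psi psiP] : forall k : nat, exists psi, [/\ smooth_per X psi,
    nrm (inner X) (psi - u) <= k.+1%:R^-1 &
    forall i, nrm (inner X) (partial i psi - g i) <= k.+1%:R^-1].
  by move=> k; apply: H; rewrite invr_gt0 ltr0n.
have sq (f : nat -> V -> R) : (forall k, L2per X (f k)) ->
    (forall k, nrm (inner X) (f k) <= k.+1%:R^-1) -> inner X (f k) (f k) @[k --> \oo] --> 0.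
  move=> Lf hf; apply: (@cvg_le_dist _ _ (fun k => k.+1%:R^-1)); last exact: cvg_harmonic.
  move=> k; rewrite subr0 ger0_norm ?(si_ge0 si)// -(nrmE si)//.
  apply: le_trans (hf k); rewrite expr2 ler_piMr ?nrm_ge0//.
  by apply: le_trans (hf k) _; rewrite invf_le1 ?ltr0n// ler1n.
exists psi; split=> [k||i]; first by have [] := psiP k.
  apply: (sq (fun k => psi k - u)) => k; have [sp h1 h2] := psiP k; last exact: h1.
  exact: (si_memB si (smooth_per_L2per sp) Lu).
apply: (sq (fun k => partial i (psi k) - g i)) => k; have [sp h1 h2] := psiP k; last exact: h2.
exact: (si_memB si (partial_L2per i sp) (Lg i)).
Qed.

Lemma is_grad_lin (a : R) u v (g h : 'I_d -> V -> R) : is_grad X u g -> is_grad X v h ->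
  is_grad X (a *: u + v) (a *: g + h).
Proof.
move=> /is_gradP[Lu Lg Hu] /is_gradP[Lv Lh Hv]; apply/is_gradP; split.
- exact: (si_mem si).
- by move=> i; exact: (si_mem si).
move=> e e0; pose e' := e / (`|a| + 1).
have a1 : 0 < `|a| + 1 by rewrite ltr_wpDl.
have e'0 : 0 < e' by rewrite divr_gt0.
have [p [sp p1 p2]] := Hu _ e'0; have [q [sq q1 q2]] := Hv _ e'0.
have comb (x y x' y' : V -> R) : L2per X x -> L2per X y -> L2per X x' -> L2per X y' ->
    nrm (inner X) (x - x') <= e' -> nrm (inner X) (y - y') <= e' ->
    nrm (inner X) (a *: x + y - (a *: x' + y')) <= e.
  move=> Lx Ly Lx' Ly' h1 h2.
  have -> : a *: x + y - (a *: x' + y') = a *: (x - x') + (y - y').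
    by rewrite scalerBr opprD addrACA.
  have P1 := si_memB si Lx Lx'; have P2 := si_memB si Ly Ly'.
  apply: le_trans (nrmD si (si_memZ si a P1) P2) _; rewrite (nrmZ si)//.
  apply: le_trans (lerD (ler_wpM2l (normr_ge0 a) h1) h2) _.
  by rewrite -{2}[e']mul1r -mulrDl /e' mulrC divfK// gt_eqF.
exists (a *: p + q); split; first exact: smooth_per_lin.
  by apply: comb => //; exact: smooth_per_L2per.
move=> i; rewrite partial_lin; [|exact: sp.1|exact: sq.1].
by apply: comb => //; exact: partial_L2per.
Qed.

Lemma is_grad_sub_cst u (g : 'I_d -> V -> R) (c : R) : is_grad X u g ->
  is_grad X (fun x => u x - c) g.
Proof.
move=> Gu; have Gc := smooth_semi_is_grad (smooth_per_cst X (- c)).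
have := is_grad_lin 1 Gu Gc.
rewrite (_ : 1 *: u + _ = fun x => u x - c); last by rewrite scale1r.
rewrite (_ : 1 *: g + _ = g)//; apply/funext => i; rewrite scale1r fctE.
rewrite (_ : partial i _ = 0) ?addr0//.
by apply/funext => x; rewrite /partial derive_cst.
Qed.

(* Closability of the gradient: if psi_k -> 0 and grad psi_k -> g in L^2, then
   <g_i, partial_i psi_m> = lim_k - <psi_k, partial_i partial_i psi_m> = 0. *)
Lemma is_grad0 (g : 'I_d -> V -> R) i : is_grad X 0 g -> inner X (g i) (g i) = 0.
Proof.
move=> /is_gradP[L0 Lg H].
have orth psi : smooth_per X psi -> inner X (g i) (partial i psi) = 0.
  move=> sp; have Lp := partial_L2per i sp.
  have spp : smooth_per X (partial i psi).
    split; last exact: periodic_partial sp.2.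
    by move=> s; have := sp.1 (rcons s i); rewrite /partials foldr_rcons.
  pose a := nrm (inner X) (partial i psi); pose b := nrm (inner X) (partial i (partial i psi)).
  apply/eqP; rewrite -normr_le0; apply/ler_addgt0Pr => e e0; rewrite add0r.
  have ab : 0 < a + b + 1 by rewrite ltr_wpDl// addr_ge0// nrm_ge0.
  have [p [spp' p1 p2]] := H (e / (a + b + 1)) (divr_gt0 e0 ab).
  have Lpi := partial_L2per i spp'; have Lpp := smooth_per_L2per spp'.
  have Lppp := partial_L2per i spp.
  have -> : inner X (g i) (partial i psi) =
      - inner X (partial i p - g i) (partial i psi) - inner X (p - 0) (partial i (partial i psi)).
    rewrite (si_Bl si Lpi (Lg i) Lp) subr0.
    rewrite (inner_partial_by_parts X0 i (smooth_C1 spp'.1) (smooth_C1 spp.1) spp'.2 spp.2).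
    by rewrite opprB opprK addrK.
  rewrite -opprD normrN; apply: le_trans (ler_normD _ _) _.
  have h1 := nrm_cs si (si_memB si Lpi (Lg i)) Lp.
  have h2 := nrm_cs si (si_memB si Lpp L0) Lppp.
  apply: le_trans (lerD h1 h2) _.
  apply: le_trans (lerD (ler_wpM2r (nrm_ge0 _ _) (p2 i)) (ler_wpM2r (nrm_ge0 _ _) p1)) _.
  rewrite -mulrDr mulrAC ler_pdivrMr// ler_pM2l// -/a -/b.
  by rewrite lerDl.
(* [g i] is itself a limit of such partial derivatives, hence orthogonal to itself. *)
apply/eqP; rewrite -normr_le0; apply/ler_addgt0Pr => e e0; rewrite add0r.
have n0 : 0 < nrm (inner X) (g i) + 1 by rewrite ltr_wpDl// nrm_ge0.
have [p [sp p1 p2]] := H (e / (nrm (inner X) (g i) + 1)) (divr_gt0 e0 n0).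
have Lpi := partial_L2per i sp.
have -> : inner X (g i) (g i) = - inner X (g i) (partial i p - g i).
  by rewrite (si_Br si Lpi (Lg i) (Lg i)) orth// sub0r opprK.
rewrite normrN; apply: le_trans (nrm_cs si (Lg i) (si_memB si Lpi (Lg i))) _.
apply: le_trans (ler_wpM2l (nrm_ge0 _ _) (p2 i)) _.
by rewrite mulrA ler_pdivrMr// mulrC ler_pM2l// lerDl.
Qed.

Lemma is_grad_unique u (g h : 'I_d -> V -> R) i v : is_grad X u g -> is_grad X u h ->
  L2per X v -> inner X (g i) v = inner X (h i) v.
Proof.
move=> Gg Gh Lv; have := is_grad_lin (-1) Gh Gg; rewrite scaleN1r addNr => /is_grad0 => /(_ i).
have [_ Lg _] := Gg; have [_ Lh _] := Gh.
move=> n0; have LB : L2per X ((-1 *: h + g) i) := si_mem si (-1) (Lh i) (Lg i).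
have := si_null_l si LB Lv n0.
rewrite (_ : (-1 *: h + g) i = g i - h i); last by rewrite scaleN1r addrC.
by rewrite (si_Bl si (Lg i) (Lh i) Lv) => /eqP; rewrite subr_eq0 => /eqP.
Qed.

Lemma is_grad_grad u : H1per X u -> is_grad X u (grad X u).
Proof. by move=> [g Gg]; rewrite /grad; exact: (xgetPex _ (ex_intro _ g Gg)). Qed.

Lemma H1per_L2per u : H1per X u -> L2per X u. Proof. by move=> [g []]. Qed.

Definition dirichlet (g h : 'I_d -> V -> R) : R := \sum_(i < d) inner X (g i) (h i).

Lemma smooth_poincare : exists2 C : R, 0 <= C & forall psi, smooth_per X psi ->
  inner X (fun x => psi x - mean X psi) (fun x => psi x - mean X psi) <=
  C * dirichlet (partial^~ psi) (partial^~ psi).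
Proof.
have [C C0 hC] := poincare X0; exists C => // psi sp.
have := hC _ (smooth_C1 sp.1).
have Lp := smooth_per_L2per sp.
have Lm := L2per_sqint (L2per_subc (mean X psi) Lp).
have -> : (\int[mu]_(x in box X) ((psi x - mean X psi) ^+ 2)%:E)%E =
  (inner X (fun x => psi x - mean X psi) (fun x => psi x - mean X psi))%:E.
  by rewrite (inn_EFin mD Lm Lm).
have E i : (\int[mu]_(x in box X) ((partial i psi x) ^+ 2)%:E)%E =
    (inner X (partial i psi) (partial i psi))%:E.
  have Li := L2per_sqint (partial_L2per i sp).
  by rewrite (inn_EFin mD Li Li).
under eq_bigr do rewrite E.
by rewrite sumEFin -EFinM lee_fin.
Qed.

End gradients.
End periodic_L2.

Lemma ip_lim_cvg0 {R : realType} {H : lmodType R} (ip : H -> H -> R) (u : nat -> H) (l : H) :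
  (forall n, 0 <= ip (u n - l) (u n - l)) -> ip_lim ip u l ->
  ip (u n - l) (u n - l) @[n --> \oo] --> 0.
Proof.
move=> h0 h; apply/cvgrPdist_le => e e0; have [N hN] := h e e0.
by exists N => // n /= Nn; rewrite sub0r normrN ger0_norm// hN.
Qed.

(** * The inverse Laplacian and its quadratic form *)

Section inverse_laplacian.
Context {R : realType} {d : nat}.
Variable X : 'I_d -> R.
Hypothesis X0 : forall i, 0 < X i.
Local Notation V := 'rV[R]_d.
Local Notation mu := (@leb R d).
Implicit Types (u v w g h : V -> R).

Let mD := measurable_box X.
Let muD := leb_box_lty X.
Let si := L2per_semi X.
Local Notation ipX := (inner X).
Local Notation nrmX := (nrm (inner X)).

Lemma is_grad_seq u (g : 'I_d -> V -> R) : is_grad X u g ->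
  exists psi : nat -> V -> R, [/\ forall k, smooth_per X (psi k),
    nrmX (psi k - u) @[k --> \oo] --> 0 &
    forall i, nrmX (partial i (psi k) - g i) @[k --> \oo] --> 0].
Proof.
move=> /(is_gradP X _ _)[Lu Lg H].
have /choice[psi psiP] : forall k : nat, exists psi, [/\ smooth_per X psi,
    nrmX (psi - u) <= k.+1%:R^-1 & forall i, nrmX (partial i psi - g i) <= k.+1%:R^-1].
  by move=> k; apply: H; rewrite invr_gt0 ltr0n.
have c0 (a : nat -> R) : (forall k, 0 <= a k <= k.+1%:R^-1) -> a @ \oo --> 0.
  move=> h; apply: (@cvg_le_dist _ _ (fun k => k.+1%:R^-1)); last exact: cvg_harmonic.
  by move=> k; have /andP[h1 h2] := h k; rewrite subr0 ger0_norm.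
exists psi; split=> [k||i]; first by have [] := psiP k.
  by apply: c0 => k; rewrite nrm_ge0; have [] := psiP k.
by apply: c0 => k; rewrite nrm_ge0; have [_ _ ->] := psiP k.
Qed.

Lemma inner_cvg (p : nat -> V -> R) u v : (forall k, L2per X (p k)) -> L2per X u -> L2per X v ->
  nrmX (p k - u) @[k --> \oo] --> 0 -> ipX (p k) v @[k --> \oo] --> ipX u v.
Proof. by move=> *; exact: (ip_lim_cvg si). Qed.

Lemma inner_sq_cvg (p : nat -> V -> R) u : (forall k, L2per X (p k)) -> L2per X u ->
  nrmX (p k - u) @[k --> \oo] --> 0 -> ipX (p k) (p k) @[k --> \oo] --> ipX u u.
Proof.
move=> Lp Lu h; rewrite -(nrmE si Lu).
rewrite (_ : (fun k => _) = fun k => nrmX (p k) ^+ 2).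
  by apply: cvgM; exact: (nrm_lim_cvg si).
by apply/funext => k; rewrite (nrmE si).
Qed.

Lemma grad_poincare : exists2 C : R, 0 < C & forall u (g : 'I_d -> V -> R), is_grad X u g -> mean X u = 0 ->
  ipX u u <= C * dirichlet X g g.
Proof.
(* The added 1 makes the constant positive, so that it can be divided by. *)
have [C C0 hC] := smooth_poincare X0; exists (C + 1) => [|u g Gu mu0].
  by rewrite ltr_wpDl.
have [Lu Lg _] := Gu; have [psi [sp cu cg]] := is_grad_seq Gu.
have Lp k := smooth_per_L2per (sp k); have Lpi i k := partial_L2per i (sp k).
have D0 : 0 <= dirichlet X g g by apply: sumr_ge0 => i _; exact: (si_ge0 si).
apply: (@le_trans _ _ (C * dirichlet X g g)); last by rewrite ler_wpM2r// lerDl.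
have Lm k : L2per X (fun x => psi k x - mean X (psi k)) := L2per_subc _ (Lp k).
apply: (@cvg_seq_le _ (fun k => ipX (fun x => psi k x - mean X (psi k)) (fun x => psi k x - mean X (psi k)))
   (fun k => C * dirichlet X (partial^~ (psi k)) (partial^~ (psi k)))).
- by move=> k; exact: hC.
- apply: inner_sq_cvg => //.
  apply: (@cvg_le_dist _ _ (fun k => nrmX (psi k - u))) => // k.
  rewrite subr0 ger0_norm ?nrm_ge0//.
  (* As [u] has mean 0, the mean-free part of [psi k] minus [u] is the mean-free part of
     [psi k - u], whose norm is no larger. *)
  apply: le_trans (nrm_sub_mean X0 (si_memB si (Lp k) Lu)).
  have Em : mean X (psi k - u) = mean X (psi k).
    by rewrite addrC -scaleN1r (mean_lin X0)// mu0 mulr0 add0r.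
  rewrite Em le_eqVlt; apply/orP; left; apply/eqP; congr (nrm _ _).
  by apply/funext => x; rewrite !fctE addrAC.
- apply: cvgMr; apply: cvg_sum_seq => i; apply: inner_sq_cvg => //; exact: Lpi.
Qed.

(** The Sobolev space is encoded by the graph of the gradient: the gradient is part of the vector,
    so the linear structure does not involve the selection made by [grad]. *)
Definition mean0_grad : set ((V -> R) * ('I_d -> V -> R)) :=
  fun p => is_grad X p.1 p.2 /\ mean X p.1 = 0.

Definition dirichlet_ip (p q : (V -> R) * ('I_d -> V -> R)) : R := dirichlet X p.2 q.2.

Lemma mean0_grad_semi : @semi_inner R ((V -> R) * ('I_d -> V -> R))%type mean0_grad dirichlet_ip.
Proof.
split.
- move=> a [u g] [v h] [/= Gp mp] [/= Gq mq].
  have -> : a *: (u, g) + (v, h) = (a *: u + v, a *: g + h) by [].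
  split=> /=; first exact: (is_grad_lin a Gp Gq).
  have [Lp _ _] := Gp; have [Lq _ _] := Gq.
  by rewrite (mean_lin X0)// mp mq mulr0 addr0.
- split; last exact: mean_cst.
  have := smooth_semi_is_grad (smooth_per_cst X 0).
  rewrite (_ : partial^~ _ = 0)//; apply/funext => i; apply/funext => x.
  by rewrite /partial derive_cst.
- move=> p q [[_ Lp _] _] [[_ Lq _] _]; apply: eq_bigr => i _; exact: (si_sym si).
- move=> a p q r [[_ Lp _] _] [[_ Lq _] _] [[_ Lr _] _].
  rewrite /dirichlet_ip /dirichlet mulr_sumr -big_split /=; apply: eq_bigr => i _.
  exact: (si_lin si).
- by move=> p [[_ Lp _] _]; apply: sumr_ge0 => i _; exact: (si_ge0 si).
Qed.

(** The Dirichlet product sees gradients only; Poincare makes the functions Cauchy too. The limits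
    form a pair again because a smooth function e/2-close to [p N] is e-close to them. *)
Lemma mean0_grad_complete : ip_complete mean0_grad dirichlet_ip.
Proof.
move=> p Gp cp; have sG := mean0_grad_semi.
have [C C0 hC] := grad_poincare.
have Lg n i : L2per X ((p n).2 i) by have [[_ h _] _] := Gp n; exact: h.
have Lu n : L2per X (p n).1 by have [[h _ _] _] := Gp n; exact: h.
have ge0 n m i : 0 <= ipX ((p n).2 i - (p m).2 i) ((p n).2 i - (p m).2 i).
  by apply: (si_ge0 si); apply: (si_memB si).
have cauchy_i i : ip_cauchy ipX (fun n => (p n).2 i).
  move=> e e0; have [N hN] := cp _ e0; exists N => m n Nm Nn.
  apply: le_trans (hN m n Nm Nn); rewrite /dirichlet_ip /dirichlet (bigD1 i)//= lerDl.
  by apply: sumr_ge0 => j _; exact: ge0.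
have cauchy_u : ip_cauchy ipX (fun n => (p n).1).
  move=> e e0; have [N hN] := cp _ (divr_gt0 e0 C0); exists N => m n Nm Nn.
  have [Gd md] := si_memB sG (Gp m) (Gp n).
  apply: le_trans (hC _ _ Gd md) _.
  by have := hN m n Nm Nn; rewrite ler_pdivlMr// mulrC.
have /choice[g /all_and2[Lgl gl]] : forall i, exists l, L2per X l /\ ip_lim ipX (fun n => (p n).2 i) l.
  by move=> i; have [l Ll ll] := L2per_complete (Lg^~ i) (cauchy_i i); exists l.
have [w Lw wl] := L2per_complete Lu cauchy_u.
have wl' := (ip_limP si Lu Lw).1 wl.
exists (w, g); first split => /=.
- apply/(is_gradP X _ _); split=> // e e0; have e2 : 0 < e / 2 by rewrite divr_gt0.
  have c2 : (nrmX ((p n).1 - w) + \sum_(i < d) nrmX ((p n).2 i - g i)) @[n --> \oo] --> 0.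
    rewrite -[X in _ --> X](addr0 0); apply: cvgD => //.
    rewrite -[X in _ --> X](_ : \sum_(i < d) 0 = 0); last by rewrite big1.
    by apply: cvg_sum_seq => i; exact: (ip_limP si (Lg^~ i) (Lgl i)).1.
  have [N hN] := cvg0_le e2 c2; have {}hN := hN _ (leqnn N).
  have [/(is_gradP X _ _)[_ _ /(_ _ e2)[psi [sp p1 p2]]] _] := Gp N.
  exists psi; split=> // [|i].
    apply: le_trans (nrm_triangle si (smooth_per_L2per sp) (Lu N) Lw) _.
    rewrite [leRHS]splitr lerD// (le_trans _ hN)// lerDl.
    by apply: sumr_ge0 => i _; exact: nrm_ge0.
  apply: le_trans (nrm_triangle si (partial_L2per i sp) (Lg N i) (Lgl i)) _.
  rewrite [leRHS]splitr lerD// (le_trans _ hN)// (bigD1 i)//= addrCA lerDl.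
  by rewrite addr_ge0 ?nrm_ge0// sumr_ge0// => j _; exact: nrm_ge0.
- have L1 := L2per_cst X 1.
  have := inner_cvg Lu Lw L1 wl'.
  rewrite (_ : (fun k => _) = fun=> 0); last first.
    by apply/funext => n; rewrite (inner_cst1 X0)// (Gp n).2 mul0r.
  move=> h; have : 0 = mean X w * vol X.
    by rewrite -(inner_cst1 X0 Lw); apply: cvg_seq_unique h; exact: cvg_cst.
  by move/esym/eqP; rewrite mulf_eq0 (gt_eqF (vol_gt0 X0)) orbF => /eqP.
move=> e e0.
have c2 : (\sum_(i < d) ipX ((p n).2 i - g i) ((p n).2 i - g i)) @[n --> \oo] --> 0.
  rewrite -[X in _ --> X](_ : \sum_(i < d) 0 = 0); last by rewrite big1.
  apply: cvg_sum_seq => i; apply: ip_lim_cvg0 (gl i) => n.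
  by apply: (si_ge0 si); exact: (si_memB si).
exact: cvg0_le e0 c2.
Qed.

Lemma Rintegral_dirichlet (g h : 'I_d -> V -> R) :
  (forall i, L2per X (g i)) -> (forall i, L2per X (h i)) ->
  \int[mu]_(x in box X) (\sum_(i < d) g i x * h i x) = dirichlet X g h.
Proof.
move=> Lg Lh.
have ih i : intg mu (box X) (fun x => g i x * h i x).
  by apply: sqint_mul => //; exact: L2per_sqint.
rewrite /dirichlet; elim: (index_enum _) => [|i s IH].
  by under eq_Rintegral do rewrite big_nil; rewrite big_nil Rintegral_cst// mul0r.
have is_ : intg mu (box X) (fun x => \sum_(i <- s) g i x * h i x).
  exact: (@intg_sum _ _ _ mu _ mD muD _ s (fun i x => g i x * h i x) ih).
under eq_Rintegral do rewrite big_cons; rewrite big_cons RintegralD//; first by rewrite IH.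
exact: ih.
Qed.

(** Smooth test functions are replaced by [H1per] ones by density, so that the time steps themselves
    can serve as test functions. *)
Lemma laplacian_test u w v : is_laplacian X u w -> H1per X v ->
  dirichlet X (grad X u) (grad X v) = - ipX w v.
Proof.
move=> [Hu Lw uw] Hv.
have [Lu Lgu _] := is_grad_grad Hu; have [Lv Lgv _] := is_grad_grad Hv.
have [psi [sp cu cg]] := is_grad_seq (is_grad_grad Hv).
have h1 : dirichlet X (grad X u) (partial^~ (psi k)) @[k --> \oo] --> dirichlet X (grad X u) (grad X v).
  apply: cvg_sum_seq => i; rewrite (si_sym si)//.
  rewrite (_ : (fun k => _) = fun k => ipX (partial i (psi k)) (grad X u i)).
    by apply: inner_cvg => // k; exact: partial_L2per.
  by apply/funext => k; rewrite (si_sym si)//; exact: partial_L2per.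
apply: (cvg_seq_unique h1).
rewrite (_ : (fun k => _) = fun k => - ipX (psi k) w).
  rewrite (si_sym si)//; apply: cvgN; apply: inner_cvg => // k; exact: smooth_per_L2per.
apply/funext => k; have Lp := smooth_per_L2per (sp k).
rewrite (si_sym si Lp Lw) -uw// Rintegral_dirichlet// => i; exact: partial_L2per.
Qed.

Lemma is_invlap_exists g : L2per X g -> exists u, is_invlap X g u.
Proof.
move=> Lg; have sG := mean0_grad_semi; have [C C0 hC] := grad_poincare.
pose l (p : (V -> R) * ('I_d -> V -> R)) := ipX g p.1.
have llin a p q : mean0_grad p -> mean0_grad q -> l (a *: p + q) = a * l p + l q.
  case: p q => [u h] [v k] [[/= Lu _ _] _] [[/= Lv _ _] _]; rewrite /l /=.
  by rewrite (si_Dr si (si_memZ si a Lu) Lv Lg) (si_Zr si _ Lu Lg).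
have lC p : mean0_grad p -> `|l p| <= nrmX g * Num.sqrt C * nrm dirichlet_ip p.
  case: p => [u h] Gp; have [/= Gu mu0] := Gp; have [Lu _ _] := Gu.
  apply: le_trans (nrm_cs si Lg Lu) _; rewrite -mulrA ler_wpM2l ?nrm_ge0//.
  rewrite /nrm -sqrtrM; last exact: ltW.
  by rewrite ler_wsqrtr//; exact: hC Gu mu0.
have [[u h] [/= Gu mu0] Gv] := riesz sG mean0_grad_complete llin lC.
have [Lu Lh _] := Gu.
have Hu : H1per X u by exists h.
have [_ Lgu _] := is_grad_grad Hu.
have Lgm : L2per X (fun x => - (g x - mean X g)).
  have := si_memN si (L2per_subc (mean X g) Lg).
  by rewrite (_ : - (fun x => g x - mean X g) = fun x => - (g x - mean X g)).
exists u; split=> //; split=> // psi sp.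
have Lp := smooth_per_L2per sp.
rewrite Rintegral_dirichlet//; last by move=> i; exact: partial_L2per.
(* Riesz only tests mean-free functions. Subtracting its mean from [psi] keeps the partial
   derivatives, and <g, psi - mean psi> = <g - mean g, psi>. *)
have Gp := is_grad_sub_cst (mean X psi) (smooth_semi_is_grad sp).
have mp : mean X (fun x => psi x - mean X psi) = 0.
  have := mean_lin X0 (-1) (L2per_cst X (mean X psi)) Lp.
  rewrite (mean_cst X0) mulN1r addNr => h0; rewrite -[RHS]h0; congr (mean X _).
  by apply/funext => x; rewrite !fctE scaleN1r addrC.
transitivity (dirichlet X h (partial^~ psi)).
  apply: eq_bigr => i _; apply: (is_grad_unique X0 i (is_grad_grad Hu) Gu).
  exact: partial_L2per.
have := Gv (fun x => psi x - mean X psi, partial^~ psi) (conj Gp mp).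
rewrite /dirichlet_ip /= => ->; rewrite /l /=.
have -> : (fun x => psi x - mean X psi) = psi - (fun=> mean X psi) by [].
have -> : (fun x => - (g x - mean X g)) = - (g - (fun=> mean X g)) by [].
have Lc c := L2per_cst X c.
rewrite (si_Br si Lp (Lc _) Lg) (si_Nl si (si_memB si Lg (Lc _)) Lp) opprK.
rewrite (si_Bl si Lg (Lc _) Lp) (si_sym si (Lc (mean X g)) Lp).
by rewrite !(inner_cst X0)//; ring.
Qed.

Lemma invlapP g : L2per X g -> is_invlap X g (invlap X g).
Proof. by move=> /is_invlap_exists h; rewrite /invlap; exact: (xgetPex _ h). Qed.

Lemma invlap_L2per g : L2per X g -> L2per X (invlap X g).
Proof. by move=> /invlapP[[/H1per_L2per]]. Qed.

Lemma invlap_test g v : L2per X g -> H1per X v ->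
  dirichlet X (grad X (invlap X g)) (grad X v) = ipX g v - mean X g * (mean X v * vol X).
Proof.
move=> Lg Hv; have [lap _] := invlapP Lg; have Lv := H1per_L2per Hv.
rewrite (laplacian_test lap Hv).
have -> : (fun x => - (g x - mean X g)) = - (g - (fun=> mean X g)) by [].
have Lc c := L2per_cst X c.
rewrite (si_Nl si (si_memB si Lg (Lc _)) Lv) opprK (si_Bl si Lg (Lc _) Lv).
by rewrite (si_sym si (Lc (mean X g)) Lv) (inner_cst X0).
Qed.

Lemma dirichlet_sym (g h : 'I_d -> V -> R) : (forall i, L2per X (g i)) ->
  (forall i, L2per X (h i)) -> dirichlet X g h = dirichlet X h g.
Proof. by move=> Lg Lh; apply: eq_bigr => i _; exact: (si_sym si (Lg i) (Lh i)). Qed.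

(** The equation of A h is tested with A g, which has mean 0. The right-hand side displays symmetry
    and nonnegativity at once. *)
Lemma invlap_ip g h : L2per X g -> L2per X h ->
  ipX (invlap X g) h = dirichlet X (grad X (invlap X g)) (grad X (invlap X h)).
Proof.
move=> Lg Lh; have [[Hg _ _] _] := invlapP Lg; have [[Hh _ _] mh] := invlapP Lh.
have [[_ Lgg _] [_ Lgh _]] := (is_grad_grad Hg, is_grad_grad Hh).
have [_ mg] := invlapP Lg.
rewrite (dirichlet_sym Lgg Lgh).
rewrite (invlap_test Lh Hg) mg mul0r mulr0 subr0 (si_sym si)//.
exact: H1per_L2per.
Qed.

Lemma invlap_sym : sym_op (L2per X : set (V -> R)) ipX (invlap X).
Proof.
split=> [g|g h Lg Lh]; first exact: invlap_L2per.
rewrite (invlap_ip Lg Lh) (si_sym si Lg (invlap_L2per Lh)) (invlap_ip Lh Lg).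
have [[Hg _ _] _] := invlapP Lg; have [[Hh _ _] mh] := invlapP Lh.
have [[_ Lgg _] [_ Lgh _]] := (is_grad_grad Hg, is_grad_grad Hh).
exact: dirichlet_sym.
Qed.

Lemma invlap_ge0 g : L2per X g -> 0 <= ipX (invlap X g) g.
Proof.
move=> Lg; rewrite (invlap_ip Lg Lg); have [[Hg _ _] _] := invlapP Lg.
by have [_ Lgg _] := is_grad_grad Hg; apply: sumr_ge0 => i _; exact: (si_ge0 si).
Qed.

(** With q = <A g, g>, which is also the Dirichlet energy of A g, Cauchy-Schwarz and Poincare give
    q^2 <= C q |g|^2. *)
Lemma invlap_le : exists2 C : R, 0 < C & forall g, L2per X g ->
  ipX (invlap X g) g <= C * ipX g g.
Proof.
have [C C0 hC] := grad_poincare; exists C => // g Lg.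
have [[Hg _ _] mg] := invlapP Lg; have LA := invlap_L2per Lg.
have := hC _ _ (is_grad_grad Hg) mg; rewrite -(invlap_ip Lg Lg) => h.
have cs := si_cauchy_schwarz si LA Lg; have q0 := invlap_ge0 Lg.
have g0 := si_ge0 si Lg.
set q := ipX (invlap X g) g in h cs q0 *.
have [->|qn] := eqVneq q 0; first by rewrite mulr_ge0// ltW.
have qp : 0 < q by rewrite lt_neqAle eq_sym qn.
rewrite -(ler_pM2r qp) -expr2; apply: le_trans cs _.
by rewrite mulrAC ler_wpM2r.
Qed.

Lemma invlap_half_sqrt : is_nonneg_sqrt X (invlap X) (invlap_half X).
Proof.
rewrite /invlap_half; apply: xgetPex.
have [C C0 hC] := invlap_le.
have [B [LB symB] [B0 BB]] := exists_sqrt_op si (@L2per_complete _ _ X) invlap_sym invlap_ge0 C0 hC.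
exists B; split=> // g Lg.
have L1 : L2per X (B (B g) - invlap X g).
  by apply: (si_memB si); [exact/LB/LB|exact: invlap_L2per].
have n0 : ipX (B (B g) - invlap X g) (B (B g) - invlap X g) = 0.
  by rewrite (si_Bl si (LB _ (LB _ Lg)) (invlap_L2per Lg) L1) (BB _ _ Lg L1) subrr.
have := inn_null mD (L2per_sqint L1) n0.
by apply: filterS => x h Bx; apply/eqP; rewrite -subr_eq0; apply/eqP/h.
Qed.

(** For a symmetric square root B, |B g|^2 = <B B g, g>, so the value does not depend on the root
    that was selected. *)
Lemma invlap_half_energy g : L2per X g ->
  \int[mu]_(x in box X) (`|invlap_half X g x| ^+ 2) = ipX (invlap X g) g.
Proof.
move=> Lg; have [LB symB B0 BB] := invlap_half_sqrt.
transitivity (ipX (invlap_half X g) (invlap_half X g)).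
  by apply: eq_Rintegral => x _; rewrite real_normK ?num_real// expr2.
rewrite (symB _ _ Lg (LB _ Lg)).
rewrite (si_sym si Lg (LB _ (LB _ Lg))).
have mB := sqint_mf (L2per_sqint (LB _ (LB _ Lg))).
have mA := sqint_mf (L2per_sqint (invlap_L2per Lg)).
have mg := sqint_mf (L2per_sqint Lg).
exact: (ae_eq_inn mD mB mA mg mg (BB _ Lg) (ae_eq_refl _ _ _)).
Qed.

(** Constants are orthogonal to the range of A, which consists of mean-free functions. *)
Lemma invlap_addc g (c : R) h : L2per X g -> L2per X h ->
  ipX (invlap X (fun x => g x + c)) h = ipX (invlap X g) h.
Proof.
move=> Lg Lh; have LA := invlap_L2per Lh; have [_ mh] := invlapP Lh.
apply: (sym_op_addl si invlap_sym Lg (L2per_cst X c) Lh).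
by rewrite (si_sym si (L2per_cst X c) LA) (inner_cst X0)// mh mul0r mulr0.
Qed.

End inverse_laplacian.

(** * Bounds from the L^oo operator norm *)

Section clamp.
Context {R : realType}.
Implicit Types (a b s t : R).

Definition clamp a b s := Num.max a (Num.min s b).

Variables a b : R.
Hypothesis ab : a <= b.

Variant clamp_spec s : R -> Type :=
  | ClampLow of s < a : clamp_spec s a
  | ClampMid of a <= s & s <= b : clamp_spec s s
  | ClampHigh of b < s : clamp_spec s b.

Lemma clampP s : clamp_spec s (clamp a b s).
Proof.
rewrite /clamp; have [sb|bs] := leP s b; last first.
  by rewrite max_r//; exact: ClampHigh.
by have [sa|as_] := ltP s a; [exact: ClampLow|exact: ClampMid].
Qed.

Lemma clamp_in s : a <= clamp a b s /\ clamp a b s <= b.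
Proof. by case: clampP => [h|h1 h2|h]; split. Qed.

Lemma measurable_clamp : measurable_fun [set: R] (clamp a b).
Proof. by apply: measurable_maxr => //; exact: measurable_minr. Qed.

Lemma clamp_lip s t : `|clamp a b t - clamp a b s| <= `|t - s|.
Proof.
have ab' := ab.
rewrite ler_norml; have := ler_norm (t - s); have := ler_norm (- (t - s)).
rewrite normrN => n1 n2; case: (clampP s) => [hs|hs1 hs2|hs];
  by case: (clampP t) => [ht|ht1 ht2|ht]; apply/andP; split; lra.
Qed.

Lemma clamp_excess_lip s t :
  `|(t - clamp a b t) - (s - clamp a b s)| <= `|t - s|.
Proof.
have ab' := ab.
rewrite ler_norml; have := ler_norm (t - s); have := ler_norm (- (t - s)).
rewrite normrN => n1 n2; case: (clampP s) => [hs|hs1 hs2|hs];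
  by case: (clampP t) => [ht|ht1 ht2|ht]; apply/andP; split; lra.
Qed.

Lemma clamp_excess s t :
  clamp a b t = clamp a b s \/ `|t - clamp a b t| <= `|t - s|.
Proof.
have ab' := ab.
rewrite ler_norml; have := ler_norm (t - s); have := ler_norm (- (t - s)).
rewrite normrN => n1 n2; case: (clampP s) => [hs|hs1 hs2|hs];
  case: (clampP t) => [ht|ht1 ht2|ht]; try (by left);
  by right; apply/andP; split; lra.
Qed.

(** Either the clamp does not move or the excess of [t] is at most |t - s|; either way the product
    is of second order. This yields quadratic remainders across the junctions of functions extended
    beyond a clamp. *)
Lemma clamp_defect s t :
  `|clamp a b t - clamp a b s| * `|t - clamp a b t| <= (t - s) ^+ 2.
Proof.
have [->|h] := clamp_excess s t; first by rewrite subrr normr0 mul0r sqr_ge0.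
by rewrite -real_normK ?num_real// expr2 ler_pM// clamp_lip.
Qed.

End clamp.

Section symmetric_clamp.
Context {R : realType}.
Variable c : R.
Hypothesis c0 : 0 <= c.
Implicit Types s : R.

Let cc : - c <= c. Proof. by rewrite (le_trans _ c0)// oppr_le0. Qed.

Lemma clamp_norm_le s : `|clamp (- c) c s| <= c.
Proof. by rewrite ler_norml; have [-> ->] := clamp_in cc s. Qed.

Lemma clamp_id s : `|s| <= c -> clamp (- c) c s = s.
Proof. by rewrite ler_norml /clamp => /andP[h1 h2]; rewrite min_l// max_r. Qed.

Let clamp0 : clamp (- c) c 0 = 0.
Proof. by rewrite clamp_id// normr0. Qed.

Lemma clamp_norm s : `|clamp (- c) c s| <= `|s|.
Proof. by have := clamp_lip cc 0 s; rewrite clamp0 !subr0. Qed.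

Lemma clamp_dist s : `|clamp (- c) c s - s| <= `|s|.
Proof. by have := clamp_excess_lip cc 0 s; rewrite clamp0 !subr0 distrC. Qed.

End symmetric_clamp.

Lemma ae_mono d (T : measurableType d) (R : realType) (mu : {measure set T -> \bar R})
  (P Q : T -> Prop) : {ae mu, forall x, P x} -> (forall x, P x -> Q x) ->
  {ae mu, forall x, Q x}.
Proof. by move=> hP PQ; apply: filterS hP => x; exact: PQ. Qed.

Lemma ae_and d (T : measurableType d) (R : realType) (mu : {measure set T -> \bar R})
  (P Q : T -> Prop) : {ae mu, forall x, P x} -> {ae mu, forall x, Q x} ->
  {ae mu, forall x, P x /\ Q x}.
Proof. by move=> hP hQ; apply: filterS2 hP hQ => x; split. Qed.

Section ae_integrals.
Context {d} {T : measurableType d} {R : realType}.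
Variables (mu : {measure set T -> \bar R}) (D : set T).
Hypothesis mD : measurable D.

Lemma ae_le_Rintegral (f g : T -> R) : intg mu D f -> intg mu D g ->
  {ae mu, forall x, D x -> f x <= g x} ->
  \int[mu]_(x in D) f x <= \int[mu]_(x in D) g x.
Proof.
move=> fi gi fg.
have mf : measurable_fun D f by apply/measurable_EFinP; exact: measurable_int fi.
have mg : measurable_fun D g by apply/measurable_EFinP; exact: measurable_int gi.
have hi : intg mu D (fun x => Num.max (f x) (g x)).
  apply: (@le_integrable _ _ _ _ _ mD _ (fun x => (`|f x| + `|g x|)%:E)).
  - by apply/measurable_EFinP; exact: measurable_maxr.
  - move=> x _ /=; rewrite lee_fin [leRHS]ger0_norm ?addr_ge0//.
    by case: (leP (f x) (g x)) => _; [rewrite lerDr|rewrite lerDl].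
  - exact: (integrableD mD (integrable_norm fi) (integrable_norm gi)).
have -> : \int[mu]_(x in D) g x = \int[mu]_(x in D) Num.max (f x) (g x).
  rewrite /Rintegral; congr fine; apply: ae_eq_integral => //.
  - exact/measurable_EFinP.
  - by apply/measurable_EFinP; exact: measurable_maxr.
  by apply: filterS fg => x h Dx /=; rewrite max_r// h.
by apply: le_Rintegral => // x _; rewrite le_max lexx.
Qed.

Lemma dct0 (f : nat -> T -> R) (G : T -> R) : intg mu D G ->
  (forall n, measurable_fun [set: T] (f n)) -> (forall n x, D x -> `|f n x| <= G x) ->
  (forall x, D x -> f n x @[n --> \oo] --> 0) ->
  \int[mu]_(x in D) f n x @[n --> \oo] --> 0.
Proof.
move=> Gi mf fG f0.
have [|||||_ _] := @dominated_convergence _ _ _ mu D mD (fun n x => (f n x)%:E) (cst 0%E) (EFin \o G).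
- by move=> n; apply/measurable_EFinP; exact: measurable_funTS.
- exact: measurable_cst.
- by apply: nearW => x Dx; apply: cvg_EFin; [exact: nearW|exact: f0].
- by [].
- by apply: nearW => x n Dx; rewrite /= lee_fin fG.
rewrite integral0_eq//= => h.
have := fine_cvg h; exact.
Qed.

End ae_integrals.

Section Linf_bounds.
Context {R : realType} {d : nat}.
Variable X : 'I_d -> R.
Hypothesis X0 : forall i, 0 < X i.
Local Notation V := 'rV[R]_d.
Local Notation mu := (@leb R d).
Implicit Types (u v w g h : V -> R).

Let mD := measurable_box X.
Let muD := leb_box_lty X.
Let si := L2per_semi X.
Local Notation ipX := (inner X).
Local Notation nrmX := (nrm (inner X)).

Definition ae_bound g (c : R) := {ae mu, forall x, box X x -> `|g x| <= c}.

Lemma Linf_norm_le u (c : R) : 0 <= c -> (Linf_norm X u <= c%:E)%E <-> ae_bound u c.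
Proof.
move=> c0; rewrite /Linf_norm unlock.
have muT : (0 < mu [set: V])%E.
  by apply: lt_le_trans (leb_box_gt0 X0) _; apply: le_measure; rewrite ?inE//; exact: measurable_box.
rewrite muT; split.
  move=> /ess_supP; apply: filterS => x /= + Bx.
  by rewrite patchE mem_set//= lee_fin.
move=> h; apply/ess_supP; apply: (ae_mono h) => {}x {}h /=.
rewrite patchE; case: ifPn => [/set_mem Bx|_] /=; first by rewrite lee_fin h.
by rewrite normr0 lee_fin.
Qed.

Lemma ip_ext_ae u v : L2per X u -> L2per X v ->
  (forall z, L2per X z -> ipX u z = ipX v z) -> ae_eq_box X u v.
Proof.
move=> Lu Lv h; have LB := si_memB si Lu Lv.
have n0 : ipX (u - v) (u - v) = 0 by rewrite (si_Bl si Lu Lv LB) h// subrr.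
have := inn_null mD (L2per_sqint LB) n0.
by apply: filterS => x h' Bx; apply/eqP; rewrite -subr_eq0; apply/eqP/h'.
Qed.

Lemma ae_bound_ip w h (c : R) : L2per X w -> L2per X h -> ae_bound w c ->
  ipX w h <= c * \int[mu]_(x in box X) `|h x|.
Proof.
move=> Lw Lh wc; have sw := L2per_sqint Lw; have sh := L2per_sqint Lh.
have ih := sqint_intg mD muD (sqint_abs sh).
rewrite -RintegralZl//; apply: ae_le_Rintegral => //.
- exact: sqint_mul.
- exact: intgZ.
apply: (ae_mono wc) => x h1 Bx; apply: le_trans (ler_norm _) _.
by rewrite normrM ler_wpM2r// h1.
Qed.

Lemma invlap_scale (c : R) g : L2per X g ->
  ae_eq_box X (invlap X (c *: g)) (c *: invlap X g).
Proof.
move=> Lg; have [LA sA] := invlap_sym X0; have Lcg := si_memZ si c Lg.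
apply: ip_ext_ae; [exact: LA|exact: (si_memZ si c (LA _ Lg))|move=> z Lz].
rewrite (sA _ _ Lcg Lz) (si_Zl si c Lg (LA _ Lz)) (si_Zl si c (LA _ Lg) Lz).
by rewrite (sA _ _ Lg Lz).
Qed.

Variable N : R.
Hypothesis N0 : 0 <= N.
Hypothesis NP : (invlap_Linf_norm X <= N%:E)%E.

Lemma invlap_bound g (c : R) : 0 <= c -> L2per X g -> ae_bound g c ->
  ae_bound (invlap X g) (N * c).
Proof.
move=> c0 Lg gc; have [LA sA] := invlap_sym X0.
(* A zero bound cannot be normalised to the unit ball; in that case [g] is null and so is its
   image. *)
have [c00|cn0] := eqVneq c 0.
  rewrite c00 mulr0.
  have g0 : ae_eq mu (box X) g (fun=> 0).
    by apply: (ae_mono gc) => x h Bx; apply/eqP; rewrite -normr_le0 -c00 h.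
  have := null_inn mD (sqint_mf (L2per_sqint Lg)) g0 => gg0.
  have : ae_eq_box X (invlap X g) (fun=> 0).
    apply: ip_ext_ae; [exact: LA|exact: L2per_cst|move=> z Lz].
    rewrite (sA _ _ Lg Lz) (si_null_l si Lg (LA _ Lz) gg0).
    by rewrite (si_0l si Lz).
  by move=> /ae_mono; apply => x h Bx; rewrite h// normr0.
have cp : 0 < c by rewrite lt_neqAle eq_sym cn0.
have Lg' := si_memZ si c^-1 Lg.
have b1 : ae_bound (c^-1 *: g) 1.
  apply: (ae_mono gc) => x h Bx; rewrite fctE /GRing.scale /= normrM.
  by rewrite ger0_norm ?invr_ge0// mulrC ler_pdivrMr// mul1r h.
have n1 : (Linf_norm X (c^-1 *: g) <= 1)%E by apply/Linf_norm_le.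
have Lp : Linfper X (c^-1 *: g).
  split; [exact: sqint_mf (L2per_sqint Lg')|by have [] := Lg'|].
  by apply: le_lt_trans n1 _; rewrite ltry.
have : (Linf_norm X (invlap X (c^-1 *: g)) <= N%:E)%E.
  by apply: le_trans NP; apply: ereal_sup_ubound; exists (c^-1 *: g).
move=> /(Linf_norm_le _ N0) bA.
have eA := invlap_scale c Lg'.
rewrite scalerA mulfV// scale1r in eA.
have bA_eA : {ae mu, forall x, (box X x -> `|invlap X (c^-1 *: g) x| <= N) /\
    (box X x -> invlap X g x = (c *: invlap X (c^-1 *: g)) x)}.
  exact: ae_and bA eA.
apply: (ae_mono bA_eA) => x [h1 h2] Bx; rewrite h2// fctE /GRing.scale /= normrM ger0_norm// mulrC ler_wpM2r//.
exact: h1.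
Qed.

Lemma invlap_bound_iter k g (c : R) : 0 <= c -> L2per X g -> ae_bound g c ->
  L2per X (iter k (invlap X) g) /\ ae_bound (iter k (invlap X) g) (N ^+ k * c).
Proof.
move=> c0 Lg gc; elim: k => [|k [Lk bk]]; first by rewrite expr0 mul1r.
split; first exact: (invlap_sym X0).1.
by rewrite iterS exprS -mulrA; apply: invlap_bound => //; rewrite mulr_ge0// exprn_ge0.
Qed.

(** Pairing the L^oo bound of A^k x with the L^1 norm of x bounds the k-th moment by a constant
    times N^k, and the moment bound discards that constant. *)
Lemma invlap_quad_bounded x (c : R) : 0 <= c -> L2per X x -> (forall y, `|x y| <= c) ->
  ipX (invlap X x) x <= N * ipX x x.
Proof.
move=> c0 Lx xc.
have bx : ae_bound x c by apply: nearW => y _.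
apply: (sym_op_moment_bound si (invlap_sym X0) (invlap_ge0 X0) Lx N0
  (K := c * \int[mu]_(y in box X) `|x y|)) => k.
have [Lk bk] := invlap_bound_iter k c0 Lx bx.
by rewrite mulrC mulrA; exact: ae_bound_ip.
Qed.

Lemma invlap_nrm : exists2 C : R, 0 < C & forall g, L2per X g ->
  nrmX (invlap X g) <= C * nrmX g.
Proof.
have [C C0 hC] := invlap_le X0; exists C => // g Lg.
have [LA sA] := invlap_sym X0.
rewrite -ler_sqr ?nnegrE ?mulr_ge0 ?nrm_ge0//; last exact: ltW.
rewrite exprMn (nrmE si (LA _ Lg)) (nrmE si Lg).
apply: le_trans (sym_op_sq_le si (invlap_sym X0) (invlap_ge0 X0) (ltW C0) hC Lg) _.
by rewrite exprS expr1 -mulrA ler_wpM2l ?hC// ltW.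
Qed.

(** Truncations at height n converge to x in L^2, and the bound for bounded functions does not
    depend on the height. *)
Lemma invlap_quad x : L2per X x -> ipX (invlap X x) x <= N * ipX x x.
Proof.
move=> Lx; have [LA sA] := invlap_sym X0; have [C C0 hC] := invlap_nrm.
pose xn n := clamp (- n%:R) n%:R \o x.
have Lxn n : L2per X (xn n).
  apply: L2per_comp => //; first exact: measurable_clamp.
  by exists 0, 1 => s; rewrite add0r mul1r clamp_norm.
have xn_cvg0 : ipX (xn n - x) (xn n - x) @[n --> \oo] --> 0.
  apply: (@dct0 _ _ _ mu (box X) mD (fun n y => (xn n y - x y) * (xn n y - x y)) (fun y => x y ^+ 2)).
  - exact: (sqint_sq (L2per_sqint Lx)).
  - move=> n; have := sqint_mf (L2per_sqint (si_memB si (Lxn n) Lx)) => m.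
    exact: measurable_funM.
  - move=> n y _; rewrite -expr2 ger0_norm ?sqr_ge0// -real_normK ?num_real//.
    by rewrite -[leRHS]real_normK ?num_real// ler_sqr ?nnegrE// clamp_dist.
  - move=> y _; apply: cvg_near_cst; exists (Num.truncn `|x y|).+1 => // n /= hn.
    rewrite /xn /= clamp_id ?subrr ?mulr0//.
    by apply/ltW/(lt_le_trans (truncnS_gt _)); rewrite ler_nat.
have nxn : nrmX (xn n - x) @[n --> \oo] --> 0.
  by rewrite -[X in _ --> X]sqrtr0; apply: continuous_cvg => //; exact: sqrt_continuous.
have c1 := nrm_lim_cvg si Lxn Lx nxn.
have c2 := inner_sq_cvg Lxn Lx nxn.
have c3 : ipX (invlap X (xn n)) (xn n) @[n --> \oo] --> ipX (invlap X x) x.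
  apply: (@cvg_le_dist _ _ (fun n => nrmX (xn n - x) * (C * nrmX (xn n) + C * nrmX x))).
    move=> n; apply: le_trans (sym_op_quad_dist si (invlap_sym X0) (Lxn n) Lx) _.
    by apply: ler_wpM2l; [exact: nrm_ge0|apply: lerD; exact: hC].
  rewrite -[X in _ --> X](mul0r (C * nrmX x + C * nrmX x)); apply: cvgM => //.
  by apply: cvgD; [apply: cvgMr|exact: cvg_cst].
apply: (cvg_seq_le _ c3 (cvgM (cvg_cst N) c2)) => n.
apply: (invlap_quad_bounded (c := n%:R)) => // y; exact: clamp_norm_le.
Qed.

End Linf_bounds.

(** * The nonlinearities *)

Section real_calculus.
Context {R : realType}.
Implicit Types (g : R -> R) (C L s t : R).

(** Derivatives are obtained from quadratic remainders, so functions defined by cases need no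
    separate argument at their junctions. *)
Lemma quad_is_derive g d C s :
  (forall t, `|t - s| <= 1 -> `|g t - g s - d * (t - s)| <= C * (t - s) ^+ 2) ->
  is_derive s 1 g d.
Proof.
move=> gC; have C0 : 0 <= C.
  have e : s + 1 - s = 1 by ring.
  have := gC (s + 1); rewrite e normr1 expr1n !mulr1 => /(_ (lexx _)).
  exact: le_trans (normr_ge0 _).
suff gd : h^-1 *: ((g \o shift s) (h *: (1 : R)) - g s) @[h --> 0^'] --> d.
  by apply: DeriveDef; [apply: cvgP gd|exact: cvg_lim gd].
apply/cvgrPdist_le => e e0; near=> h.
have h0 : h != 0 by near: h; exact: nbhs_dnbhs_neq.
have h1 : `|h| <= 1 by near: h; apply: dnbhs0_le.
have hC : C * `|h| <= e.
  have he : `|h| <= e / (C + 1).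
    by near: h; apply: dnbhs0_le; rewrite divr_gt0// ltr_wpDl.
  move: he; rewrite ler_pdivlMr ?ltr_wpDl// => he.
  by apply: le_trans he; rewrite mulrC ler_wpM2l// lerDl.
rewrite /= /shift /= -![_ *: _]/(_ * _) mulr1.
have := gC (h + s); rewrite addrK => /(_ h1) gh.
have -> : d - h^-1 * (g (h + s) - g s) = - (h^-1 * (g (h + s) - g s - d * h)).
  by field.
rewrite normrN normrM normfV ler_pdivrMl ?normr_gt0//.
apply: le_trans gh _; rewrite -real_normK ?num_real// expr2.
by rewrite mulrA [leRHS]mulrC ler_wpM2r.
Unshelve. all: by end_near. Qed.

Lemma derive1_eq g (g1 : R -> R) : (forall s : R, is_derive s 1 g (g1 s)) -> derive1 g = g1.
Proof. by move=> gg; apply/funext => s; rewrite derive1E; exact: derive_val. Qed.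

Lemma MVT_any g (g1 : R -> R) s t : (forall u : R, is_derive u 1 g (g1 u)) ->
  exists th, [/\ 0 <= th, th <= 1 & g t - g s = g1 (s + th * (t - s)) * (t - s)].
Proof.
move=> gg.
have cg (a b : R) : {within `[a, b], continuous g}.
  apply: continuous_subspaceT => u; apply: differentiable_continuous.
  by apply/derivable1_diffP; have [] := gg u.
wlog st : s t / s < t.
  move=> H; have [/H//|/H|->] := ltgtP s t; last first.
    by exists 0; rewrite !subrr !mulr0; split.
  move=> [th [th0 th1 E]]; exists (1 - th); split; try lra.
  have -> : s + (1 - th) * (t - s) = t + th * (s - t) by ring.
  by rewrite -[LHS]opprB E -[in RHS](opprB s t) mulrN.
have [c] := MVT st (fun u _ => gg u) (cg s t).
rewrite in_itv /= => /andP[sc ct] E.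
have ts : 0 < t - s by lra.
exists ((c - s) / (t - s)); split.
- by rewrite divr_ge0//; lra.
- by rewrite ler_pdivrMr//; lra.
- have -> : s + (c - s) / (t - s) * (t - s) = c by rewrite divfK ?gt_eqF//; ring.
  exact: E.
Qed.

Lemma lip_of_derive g (g1 : R -> R) L : (forall u : R, is_derive u 1 g (g1 u)) ->
  (forall u : R, `|g1 u| <= L) -> forall s t, `|g t - g s| <= L * `|t - s|.
Proof.
move=> gg gL s t; have [th [_ _ ->]] := MVT_any s t gg.
by rewrite normrM ler_wpM2r.
Qed.

(** For e = 1 and e = -1, the function e (g(u) - g1(s) u) - (L/2) (u - s)^2 does not increase away
    from s, because g1 is L-Lipschitz; the mean value theorem concludes. *)
Lemma taylor_bound g (g1 g2 : R -> R) L : (forall u : R, is_derive u 1 g (g1 u)) ->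
  (forall u : R, is_derive u 1 g1 (g2 u)) -> (forall u : R, `|g2 u| <= L) ->
  forall s t, `|g t - g s - g1 s * (t - s)| <= L / 2 * (t - s) ^+ 2.
Proof.
move=> gg gg1 gL s t.
have lip := lip_of_derive gg1 gL.
have aux (e : R) : `|e| = 1 -> e * (g t - g s - g1 s * (t - s)) <= L / 2 * (t - s) ^+ 2.
  move=> e1.
  pose G := fun u => e * (g u - g1 s * u) - L / 2 * (u - s) ^+ 2.
  pose G1 := fun u => e * (g1 u - g1 s) - L * (u - s).
  have GG (u : R) : is_derive u 1 G (G1 u).
    have := gg u => ggu.
    pose q : R -> R := e *: (g - (g1 s) *: id) - (L / 2) *: ((id - cst s) ^+ 2).
    have -> : G = q by apply/funext => y; rewrite /q !fctE.
    apply: is_derive_eq; rewrite /G1 /cst /=.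
    by rewrite /GRing.scale /= !fctE; field.
  have [th [th0 th1 E]] := MVT_any s t GG.
  have : G1 (s + th * (t - s)) * (t - s) <= 0.
    rewrite /G1 (addrC s) addrK.
    have := lip s (th * (t - s) + s); rewrite addrK => l.
    have h : e * (g1 (th * (t - s) + s) - g1 s) * (t - s) <= L * `|th * (t - s)| * `|t - s|.
      apply: le_trans (ler_norm _) _; rewrite !normrM e1 mul1r ler_wpM2r//.
      by move: l; rewrite normrM.
    rewrite mulrBl subr_le0; apply: le_trans h _.
    have sq : `|t - s| * `|t - s| = (t - s) * (t - s).
      by rewrite -!expr2 real_normK ?num_real.
    by rewrite normrM (ger0_norm th0) -!mulrA sq.
  rewrite -E /G subrr expr0n /= mulr0 subr0 => h; nra.
have h1 := aux 1 (normr1 _); have h2 := aux (-1) (etrans (normrN _) (normr1 _)).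
by rewrite ler_norml; apply/andP; split; lra.
Qed.

End real_calculus.

(** * The phase function f and its derivatives *)

Section phase.
Context {R : realType}.
Implicit Types (s t x y : R).

Definition quintic x := 6 * x ^+ 5 - 15 * x ^+ 4 + 10 * x ^+ 3.
Definition quintic1 x := 30 * x ^+ 2 * (1 - x) ^+ 2.
Definition quintic2 x := 60 * x * (1 - x) * (1 - 2 * x).

(** Clamping the argument gives the derivatives on the whole line because [quintic1] and [quintic2]
    vanish at 0 and 1. *)
Definition fphase1 s := quintic1 (clamp 0 1 s).
Definition fphase2 s := quintic2 (clamp 0 1 s).

Lemma fphaseE s : fphase s = quintic (clamp 0 1 s).
Proof.
rewrite /fphase /quintic; case: (clampP ler01) => [h|h1 h2|h].
- by rewrite h; lra.
- by rewrite ltNge h1 h2.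
- by rewrite ltNge (le_trans ler01 (ltW h)) /= leNgt h /=; lra.
Qed.

Lemma clamp01_in s : 0 <= clamp 0 1 s <= 1.
Proof. by have [h1 h2] := clamp_in (@ler01 R) s; rewrite h1 h2. Qed.

Lemma norm_mul_le1 x y : `|x| <= 1 -> `|y| <= 1 -> `|x * y| <= 1.
Proof. by move=> x1 y1; rewrite normrM mulr_ile1. Qed.

(** Each remainder is (b - a)^2 times a polynomial, bounded by the absolute values of its
    coefficients. The constants are crude: they serve differentiability and an error term that tends
    to 0. *)
Lemma quintic_taylor (a b : R) : 0 <= a <= 1 -> 0 <= b <= 1 ->
  `|quintic b - quintic a - quintic1 a * (b - a)| <= 361 * (b - a) ^+ 2 /\
  `|quintic1 b - quintic1 a - quintic2 a * (b - a)| <= 1000 * (b - a) ^+ 2.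
Proof.
move=> /andP[a0 a1] /andP[b0 b1]; set h := b - a.
have -> : b = a + h by rewrite /h; ring.
have na : `|a| <= 1 by rewrite ler_norml; apply/andP; split; lra.
have nh : `|h| <= 1 by rewrite ler_norml /h; apply/andP; split; lra.
have na2 := norm_mul_le1 na na; have nah := norm_mul_le1 na nh.
have nh2 := norm_mul_le1 nh nh; have na2h := norm_mul_le1 na2 nh.
have nah2 := norm_mul_le1 nah nh; have nh3 := norm_mul_le1 nh2 nh.
have na3 := norm_mul_le1 na2 na.
have box1 (x : R) : `|x| <= 1 -> -1 <= x /\ x <= 1 by rewrite ler_norml => /andP.
have [s1 s2] := box1 _ nh2; have [s3 s4] := box1 _ na2; have [s5 s6] := box1 _ nah.
have [s7 s8] := box1 _ na2h; have [s9 t1] := box1 _ nah2; have [t2 t3] := box1 _ nh3.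
have [t4 t5] := box1 _ na3; have [t6 t7] := box1 _ nh.
split.
- have -> : quintic (a + h) - quintic a - quintic1 a * h =
    (30 * a - 90 * (a * a) + 60 * (a * a * a) + 10 * h - 60 * (a * h)
     + 60 * (a * a * h) + 30 * (a * h * h) - 15 * (h * h) + 6 * (h * h * h)) * h ^+ 2.
    by rewrite /quintic /quintic1; ring.
  rewrite normrM [`|h ^+ 2|]ger0_norm ?sqr_ge0// ler_wpM2r ?sqr_ge0// ler_norml.
  by apply/andP; split; lra.
- have -> : quintic1 (a + h) - quintic1 a - quintic2 a * h =
    (30 - 180 * a + 180 * (a * a) + 120 * (a * h) - 60 * h + 30 * (h * h)) * h ^+ 2.
    by rewrite /quintic1 /quintic2; ring.
  rewrite normrM [`|h ^+ 2|]ger0_norm ?sqr_ge0// ler_wpM2r ?sqr_ge0// ler_norml.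
  by apply/andP; split; lra.
Qed.

(** When t leaves [0, 1] through an endpoint, the distance from s to that endpoint and the clamping
    error are both at most |t - s|. The weight, which vanishes at the endpoints, supplies the first
    factor. *)
Lemma clamp01_weight s t :
  clamp 0 1 s * (1 - clamp 0 1 s) * `|clamp 0 1 t - clamp 0 1 s - (t - s)|
  <= (t - s) ^+ 2.
Proof.
have : 0 <= clamp 0 1 s * (1 - clamp 0 1 s).
  by have /andP[u1 u2] := clamp01_in s; rewrite mulr_ge0// subr_ge0.
move=> /ger0_norm nE; rewrite -[X in X * _]nE -normrM ler_norml.
have sq0 := sqr_ge0 (t - s).
case: (clampP ler01 s) => [hs|hs1 hs2|hs].
- by rewrite mul0r mul0r oppr_le0 sq0.
- have s1 : 0 <= 1 - s by lra.
  case: (clampP ler01 t) => [ht|ht1 ht2|ht].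
  + have k0 : 0 <= s * - t by rewrite mulr_ge0//; lra.
    have k1 : s * - t <= (t - s) ^+ 2 by nra.
    have k2 := mulr_ge0 s1 k0; have k3 := mulr_ge0 hs1 k0.
    by apply/andP; split; nra.
  + by rewrite subrr mulr0 oppr_le0 sq0.
  + have t1 : 0 <= t - 1 by lra.
    have k0 := mulr_ge0 s1 t1.
    have k1 : (1 - s) * (t - 1) <= (t - s) ^+ 2 by nra.
    have k2 := mulr_ge0 s1 k0; have k3 := mulr_ge0 hs1 k0.
    by apply/andP; split; nra.
- by rewrite subrr mulr0 mul0r oppr_le0 sq0.
Qed.

(** The expansion must carry t - s instead of the clamped increment; the discrepancy is of second
    order because [g1] is dominated by the weight a (1 - a). *)
Lemma clamp01_quad (g g1 : R -> R) (C K : R) : 0 <= C -> 0 <= K ->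
  (forall a b, 0 <= a <= 1 -> 0 <= b <= 1 ->
    `|g b - g a - g1 a * (b - a)| <= C * (b - a) ^+ 2) ->
  (forall a, 0 <= a <= 1 -> `|g1 a| <= K * (a * (1 - a))) ->
  forall s t, `|g (clamp 0 1 t) - g (clamp 0 1 s) - g1 (clamp 0 1 s) * (t - s)|
    <= (C + K) * (t - s) ^+ 2.
Proof.
move=> C0 K0 gC gK s t; have ia := clamp01_in s; have ib := clamp01_in t.
have h1 := gC _ _ ia ib; have h2 := gK _ ia; have w := clamp01_weight s t.
have hb : `|clamp 0 1 t - clamp 0 1 s| <= `|t - s| by exact: clamp_lip.
move: h1 h2 w hb; set a := clamp 0 1 s; set b := clamp 0 1 t => h1 h2 w hb.
have -> : g b - g a - g1 a * (t - s) =
  (g b - g a - g1 a * (b - a)) + g1 a * (b - a - (t - s)) by ring.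
apply: le_trans (ler_normD _ _) _; rewrite [leRHS]mulrDl lerD//.
  apply: le_trans h1 _; apply: ler_wpM2l => //.
  rewrite -(real_normK (num_real (b - a))) -(real_normK (num_real (t - s))).
  by rewrite ler_sqr ?nnegrE.
rewrite normrM; apply: le_trans (ler_wpM2r (normr_ge0 _) h2) _.
by rewrite -mulrA ler_wpM2l.
Qed.

Lemma fphase_quad s t : `|fphase t - fphase s - fphase1 s * (t - s)| <= (361 + 30) * (t - s) ^+ 2.
Proof.
rewrite !fphaseE; apply: clamp01_quad => [||a b ia ib|a /andP[a0 a1]]; try exact: ler0n.
  exact: (quintic_taylor ia ib).1.
have w0 : 0 <= a * (1 - a) by rewrite mulr_ge0// subr_ge0.
have -> : quintic1 a = 30 * (a * (1 - a)) * (a * (1 - a)) by rewrite /quintic1; ring.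
have w2 : 0 <= 30 * (a * (1 - a)) * (a * (1 - a)) by rewrite !mulr_ge0// subr_ge0.
by rewrite (ger0_norm w2) ler_piMr ?mulr_ge0//; nra.
Qed.

Lemma fphase1_quad s t :
  `|fphase1 t - fphase1 s - fphase2 s * (t - s)| <= 1060 * (t - s) ^+ 2.
Proof.
have -> : 1060 = 1000 + 60 :> R by ring.
apply: clamp01_quad => [||a b ia ib|a /andP[a0 a1]]; try exact: ler0n.
  exact: (quintic_taylor ia ib).2.
have w0 : 0 <= a * (1 - a) by rewrite mulr_ge0// subr_ge0.
have -> : quintic2 a = 60 * (a * (1 - a)) * (1 - 2 * a) by rewrite /quintic2; ring.
have w2 : 0 <= 60 * (a * (1 - a)) by rewrite mulr_ge0.
rewrite normrM (ger0_norm w2) ler_piMr// ler_norml.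
by apply/andP; split; lra.
Qed.

Lemma is_derive_fphase s : is_derive s 1 (@fphase R) (fphase1 s).
Proof. by apply: (@quad_is_derive _ _ _ (361 + 30)) => t _; exact: fphase_quad. Qed.

Lemma is_derive_fphase1 s : is_derive s 1 fphase1 (fphase2 s).
Proof. by apply: (@quad_is_derive _ _ _ 1060) => t _; exact: fphase1_quad. Qed.

Lemma derive1_fphase : derive1 (@fphase R) = fphase1.
Proof. exact: derive1_eq is_derive_fphase. Qed.

Lemma derive1n2_fphase : derive1n 2 (@fphase R) = fphase2.
Proof. by rewrite /derive1n /= derive1_fphase; exact: derive1_eq is_derive_fphase1. Qed.

Lemma fphase_in s : 0 <= (fphase s : R) <= 1.
Proof.
rewrite fphaseE; have /andP[h0 h1] := clamp01_in s.
rewrite /quintic; set a := clamp _ _ _ in h0 h1 *.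
have -> : 6 * a ^+ 5 - 15 * a ^+ 4 + 10 * a ^+ 3 = a ^+ 3 * (6 * a ^+ 2 - 15 * a + 10) by ring.
apply/andP; split; first by rewrite mulr_ge0 ?exprn_ge0//; nra.
(* This is 1 - f(a), obtained from the factorisation above by the symmetry f(1 - a) = 1 - f(a). *)
have : 0 <= (1 - a) ^+ 3 * (6 * a ^+ 2 + 3 * a + 1).
  by rewrite mulr_ge0 ?exprn_ge0 ?subr_ge0//; nra.
by move=> h; rewrite -subr_ge0; apply: le_trans h _; rewrite le_eqVlt; apply/orP; left; apply/eqP; ring.
Qed.

Lemma fphase1_in s : 0 <= (fphase1 s : R) <= 15 / 8.
Proof.
rewrite /fphase1; have /andP[h0 h1] := clamp01_in s.
rewrite /quintic1; set a := clamp _ _ _ in h0 h1 *.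
have -> : 30 * a ^+ 2 * (1 - a) ^+ 2 = 30 * (a * (1 - a)) ^+ 2 by ring.
have w0 : 0 <= a * (1 - a) by rewrite mulr_ge0// subr_ge0.
have w1 : a * (1 - a) <= 1 / 4 by have := sqr_ge0 (a - 1 / 2); nra.
apply/andP; split; first by rewrite mulr_ge0// sqr_ge0.
nra.
Qed.

Lemma fphase1_norm_le s : `|fphase1 s : R| <= 15 / 8.
Proof. by have /andP[f0 f1] := fphase1_in s; rewrite ger0_norm. Qed.

Lemma measurable_quintic_clamp (p : R -> R) : continuous p ->
  measurable_fun [set: R] (fun s => p (clamp 0 1 s)).
Proof.
move=> cp; apply: (measurableT_comp (continuous_measurable_fun cp)).
exact: measurable_clamp.
Qed.

End phase.

Section phase_constants.
Context {R : realType}.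
Implicit Types (s t x y : R).

Lemma measurable_fphase : measurable_fun [set: R] (@fphase R).
Proof.
have -> : @fphase R = fun s => quintic (clamp 0 1 s) by apply/funext => s; exact: fphaseE.
apply: measurable_quintic_clamp => s; rewrite /quintic.
by apply: cvgD; [apply: cvgB|]; apply: cvgM; [exact: cvg_cst|exact: exprn_continuous
  |exact: cvg_cst|exact: exprn_continuous|exact: cvg_cst|exact: exprn_continuous].
Qed.

Lemma measurable_fphase1 : measurable_fun [set: R] (@fphase1 R).
Proof.
apply: measurable_quintic_clamp => s; rewrite /quintic1.
apply: cvgM; first by apply: cvgM; [exact: cvg_cst|exact: exprn_continuous].
apply: (@continuous_comp _ _ _ (fun x => 1 - x) (fun x => x ^+ 2)).
  by apply: cvgB; [exact: cvg_cst|exact: cvg_id].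
exact: exprn_continuous.
Qed.

Lemma measurable_fphase2 : measurable_fun [set: R] (@fphase2 R).
Proof.
apply: measurable_quintic_clamp => s; rewrite /quintic2.
apply: cvgM; first apply: cvgM.
- by apply: cvgM; [exact: cvg_cst|exact: cvg_id].
- by apply: cvgB; [exact: cvg_cst|exact: cvg_id].
- by apply: cvgB; [exact: cvg_cst|apply: cvgM; [exact: cvg_cst|exact: cvg_id]].
Qed.

Lemma fphase_lip_const_ge (L : R) :
  (forall s t, `|fphase s - fphase t| <= L * `|s - t|) -> 15 / 8 <= L.
Proof.
move=> lipL; rewrite leNgt; apply/negP => L15.
(* The difference quotient centred at 1/2, where f' is maximal, is 15/8 - 5 h^2 + 6 h^4. This [h]
   makes the loss 5 h^2 at most half of 15/8 - L. *)
pose h := Num.min (1 / 2) ((15 / 8 - L) / 5).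
have h0 : 0 < h by rewrite lt_min; apply/andP; split; lra.
have h1 : h <= 1 / 2 by rewrite ge_min lexx.
have h2 : h <= (15 / 8 - L) / 5 by rewrite ge_min lexx orbT.
have fE x : -1/2 <= x -> x <= 1/2 -> fphase (1 / 2 + x) = 1 / 2 + 15 / 8 * x - 5 * x ^+ 3 + 6 * x ^+ 5.
  move=> x1 x2; rewrite /fphase ltNge (_ : 0 <= 1 / 2 + x) /=; last by lra.
  by rewrite (_ : 1 / 2 + x <= 1); [field|lra].
have := lipL (1 / 2 + h) (1 / 2 + - h); rewrite !fE; try lra.
have -> : 1 / 2 + h - (1 / 2 + - h) = 2 * h by ring.
rewrite [`|2 * h|]ger0_norm; last by lra.
move=> /(le_trans (ler_norm _)).
have h4 : 0 <= h ^+ 4 by rewrite exprn_ge0// ltW.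
have h5 : 0 <= h ^+ 5 by rewrite exprn_ge0// ltW.
have -> : 1 / 2 + 15 / 8 * h - 5 * h ^+ 3 + 6 * h ^+ 5 -
   (1 / 2 + 15 / 8 * - h - 5 * (- h) ^+ 3 + 6 * (- h) ^+ 5) =
   (15 / 8 - 5 * h ^+ 2 + 6 * h ^+ 4) * (2 * h) by field.
rewrite ler_pM2r; last by lra.
have : 5 * h ^+ 2 <= (15 / 8 - L) / 2 by nra.
by move=> *; lra.
Qed.

(** [r] is sqrt 3 and the right-hand side is max |f''| / 2. In the variable p = sqrt 3 |1 - 2 a| the
    two sides touch at p = 1, where |f''| is maximal; (p - 1)^2 factors out of their difference and
    [key] compares the cofactors. *)
Lemma phase_curvature (r : R) s : 0 < r -> r ^+ 2 = 3 ->
  2^-1 * `|fphase2 s| + 81 / 65 * (fphase1 s - 5 / 6) ^+ 2 <= 5 / 3 * r.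
Proof.
move=> r0 r3; rewrite /fphase1 /fphase2.
have /andP[a0 a1] := clamp01_in s; set a := clamp _ _ _ in a0 a1 *.
pose y := `|1 - 2 * a|.
have y0 : 0 <= y by rewrite /y.
have y1 : y <= 1 by rewrite /y ler_norml; apply/andP; split; lra.
have y2 : a * (1 - a) = (1 - y ^+ 2) / 4 by rewrite /y real_normK ?num_real//; field.
have w0 : 0 <= a * (1 - a) by rewrite mulr_ge0// subr_ge0.
have -> : `|quintic2 a| = 15 * (1 - y ^+ 2) * y.
  have -> : quintic2 a = 60 * (a * (1 - a)) * (1 - 2 * a) by rewrite /quintic2; ring.
  rewrite normrM -/y [`|60 * _|]ger0_norm; last by rewrite mulr_ge0.
  by rewrite y2; field.
have -> : quintic1 a = 15 / 8 * (1 - y ^+ 2) ^+ 2.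
  have -> : quintic1 a = 30 * (a * (1 - a)) ^+ 2 by rewrite /quintic1; ring.
  by rewrite y2; field.
pose p := r * y.
have p0 : 0 <= p by rewrite mulr_ge0// ltW.
(* Near p = 2/5, where the two cases of [key] meet, the bound m <= 8 leaves 45/13 against 2 r, so
   sqrt 3 is needed to this accuracy. *)
have r1 : 433 / 250 <= r by nra.
pose m := (1 + p) * (5 - p ^+ 2).
have key : 45 / 832 * m ^+ 2 <= 5 * r / 6 * (p + 2).
  have p3 : p <= r by rewrite /p; nra.
  have p4 : p ^+ 2 <= 3 by rewrite -r3 ler_sqr ?nnegrE// ltW.
  have m0 : 0 <= m by rewrite mulr_ge0//; lra.
  have [pl|pg] := leP p (2 / 5).
    have m5 : m <= 5 * (1 + p).
      by rewrite /m (mulrC 5) ler_wpM2l//; [lra|have := sqr_ge0 p; lra].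
    have m6 : m ^+ 2 <= (5 * (1 + p)) ^+ 2 by rewrite ler_sqr ?nnegrE//; lra.
    nra.
  have m8 : m <= 8.
    have : 0 <= (p - 1) ^+ 2 * (p + 3) by rewrite mulr_ge0 ?sqr_ge0//; lra.
    by rewrite /m => q; lra.
  have m6 : m ^+ 2 <= 8 ^+ 2 by rewrite ler_sqr ?nnegrE.
  nra.
have yp : y = r * p / 3 by rewrite /p mulrA -expr2 r3; field.
have yp2 : y ^+ 2 = p ^+ 2 / 3 by rewrite /p exprMn r3; field.
have -> : (15 / 8 * (1 - y ^+ 2) ^+ 2 - 5 / 6) ^+ 2 =
  (15 / 8) ^+ 2 * (1 / 81) * (p - 1) ^+ 2 * m ^+ 2.
  by rewrite /m yp2; field.
rewrite yp2 {1}yp.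
have -> : 2^-1 * (15 * (1 - p ^+ 2 / 3) * (r * p / 3)) =
  5 / 3 * r - (p - 1) ^+ 2 * (5 * r / 6 * (p + 2)) by field.
have := ler_wpM2l (sqr_ge0 (p - 1)) key.
by move=> q; lra.
Qed.

(** Evaluation at (1 - 1 / sqrt 3) / 2, the maximiser of f'' on [0, 1]. *)
Lemma fphase2_bound_ge (L r : R) : (forall s, `|fphase2 s| <= L) ->
  0 < r -> r ^+ 2 = 3 -> 10 / 3 * r <= L.
Proof.
move=> hL r0 r3; have r1 : r <= 2 by nra.
have := hL ((1 - r / 3) / 2); rewrite /fphase2.
have -> : clamp 0 1 ((1 - r / 3) / 2) = (1 - r / 3) / 2.
  by rewrite /clamp min_l ?max_r//; lra.
move=> /(le_trans (ler_norm _)); apply: le_trans.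
rewrite /quintic2 le_eqVlt; apply/orP; left; apply/eqP.
have -> : 60 * ((1 - r / 3) / 2) * (1 - (1 - r / 3) / 2) * (1 - 2 * ((1 - r / 3) / 2)) =
  5 * r * (1 - r ^+ 2 / 9) by field.
by rewrite r3; field.
Qed.

Lemma phase_curvature_le (L : R) s : (forall s, `|fphase2 s| <= L) ->
  2^-1 * `|fphase2 s| + 81 / 65 * (fphase1 s - 5 / 6) ^+ 2 <= L / 2.
Proof.
move=> hL; have r0 : 0 < Num.sqrt 3 :> R by rewrite sqrtr_gt0.
have r3 : Num.sqrt 3 ^+ 2 = 3 :> R by rewrite sqr_sqrtr.
have h1 := phase_curvature s r0 r3; have h2 := fphase2_bound_ge hL r0 r3.
by apply: le_trans h1 _; lra.
Qed.

End phase_constants.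

(** * The quadratically extended double well *)

Section cut_well.
Context {R : realType}.
Implicit Types (s t x y : R).

Definition well1 x := 36 * (x ^+ 2 - x) * (2 * x - 1).
Definition well2 x := 36 * (6 * x ^+ 2 - 6 * x + 1).

Lemma derive1_double_well : derive1 (@double_well R) = well1.
Proof.
apply: derive1_eq => s.
apply: (@quad_is_derive _ _ _ (18 * (6 * s ^+ 2 + 10 * `|s| + 4))) => t ts.
set h := t - s in ts *; have -> : t = s + h by rewrite /h; ring.
have -> : double_well (s + h) - double_well s - well1 s * h =
  18 * (6 * s ^+ 2 + 4 * (s * h) + h ^+ 2 - 6 * s - 2 * h + 1) * h ^+ 2.
  by rewrite /double_well /well1; ring.
rewrite normrM [`|h ^+ 2|]ger0_norm ?sqr_ge0// ler_wpM2r ?sqr_ge0//.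
rewrite normrM (ger0_norm (ler0n _ 18)) ler_wpM2l//.
have sh : `|s * h| <= `|s| by rewrite normrM ler_piMr.
have h2 : h ^+ 2 <= 1 by rewrite -real_normK ?num_real// exprn_ile1.
have h20 := sqr_ge0 h; have s20 := sqr_ge0 s.
move: ts sh; rewrite !ler_norml => /andP[t1 t2] /andP[q1 q2].
have := ler_norm s; have := ler_norm (- s); rewrite normrN => n1 n2.
by apply/andP; split; lra.
Qed.

Lemma derive1n2_double_well : derive1n 2 (@double_well R) = well2.
Proof.
rewrite /derive1n /= derive1_double_well; apply: derive1_eq => s.
apply: (@quad_is_derive _ _ _ (36 * (6 * `|s| + 5))) => t ts.
set h := t - s in ts *; have -> : t = s + h by rewrite /h; ring.
have -> : well1 (s + h) - well1 s - well2 s * h =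
  36 * (6 * s + 2 * h - 3) * h ^+ 2 by rewrite /well1 /well2; ring.
rewrite normrM [`|h ^+ 2|]ger0_norm ?sqr_ge0// ler_wpM2r ?sqr_ge0//.
rewrite normrM (ger0_norm (ler0n _ 36)) ler_wpM2l//.
move: ts; rewrite !ler_norml => /andP[t1 t2].
have := ler_norm s; have := ler_norm (- s); rewrite normrN => n1 n2.
by apply/andP; split; lra.
Qed.

Variable Mc : R.
Hypothesis Mc0 : 0 < Mc.

Let cl := clamp (- Mc) Mc.
Let MM : - Mc <= Mc. Proof. by have := Mc0 => h; lra. Qed.

(** Expanding at the clamped point covers the three regimes by one formula, since [s - cl s]
    vanishes on [-Mc, Mc]. *)
Definition Wcut1 s := well1 (cl s) + well2 (cl s) * (s - cl s).
Definition Wcut2 s := well2 (cl s).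

Lemma WcutE s : Wcut Mc s =
  double_well (cl s) + well1 (cl s) * (s - cl s) + well2 (cl s) / 2 * (s - cl s) ^+ 2.
Proof.
have M0 := Mc0; rewrite /Wcut /taylor2 derive1_double_well derive1n2_double_well.
rewrite ler_norml /cl; case: (clampP MM s) => [h|h1 h2|h].
- by rewrite (lt_geF h) /= ltNge (_ : s <= Mc)//; lra.
- by rewrite h1 h2 /= subrr expr0n /= !mulr0 !addr0.
- by rewrite (lt_geF h) andbF h.
Qed.

Let cl_bnd s : `|cl s| <= Mc.
Proof. by rewrite ler_norml; have [-> ->] := clamp_in MM s. Qed.

(** The added 1 gives K <= K^2, so every polynomial bound becomes a multiple of K or K^2. *)
Let K := 1 + Mc.
Let K1 : 1 <= K. Proof. by rewrite /K; have := Mc0 => h; lra. Qed.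

Lemma well2_bound s : `|well2 (cl s)| <= 36 * 13 * K ^+ 2.
Proof.
have M0 := Mc0; have := cl_bnd s; set a := cl s; rewrite ler_norml => /andP[a1 a2].
have a3 : a ^+ 2 <= K ^+ 2 by rewrite /K; nra.
have k2 : 1 <= K ^+ 2 by rewrite expr_ge1// (le_trans ler01 K1).
have k3 : Mc <= K ^+ 2 by rewrite /K; nra.
have a4 := sqr_ge0 a.
rewrite /well2 normrM (ger0_norm (ler0n _ 36)) -mulrA ler_wpM2l// ler_norml.
by apply/andP; split; lra.
Qed.

Lemma Wcut1_quad : exists C, forall s t,
  `|Wcut1 t - Wcut1 s - Wcut2 s * (t - s)| <= C * (t - s) ^+ 2.
Proof.
exists (36 * 13 * K + 6 * 36 * 5 * K) => s t.
have M0 := Mc0; have D := clamp_defect MM s t; have L := clamp_lip MM s t.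
rewrite /Wcut1 /Wcut2 -/cl in D L *.
have := cl_bnd s; have := cl_bnd t; move: D L.
set a := cl s; set b := cl t => D L bM aM.
have -> : well1 b + well2 b * (t - b) - (well1 a + well2 a * (s - a)) - well2 a * (t - s) =
  36 * (6 * a + 2 * (b - a) - 3) * (b - a) ^+ 2 +
  6 * 36 * (a + b - 1) * ((b - a) * (t - b)).
  by rewrite /well1 /well2; ring.
apply: le_trans (ler_normD _ _) _; rewrite [leRHS]mulrDl.
have L2 : (b - a) ^+ 2 <= (t - s) ^+ 2.
  rewrite -(real_normK (num_real (b - a))) -(real_normK (num_real (t - s))).
  by rewrite ler_sqr ?nnegrE.
move: aM bM; rewrite !ler_norml => /andP[a1 a2] /andP[b1 b2].
have k1 : `|36 * (6 * a + 2 * (b - a) - 3)| <= 36 * 13 * K.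
  by rewrite ler_norml /K; apply/andP; split; lra.
have k2 : `|6 * 36 * (a + b - 1)| <= 6 * 36 * 5 * K.
  by rewrite ler_norml /K; apply/andP; split; lra.
apply: lerD; rewrite normrM; apply: ler_pM => //.
  by rewrite ger0_norm ?sqr_ge0.
by rewrite normrM.
Qed.

(** The remainder is an exact combination of h^2, h th, (th - sg)^2, h th^2 and h sg, where h is the
    increment of the clamp and th, sg are the excesses of t and s. The clamp lemmas make each of
    them of second order in t - s. *)
Lemma Wcut_quad : exists C, forall s t,
  `|Wcut Mc t - Wcut Mc s - Wcut1 s * (t - s)| <= C * (t - s) ^+ 2.
Proof.
exists (18 * 40 * K ^+ 2 + 36 * 70 * K ^+ 2 + 36 * 13 * K ^+ 2 +
        36 * 3 * 10 * K ^+ 2 + 36 * 13 * K ^+ 2) => s t.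
have M0 := Mc0; have D := clamp_defect MM s t; have L := clamp_lip MM s t.
have D' := clamp_defect MM t s; have E := clamp_excess MM s t.
have E' := clamp_excess_lip MM s t; have w2 := well2_bound s.
have ts2 : (s - t) ^+ 2 = (t - s) ^+ 2 by ring.
rewrite {}ts2 distrC in D'.
rewrite !WcutE /Wcut1 -/cl in D D' E E' L w2 *.
have := cl_bnd s; have := cl_bnd t; move: D D' E E' L w2.
set a := cl s; set b := cl t => D D' E E' L w2 bM aM.
set h := b - a in D L; set th := t - b in D E E' *; set sg := s - a in D' E' *.
have -> : double_well b + well1 b * th + well2 b / 2 * th ^+ 2 -
   (double_well a + well1 a * sg + well2 a / 2 * sg ^+ 2) -
   (well1 a + well2 a * sg) * (t - s) =
  18 * (6 * a ^+ 2 + 4 * a * h + h ^+ 2 - 6 * a - 2 * h + 1) * h ^+ 2 +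
  36 * (6 * a ^+ 2 - 6 * a + 1 + 6 * a * h + 2 * h ^+ 2 - 3 * h) * (h * th) +
  well2 a / 2 * (th - sg) ^+ 2 +
  36 * 3 * (a + b - 1) * (h * th ^+ 2) - well2 a * (h * sg).
  by rewrite /well1 /well2 /double_well /th /sg /h; field.
have hK : `|h| <= 2 * K.
  by move: aM bM; rewrite !ler_norml /h /K => /andP[u1 u2] /andP[u3 u4]; apply/andP; split; lra.
have k1 := K1; have k0 : 0 <= K by apply: le_trans K1.
have kk : K <= K ^+ 2 by rewrite expr2 ler_peMl.
have aK : `|a| <= K by apply: le_trans aM _; rewrite /K; lra.
have bK : `|b| <= K by apply: le_trans bM _; rewrite /K; lra.
have a2 : a ^+ 2 <= K ^+ 2 by rewrite -real_normK ?num_real// ler_sqr ?nnegrE.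
have h2 : h ^+ 2 <= (2 * K) ^+ 2.
  by rewrite -real_normK ?num_real// ler_sqr ?nnegrE// mulr_ge0.
have ah : `|a * h| <= 2 * K ^+ 2.
  by rewrite normrM (_ : 2 * K ^+ 2 = K * (2 * K)) ?ler_pM//; ring.
have a20 := sqr_ge0 a; have h20 := sqr_ge0 h.
have bnd5 (x1 x2 x3 x4 x5 : R) : `|x1 + x2 + x3 + x4 - x5| <= `|x1| + `|x2| + `|x3| + `|x4| + `|x5|.
  by do 4! (apply: le_trans (ler_normD _ _) _; rewrite ?normrN lerD2r).
apply: le_trans (bnd5 _ _ _ _ _) _; rewrite !(mulrDl _ _ ((t - s) ^+ 2)).
have T0 := sqr_ge0 (t - s).
have sq_le x : `|x| <= `|t - s| -> `|x ^+ 2| <= (t - s) ^+ 2.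
  move=> xt; rewrite ger0_norm ?sqr_ge0// -real_normK ?num_real//.
  by rewrite -(real_normK (num_real (t - s))) ler_sqr ?nnegrE.
have ths : `|h * th ^+ 2| <= 2 * K * (t - s) ^+ 2.
  have [ba|thl] := E.
    by rewrite /h ba subrr mul0r normr0 mulr_ge0// mulr_ge0.
  by rewrite normrM ler_pM// sq_le.
move: aK bK hK ah; rewrite !(ler_norml a, ler_norml b, ler_norml h, ler_norml (a * h)).
move=> /andP[u1 u2] /andP[u3 u4] /andP[u5 u6] /andP[u7 u8].
have j1 : `|18 * (6 * a ^+ 2 + 4 * a * h + h ^+ 2 - 6 * a - 2 * h + 1)| <= 18 * 40 * K ^+ 2.
  by rewrite ler_norml; apply/andP; split; lra.
have j2 : `|36 * (6 * a ^+ 2 - 6 * a + 1 + 6 * a * h + 2 * h ^+ 2 - 3 * h)| <= 36 * 70 * K ^+ 2.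
  by rewrite ler_norml; apply/andP; split; lra.
have j3 : `|well2 a / 2| <= 36 * 13 * K ^+ 2.
  by rewrite normrM normfV (ger0_norm (ler0n _ 2)) ler_pdivrMr//; lra.
have j4 : `|36 * 3 * (a + b - 1)| <= 36 * 3 * (3 * K).
  by rewrite ler_norml; apply/andP; split; lra.
apply: lerD; [apply: lerD; [apply: lerD; [apply: lerD|]|]|].
- by rewrite normrM ler_pM// sq_le.
- by rewrite normrM ler_pM// normrM.
- by rewrite normrM ler_pM// sq_le.
- rewrite normrM (_ : 36 * 3 * 10 * K ^+ 2 * _ = 36 * 3 * (3 * K) * (10 / 3 * K * (t - s) ^+ 2)); last by field.
  rewrite ler_pM//; apply: le_trans ths _; rewrite ler_wpM2r// ler_wpM2r//; lra.
- by rewrite normrM ler_pM// normrM.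
Qed.

Lemma is_derive_Wcut s : is_derive s 1 (Wcut Mc) (Wcut1 s).
Proof. by have [C WC] := Wcut_quad; apply: (@quad_is_derive _ _ _ C) => t _. Qed.

Lemma is_derive_Wcut1 s : is_derive s 1 Wcut1 (Wcut2 s).
Proof. by have [C WC] := Wcut1_quad; apply: (@quad_is_derive _ _ _ C) => t _. Qed.

Lemma derive1_Wcut : derive1 (Wcut Mc) = Wcut1.
Proof. exact: derive1_eq is_derive_Wcut. Qed.

Lemma derive1n2_Wcut : derive1n 2 (Wcut Mc) = Wcut2.
Proof. by rewrite /derive1n /= derive1_Wcut; exact: derive1_eq is_derive_Wcut1. Qed.

Lemma is_derive1_measurable (g g1 : R -> R) : (forall s : R, is_derive s 1 g (g1 s)) ->
  measurable_fun [set: R] g.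
Proof.
move=> gg; apply: continuous_measurable_fun => u.
by apply: differentiable_continuous; apply/derivable1_diffP; have [] := gg u.
Qed.

Lemma measurable_Wcut : measurable_fun [set: R] (Wcut Mc).
Proof. exact: is_derive1_measurable is_derive_Wcut. Qed.

Lemma measurable_Wcut1 : measurable_fun [set: R] Wcut1.
Proof. exact: is_derive1_measurable is_derive_Wcut1. Qed.

Lemma Wcut1_growth : exists a b, forall s, `|Wcut1 s| <= a + b * `|s|.
Proof.
pose L := 36 * 13 * K ^+ 2.
have lip := lip_of_derive is_derive_Wcut1 (fun s => well2_bound s : `|Wcut2 s| <= L).
exists `|Wcut1 0|, L => s; have := lip 0 s; rewrite subr0 => h.
have := ler_normD (Wcut1 s - Wcut1 0) (Wcut1 0); rewrite subrK => h1.
by apply: le_trans h1 _; rewrite addrC lerD2l.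
Qed.

Lemma Wcut_growth : exists a b, forall s, `|Wcut Mc s| <= a + b * s ^+ 2.
Proof.
have [C WC] := Wcut_quad.
exists (`|Wcut Mc 0| + `|Wcut1 0|), (`|Wcut1 0| + C) => s; have := WC 0 s.
rewrite subr0 !ler_norml => /andP[w1 w2].
have s1 : `|Wcut1 0 * s| <= `|Wcut1 0| * (1 + s ^+ 2).
  rewrite normrM ler_wpM2l// ler_norml.
  by have := sqr_ge0 (s - 1); have := sqr_ge0 (s + 1) => u v; apply/andP; split; nra.
move: s1; rewrite ler_norml => /andP[s1 s2].
have := ler_norm (Wcut Mc 0); have := ler_norm (- Wcut Mc 0); rewrite normrN => n1 n2.
by apply/andP; split; lra.
Qed.

End cut_well.

(** * Nonlocal energy increments *)

(** Finite-difference substitute for integrating Phi'' <= c twice: [D] plays Phi', the slope of [D]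
    may exceed c by an error e(h), and the step 1/(n+1) tends to 0. *)
Lemma discrete_taylor {R : realType} (Phi D e : R -> R) (c C : R) :
  0 <= c -> (forall h, 0 <= e h) -> e (n.+1%:R^-1) @[n --> \oo] --> 0 ->
  (forall s h, 0 < h -> Phi (s + h) - Phi s - h * D s <= C * h ^+ 2) ->
  (forall s h, 0 < h -> D (s + h) - D s <= h * (c + e h)) ->
  Phi 1 - Phi 0 - D 0 <= c / 2.
Proof.
move=> c0 e0 ecvg hPhi hD.
have main n : Phi 1 - Phi 0 - D 0 <= (c + e (n.+1%:R^-1)) / 2 + C * n.+1%:R^-1.
  set h := n.+1%:R^-1; have h0 : 0 < h by rewrite /h invr_gt0.
  have ce0 : 0 <= c + e h by rewrite addr_ge0.
  have Dk k : D (k%:R * h) - D 0 <= k%:R * h * (c + e h).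
    elim: k => [|k IH]; first by rewrite !mul0r subrr.
    have := hD (k%:R * h) h h0; rewrite -natr1 mulrDl mul1r => q.
    by rewrite mulrDl; lra.
  (* The bounds on [D] add up to at most (k h)^2 / 2 times the slope; after n + 1 steps the
     remainders C h^2 add up to C h. *)
  have Pk k : Phi (k%:R * h) - Phi 0 - k%:R * h * D 0 <=
      (k%:R * h) ^+ 2 * (c + e h) / 2 + k%:R * C * h ^+ 2.
    elim: k => [|k IH]; first by rewrite !mul0r expr0n /= !mul0r subrr subr0 addr0.
    have q1 := hPhi (k%:R * h) h h0.
    have q2 := ler_wpM2l (ltW h0) (Dk k).
    have q3 : 0 <= h ^+ 2 * (c + e h) by rewrite mulr_ge0// sqr_ge0.
    have -> : k.+1%:R * h = k%:R * h + h by rewrite -natr1 mulrDl mul1r.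
    have -> : (k.+1)%:R = k%:R + 1 :> R by rewrite natr1.
    by move: q1 q2 q3 IH; set x := k%:R; set E := c + e h => q1 q2 q3 IH; lra.
  have := Pk n.+1; rewrite /h mulfV ?pnatr_eq0// -/h mul1r expr1n mul1r.
  by rewrite mulrAC expr2 mulrA mulfV ?pnatr_eq0// mul1r [h * C]mulrC.
have lim : (c + e (n.+1%:R^-1)) / 2 + C * n.+1%:R^-1 @[n --> \oo] --> (c + 0) / 2 + C * 0.
  apply: cvgD; last by apply: cvgM; [exact: cvg_cst|exact: cvg_harmonic].
  by apply: cvgM; [apply: cvgD => //; exact: cvg_cst|exact: cvg_cst].
rewrite addr0 mulr0 addr0 in lim.
by apply: (cvg_seq_le main _ lim); exact: cvg_cst.
Qed.

Section nonlocal_taylor.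
Context {R : realType} {d : nat}.
Variable X : 'I_d -> R.
Local Notation V := 'rV[R]_d.
Local Notation mu := (@leb R d).
Implicit Types (u v w g h : V -> R).

Let mD := measurable_box X.
Let muD := leb_box_lty X.
Let L2 := L2per X : set (V -> R).
Let si : @semi_inner R (V -> R) L2 (inner X) := L2per_semi X.
Local Notation ipX := (inner X).
Local Notation nrmX := (nrm (inner X)).

Lemma inner_sq_le x g : L2per X x -> L2per X g -> (forall y, `|x y| <= `|g y|) ->
  ipX x x <= ipX g g.
Proof.
move=> Lx Lg xg; have sx := L2per_sqint Lx; have sg := L2per_sqint Lg.
apply: ae_le_Rintegral => //; [exact: sqint_mul|exact: sqint_mul|apply: nearW => y _].
by rewrite -!expr2 -(real_normK (num_real (x y))) -(real_normK (num_real (g y))) ler_sqr ?nnegrE.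
Qed.

Lemma L2per_bndM (f : R -> R) (K : R) u v : measurable_fun [set: R] f ->
  (forall s, `|f s| <= K) -> L2per X u -> L2per X v ->
  L2per X (fun y => f (u y) * v y).
Proof.
move=> mf fK /L2perP[su pu] /L2perP[sv pv]; apply/L2perP; split.
  apply: (@sqint_bndM _ _ _ _ _ mD muD (f \o u) v K) => // [|y _]; last exact: fK.
  by apply: measurableT_comp => //; exact: sqint_mf su.
by move=> y i; rewrite pu pv.
Qed.

Lemma L2_fphase u : L2per X u -> L2per X (fphase \o u).
Proof.
move=> Lu; apply: L2per_comp => //; first exact: measurable_fphase.
by exists 1, 0 => s; have /andP[f0 f1] := fphase_in s; rewrite mul0r addr0 ger0_norm.
Qed.

Lemma L2_fphase1 u : L2per X u -> L2per X (fphase1 \o u).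
Proof.
move=> Lu; apply: (L2per_comp _ _ Lu); first exact: measurable_fphase1.
by exists (15 / 8), 0 => s; rewrite mul0r addr0; exact: fphase1_norm_le.
Qed.

Lemma L2_fphase1M u v : L2per X u -> L2per X v -> L2per X (fun y => fphase1 (u y) * v y).
Proof. exact: L2per_bndM (@measurable_fphase1 R) (@fphase1_norm_le R). Qed.

(** A cubic remainder |h| |dl|^3 need not be integrable for dl in L^2. Truncating the factor |h dl|
    at 1 keeps the integrand below dl^2 while it still tends to 0 pointwise. *)
Definition nonlocal_error (dl : V -> R) (h : R) : R :=
  \int[mu]_(y in box X) (Num.min (`|h| * `|dl y|) 1 * dl y ^+ 2).

Section error.
Variable dl : V -> R.
Hypothesis Ldl : L2per X dl.

Let sdl := L2per_sqint Ldl.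
Let mdl := sqint_mf sdl.

Let min_bnd (h : R) (y : V) : 0 <= Num.min (`|h| * `|dl y|) 1 <= 1.
Proof. by rewrite le_min ge_min lexx ler01 mulr_ge0//= orbT. Qed.

Let m_err (h : R) : measurable_fun [set: V] (fun y => Num.min (`|h| * `|dl y|) 1 * dl y ^+ 2).
Proof.
apply: measurable_funM; last exact: measurable_funX.
apply: measurable_minr => //; apply: measurable_funM => //.
exact: measurableT_comp.
Qed.

Lemma intg_error (h : R) : intg mu (box X) (fun y => Num.min (`|h| * `|dl y|) 1 * dl y ^+ 2).
Proof.
apply: (le_intg mD (m_err h) _ (sqint_sq sdl)) => y _.
have /andP[m0 m1] := min_bnd h y.
by rewrite (ger0_norm (mulr_ge0 m0 (sqr_ge0 _))) ler_piMl ?sqr_ge0.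
Qed.

Lemma nonlocal_error_ge0 (h : R) : 0 <= nonlocal_error dl h.
Proof.
apply: Rintegral_ge0 => y _; have /andP[m0 _] := min_bnd h y.
by rewrite mulr_ge0 ?sqr_ge0.
Qed.

Lemma nonlocal_error_cvg : nonlocal_error dl n.+1%:R^-1 @[n --> \oo] --> 0.
Proof.
apply: (@dct0 _ _ _ mu (box X) mD
  (fun n y => Num.min (`|n.+1%:R^-1| * `|dl y|) 1 * dl y ^+ 2) (fun y => dl y ^+ 2)).
- exact: sqint_sq sdl.
- by move=> n; exact: m_err.
- move=> n y _; have /andP[m0 m1] := min_bnd (n.+1%:R^-1) y.
  by rewrite (ger0_norm (mulr_ge0 m0 (sqr_ge0 _))) ler_piMl ?sqr_ge0.
- move=> y _; apply: (@cvg_le_dist _ _ (fun n => n.+1%:R^-1 * (`|dl y| * dl y ^+ 2))) => [n|].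
    have /andP[m0 m1] := min_bnd (n.+1%:R^-1) y.
    rewrite subr0 (ger0_norm (mulr_ge0 m0 (sqr_ge0 _))) [leRHS]mulrA ler_wpM2r ?sqr_ge0//.
    by rewrite ge_min [`|n.+1%:R^-1|]ger0_norm ?invr_ge0// lexx.
  rewrite -[X in _ --> X](mul0r (`|dl y| * dl y ^+ 2)).
  by apply: cvgM; [exact: cvg_harmonic|exact: cvg_cst].
Qed.

End error.

(** * Second-order expansion for an abstract nonlocal form *)

Section form.
Variables (a : (V -> R) -> (V -> R) -> R) (N : R).
Hypotheses (sa : semi_inner L2 a) (N0 : 0 <= N).
Hypothesis a_le : forall x, L2per X x -> a x x <= N * ipX x x.
Hypothesis a_addc : forall g (c : R) h, L2per X g -> L2per X h ->
  a (fun y => g y + c) h = a g h.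
Hypothesis a_bound : forall g (c : R) h, 0 <= c -> L2per X g -> L2per X h ->
  (forall y, `|g y| <= c) -> a g h <= N * c * \int[mu]_(y in box X) `|h y|.

Lemma form_cs x y : L2per X x -> L2per X y -> a x y <= N * (nrmX x * nrmX y).
Proof.
move=> Lx Ly; have sq z : L2per X z -> nrm a z <= Num.sqrt N * nrmX z.
  move=> Lz; rewrite /nrm -sqrtrM// ler_wsqrtr//; exact: a_le.
apply: le_trans (ler_norm _) _; apply: le_trans (nrm_cs sa Lx Ly) _.
have -> : N * (nrmX x * nrmX y) = (Num.sqrt N * nrmX x) * (Num.sqrt N * nrmX y).
  by rewrite -{1}(sqr_sqrtr N0); ring.
by apply: ler_pM; rewrite ?nrm_ge0// sq.
Qed.

(* [phi - 1/2] takes values in [-1/2, 1/2] and [a] does not see constants. *)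
Lemma form_fphase u h : L2per X u -> L2per X h ->
  a (fphase \o u) h <= N / 2 * \int[mu]_(y in box X) `|h y|.
Proof.
move=> Lu Lh; have Lf := L2_fphase Lu.
rewrite -(a_addc (- 2^-1) Lf Lh).
apply: (a_bound (c := 2^-1)); rewrite ?invr_ge0//; first exact: (L2per_addc _ Lf).
move=> y; have /andP[f0 f1] := fphase_in (u y).
by rewrite ler_norml; apply/andP; split; rewrite /=; lra.
Qed.

(* With [L = 15/8] and [F = 5/6], the defect is a square:
   [L^2 a(w,w) + L^2/(L^2 - F^2) a(z - F w, z - F w) - a(z,z)]
   is [a(F z - L^2 w, F z - L^2 w) / (L^2 - F^2)]. *)
Lemma form_split z w : L2per X z -> L2per X w ->
  a z z <= (15 / 8) ^+ 2 * a w w + 81 / 65 * a (z - (5 / 6) *: w) (z - (5 / 6) *: w).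
Proof.
move=> Lz Lw; set F : R := 5 / 6; set L : R := (15 / 8) ^+ 2.
have LFw := si_memZ si F Lw; have LLw := si_memZ si L Lw; have LFz := si_memZ si F Lz.
have := si_ge0 sa (si_memB si LFz LLw).
rewrite (si_sqB sa LFz LLw) (si_sqB sa Lz LFw) !(si_sqZ sa _ Lz, si_sqZ sa _ Lw).
rewrite (si_Zl sa F Lz LLw) (si_Zr sa L Lw Lz) (si_Zr sa F Lw Lz).
by rewrite /F /L => q; lra.
Qed.

Variable L_f : R.
Hypothesis hLf : forall s : R, `|fphase2 s| <= L_f.
Variables u dl : V -> R.
Hypotheses (Lu : L2per X u) (Ldl : L2per X dl).

Let L_f0 : 0 <= L_f. Proof. exact: le_trans (normr_ge0 _) (hLf 0). Qed.

Definition segment (t : R) : V -> R := t *: dl + u.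
Definition seg_phase (t : R) : V -> R := fphase \o segment t.
Definition seg_der (t : R) : V -> R := fun y => fphase1 (segment t y) * dl y.

Lemma L2_segment t : L2per X (segment t).
Proof. exact: (si_mem si). Qed.

Lemma L2_seg_phase t : L2per X (seg_phase t).
Proof. exact: L2_fphase (L2_segment t). Qed.

Lemma L2_seg_der t : L2per X (seg_der t).
Proof.
exact: L2_fphase1M (L2_segment t) Ldl.
Qed.

Let segE (s h : R) y : segment (s + h) y - segment s y = h * dl y.
Proof. by rewrite /segment !fctE /GRing.scale /=; ring. Qed.

Lemma seg_phase_lip (s h : R) y : `|seg_phase (s + h) y - seg_phase s y| <= 15 / 8 * `|h| * `|dl y|.
Proof.
have := lip_of_derive is_derive_fphase (@fphase1_norm_le R) (segment s y) (segment (s + h) y).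
by rewrite segE normrM mulrA.
Qed.

Lemma seg_phase_taylor (s h : R) y :
  `|seg_phase (s + h) y - seg_phase s y - h * seg_der s y| <= L_f / 2 * (h ^+ 2 * dl y ^+ 2).
Proof.
have := taylor_bound is_derive_fphase is_derive_fphase1 hLf (segment s y) (segment (s + h) y).
by rewrite segE exprMn /seg_der (mulrCA h).
Qed.

Let rest (s h : R) : V -> R := seg_phase (s + h) - seg_phase s - h *: seg_der s.

Let Lrest (s h : R) : L2per X (rest s h).
Proof.
apply: (si_memB si); last exact: (si_memZ si _ (L2_seg_der s)).
by apply: (si_memB si); exact: L2_seg_phase.
Qed.

Let sdl := L2per_sqint Ldl.

(** With p, q the phases at s + h and s, the left side is a(q, p - q - h z) + a(p - q, p - q) / 2;
    Taylor bounds the first term and the Lipschitz constant 15/8 the second. This constant only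
    plays [C] in [discrete_taylor], where it disappears. *)
Lemma form_Phi (s h : R) : 0 < h ->
  2^-1 * a (seg_phase (s + h)) (seg_phase (s + h)) - 2^-1 * a (seg_phase s) (seg_phase s)
  - h * a (seg_phase s) (seg_der s) <=
  (N / 2 * (L_f / 2) + N / 2 * (15 / 8) ^+ 2) * ipX dl dl * h ^+ 2.
Proof.
move=> h0; set p := seg_phase (s + h); set q := seg_phase s; set z := seg_der s.
have Lp : L2per X p := L2_seg_phase _; have Lq : L2per X q := L2_seg_phase _.
have Lz : L2per X z := L2_seg_der _; have Lpq := si_memB si Lp Lq.
have Lhz := si_memZ si h Lz; have Lr : L2per X (p - q - h *: z) := Lrest s h.
have -> : 2^-1 * a p p - 2^-1 * a q q - h * a q z =
  a q (p - q - h *: z) + 2^-1 * a (p - q) (p - q).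
  rewrite (si_Br sa Lpq Lhz Lq) (si_Br sa Lp Lq Lq) (si_Zr sa _ Lz Lq).
  by rewrite (si_sqB sa Lp Lq) (si_sym sa Lp Lq); field.
have i1 : \int[mu]_(y in box X) `|(p - q - h *: z) y| <= L_f / 2 * h ^+ 2 * ipX dl dl.
  rewrite -RintegralZl//; last exact: (sqint_mul mD sdl sdl).
  apply: ae_le_Rintegral => //.
  - exact: (sqint_intg mD muD (sqint_abs (L2per_sqint Lr))).
  - by apply: intgZ => //; exact: sqint_mul.
  - by apply: nearW => y _; rewrite -mulrA -expr2; exact: seg_phase_taylor.
have i2 : ipX (p - q) (p - q) <= (15 / 8 * h) ^+ 2 * ipX dl dl.
  rewrite -(si_sqZ si _ Ldl); apply: (inner_sq_le Lpq (si_memZ si _ Ldl)) => y.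
  rewrite [leRHS]normrM [`|15 / 8 * h|]normrM (@ger0_norm _ (15 / 8))//.
  exact: seg_phase_lip.
have := form_fphase (L2_segment s) Lr; rewrite -/q => i3.
have i4 := ler_wpM2l (divr_ge0 N0 (ler0n _ 2)) i1.
have i5 := a_le Lpq; have i6 := ler_wpM2l N0 i2.
apply: le_trans (lerD i3 (ler_wpM2l _ i5)) _; first by rewrite invr_ge0.
by move: i4 i6; set I := \int[mu]_(y in _) _; lra.
Qed.

Let E := nonlocal_error dl.
Let curvature : R := L_f / 2 * ipX dl dl.
Let err (h : R) : R := N / 2 * (1060 + L_f) * E h + N * ((L_f + 4) * Num.sqrt (E h) * (15 / 8 * nrmX dl)).

Let intg_phase2 s : intg mu (box X) (fun y => `|fphase2 (segment s y)| * dl y ^+ 2).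
Proof.
have mf2 : measurable_fun [set: R] (@fphase2 R) by exact: measurable_fphase2.
apply: (le_intg mD _ _ (intgZ mD L_f (sqint_sq sdl))) => [|y _].
  apply: measurable_funM; last exact: measurable_funX (sqint_mf sdl).
  apply: measurableT_comp => //; apply: measurableT_comp => //.
  exact: sqint_mf (L2per_sqint (L2_segment s)).
by rewrite (ger0_norm (mulr_ge0 (normr_ge0 _) (sqr_ge0 _))) ler_wpM2r ?sqr_ge0.
Qed.

(** First-order bound on the increment of f'(u + t dl) dl in L^1, with leading coefficient exactly
    |f''|. *)
Lemma int_seg_der_diff s (h : R) : 0 < h ->
  \int[mu]_(y in box X) `|(seg_der (s + h) - seg_der s) y| <=
  h * \int[mu]_(y in box X) (`|fphase2 (segment s y)| * dl y ^+ 2) + h * (1060 + L_f) * E h.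
Proof.
move=> h0; have Lw := si_memB si (L2_seg_der (s + h)) (L2_seg_der s).
rewrite -RintegralZl//; last exact: intg_phase2.
rewrite -RintegralZl//; last exact: intg_error.
rewrite -RintegralD//; last 2 first.
- exact: (intgZ mD h (intg_phase2 s)).
- exact: (intgZ mD _ (intg_error Ldl h)).
apply: ae_le_Rintegral => //.
- exact: (sqint_intg mD muD (sqint_abs (L2per_sqint Lw))).
- by apply: intgD => //; [exact: intgZ (intg_phase2 s)|exact: intgZ (intg_error Ldl h)].
apply: nearW => y _; rewrite (gtr0_norm h0).
rewrite (_ : (seg_der (s + h) - seg_der s) y =
  (fphase1 (segment (s + h) y) - fphase1 (segment s y)) * dl y); last first.
  by rewrite /seg_der !fctE mulrBl.
have := fphase1_quad (segment s y) (segment (s + h) y).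
have := lip_of_derive is_derive_fphase1 hLf (segment s y) (segment (s + h) y).
rewrite !segE [`|h * dl y|]normrM (gtr0_norm h0).
rewrite [`|_ * dl y|]normrM.
move: (fphase1 _ - fphase1 _) (fphase2 (segment s y)) => D1 f2.
set k := Num.min _ _.
have -> : dl y ^+ 2 = `|dl y| ^+ 2 by rewrite real_normK ?num_real.
have n0 := normr_ge0 (dl y); have f20 := normr_ge0 f2.
have -> : (h * dl y) ^+ 2 = h ^+ 2 * `|dl y| ^+ 2 by rewrite exprMn real_normK ?num_real.
move=> lip quad.
have lf := L_f0; have hn : 0 <= h * `|dl y| by rewrite mulr_ge0// ltW.
have -> : h * (`|f2| * `|dl y| ^+ 2) + h * (1060 + L_f) * (k * `|dl y| ^+ 2) =
  (h * `|dl y| * `|f2| + (1060 + L_f) * (k * (h * `|dl y|))) * `|dl y| by ring.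
rewrite ler_wpM2r//.
(* Small increments use the quadratic remainder of f', with constant 1060; large ones, where the
   truncated factor is 1, use that f' is [L_f]-Lipschitz. *)
have [k1|k1] := leP (h * `|dl y|) 1.
  have -> : k = h * `|dl y| by rewrite /k min_l.
  have := ler_norm (D1 - f2 * (h * dl y)) => q1.
  have := ler_norm (- (D1 - f2 * (h * dl y))); rewrite normrN => q2.
  have q3 : `|D1| <= `|f2 * (h * dl y)| + `|D1 - f2 * (h * dl y)|.
    by apply: le_trans (ler_normD _ _); rewrite addrC subrK.
  have q4 : `|f2 * (h * dl y)| = h * `|dl y| * `|f2|.
    by rewrite !normrM (gtr0_norm h0) mulrC.
  apply: le_trans q3 _; rewrite q4 lerD2l; apply: le_trans quad _.
  by rewrite -exprMn -expr2 ler_wpM2r ?sqr_ge0// lerDl.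
have -> : k = 1 by rewrite /k min_r// ltW.
rewrite mul1r; apply: le_trans lip _.
rewrite ler_wpDl//; first by rewrite mulr_ge0.
by apply: ler_wpM2r => //; rewrite lerDr ler0n.
Qed.

(** Pointwise the remainder is at most (L_f + 4) h |dl| k with k = min(h |dl|, 1): by Taylor for
    small increments, by two Lipschitz bounds for large ones. Squaring and k^2 <= k leave the
    integrand of the error, hence the square root. *)
Lemma nrm_rest s (h : R) : 0 < h ->
  nrmX (seg_phase (s + h) - seg_phase s - h *: seg_der s) <= h * ((L_f + 4) * Num.sqrt (E h)).
Proof.
move=> h0; have Lr := Lrest s h; have lf := L_f0.
have E0 : 0 <= E h := nonlocal_error_ge0 dl h.
rewrite -ler_sqr ?nnegrE ?nrm_ge0//; last first.
  by rewrite !mulr_ge0 ?sqrtr_ge0// ?addr_ge0// ltW.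
rewrite (nrmE si Lr) !exprMn sqr_sqrtr// mulrA -RintegralZl//; last exact: intg_error.
have sr := L2per_sqint Lr.
apply: ae_le_Rintegral => //; first exact: sqint_mul.
  exact: intgZ (intg_error Ldl h).
apply: nearW => y _; rewrite -expr2 (gtr0_norm h0).
set k := Num.min _ _; set r := _ y.
have r1 : `|r| <= 15 / 4 * (h * `|dl y|).
  have -> : r = (seg_phase (s + h) y - seg_phase s y) - h * seg_der s y by [].
  apply: le_trans (ler_normB _ _) _; have := seg_phase_lip s h y.
  rewrite (gtr0_norm h0) /seg_der normrM [`|fphase1 _ * _|]normrM (gtr0_norm h0) => q.
  have := ler_wpM2r (mulr_ge0 (ltW h0) (normr_ge0 (dl y))) (fphase1_norm_le (segment s y)).
  by move: q; set w := `|fphase1 _|; lra.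
have r2 : `|r| <= L_f / 2 * (h * `|dl y|) ^+ 2.
  by rewrite exprMn real_normK ?num_real//; exact: seg_phase_taylor.
have k0 : 0 <= k by rewrite /k le_min ler01 mulr_ge0// ltW.
have hn : 0 <= h * `|dl y| by rewrite mulr_ge0// ltW.
have rk : `|r| <= (L_f + 4) * (h * `|dl y|) * k.
  have [k1|k1] := leP (h * `|dl y|) 1.
    have -> : k = h * `|dl y| by rewrite /k min_l.
    by apply: le_trans r2 _; rewrite -[leRHS]mulrA -expr2 ler_wpM2r ?sqr_ge0//; lra.
  have -> : k = 1 by rewrite /k min_r// ltW.
  by rewrite mulr1; apply: le_trans r1 _; rewrite ler_wpM2r//; lra.
have k1 : k <= 1 by rewrite /k ge_min lexx orbT.
rewrite -real_normK ?num_real//.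
have : `|r| ^+ 2 <= ((L_f + 4) * (h * `|dl y|) * k) ^+ 2.
  have g0 : 0 <= (L_f + 4) * (h * `|dl y|) * k by apply: mulr_ge0 => //; apply: mulr_ge0 => //; lra.
  by rewrite ler_sqr ?nnegrE.
move=> /le_trans; apply.
have -> : dl y ^+ 2 = `|dl y| ^+ 2 by rewrite real_normK ?num_real.
have -> : ((L_f + 4) * (h * `|dl y|) * k) ^+ 2 =
  h ^+ 2 * (L_f + 4) ^+ 2 * (k * k * `|dl y| ^+ 2) by ring.
apply: ler_wpM2l; first by rewrite mulr_ge0// sqr_ge0.
by apply: ler_wpM2r; rewrite ?sqr_ge0// ler_piMr.
Qed.

(** Once [a] is bounded by N times the L^2 product, both terms are integrals with the same factor N,
    and the scalar inequality [phase_curvature_le] applies pointwise. *)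
Lemma form_curvature s : N / 2 * \int[mu]_(y in box X) (`|fphase2 (segment s y)| * dl y ^+ 2) +
  81 / 65 * a (seg_der s - (5 / 6) *: dl) (seg_der s - (5 / 6) *: dl) <= N * curvature.
Proof.
have Lx := si_memB si (L2_seg_der s) (si_memZ si (5 / 6) Ldl).
have sx := L2per_sqint Lx.
have h1 : a (seg_der s - (5 / 6) *: dl) (seg_der s - (5 / 6) *: dl) <=
  N * ipX (seg_der s - (5 / 6) *: dl) (seg_der s - (5 / 6) *: dl) := a_le Lx.
have h2 : 2^-1 * \int[mu]_(y in box X) (`|fphase2 (segment s y)| * dl y ^+ 2) +
  81 / 65 * ipX (seg_der s - (5 / 6) *: dl) (seg_der s - (5 / 6) *: dl) <= curvature.
  rewrite -RintegralZl//; last exact: intg_phase2.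
  rewrite -RintegralZl//; last exact: sqint_mul.
  rewrite /curvature -RintegralZl//; last exact: (sqint_mul mD sdl sdl).
  rewrite -RintegralD//; last 2 first.
  - exact: (intgZ mD _ (intg_phase2 s)).
  - exact: (intgZ mD _ (sqint_mul mD sx sx)).
  apply: ae_le_Rintegral => //.
  - by apply: intgD => //; [exact: intgZ (intg_phase2 s)|apply: intgZ => //; exact: sqint_mul].
  - by apply: intgZ => //; exact: sqint_mul.
  apply: nearW => y _.
  have := phase_curvature_le (segment s y) hLf => q.
  have := ler_wpM2r (sqr_ge0 (dl y)) q.
  have -> : (seg_der s - (5 / 6) *: dl) y = (fphase1 (segment s y) - 5 / 6) * dl y.
    by rewrite /seg_der !fctE /GRing.scale /= mulrBl.
  by move: `|_| (fphase1 _) => f2 f1; lra.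
have := ler_wpM2l N0 h2; move: h1; set I := \int[mu]_(y in _) _.
by move: (a _ _) (ipX (seg_der s - _) _) => x1 x2; lra.
Qed.

(** The increment of a(p, z) splits into a(p', z' - z), which carries f'', the main quadratic term h
    a(z, z), and the pairing of the Taylor remainder with z, which goes into the error. *)
Lemma form_D s (h : R) : 0 < h ->
  a (seg_phase (s + h)) (seg_der (s + h)) - a (seg_phase s) (seg_der s) <=
  h * (N * curvature + (15 / 8) ^+ 2 * a dl dl + err h).
Proof.
move=> h0; have Lp := L2_seg_phase (s + h); have Lq := L2_seg_phase s.
have Lz := L2_seg_der s; have Lz' := L2_seg_der (s + h); have Lpq := si_memB si Lp Lq.
have Lhz := si_memZ si h Lz; have Lr := Lrest s h; have Lw := si_memB si Lz' Lz.
have -> : a (seg_phase (s + h)) (seg_der (s + h)) - a (seg_phase s) (seg_der s) =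
  a (seg_phase (s + h)) (seg_der (s + h) - seg_der s) + h * a (seg_der s) (seg_der s) +
  a (seg_phase (s + h) - seg_phase s - h *: seg_der s) (seg_der s).
  rewrite (si_Br sa Lz' Lz Lp) (si_Bl sa Lpq Lhz Lz) (si_Bl sa Lp Lq Lz) (si_Zl sa _ Lz Lz).
  by ring.
have i1 := form_fphase (L2_segment (s + h)) Lw.
have i2 := ler_wpM2l (divr_ge0 N0 (ler0n _ 2)) (int_seg_der_diff s h0).
have i3 := ler_wpM2l (ltW h0) (form_split Lz Ldl).
have i4 := ler_wpM2l (ltW h0) (form_curvature s).
have i5 := form_cs Lr Lz.
have i6 : nrmX (seg_phase (s + h) - seg_phase s - h *: seg_der s) * nrmX (seg_der s) <=
  h * ((L_f + 4) * Num.sqrt (E h)) * (15 / 8 * nrmX dl).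
  apply: ler_pM; rewrite ?nrm_ge0//; first exact: nrm_rest.
  rewrite -(@ger0_norm _ (15 / 8))// -(nrmZ si _ Ldl) /nrm ler_wsqrtr//.
  apply: (inner_sq_le Lz (si_memZ si _ Ldl)) => y.
  rewrite /seg_der [leRHS]normrM normrM ler_wpM2r// (@ger0_norm _ (15 / 8))//.
  exact: fphase1_norm_le.
have i7 := le_trans i5 (ler_wpM2l N0 i6).
apply: le_trans (lerD (lerD (le_trans i1 i2) i3) i7) _.
move: i4; rewrite /err; set I := \int[mu]_(y in _) _.
set x1 := a _ _; set x2 := a dl dl; set x3 := Num.sqrt _; set x4 := nrmX _; set x5 := E h.
by move=> i4; lra.
Qed.

Lemma nonlocal_taylor :
  2^-1 * a (fphase \o (dl + u)) (fphase \o (dl + u)) - 2^-1 * a (fphase \o u) (fphase \o u)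
  - a (fphase \o u) (fun y => fphase1 (u y) * dl y) <=
  (N * (L_f / 2 * ipX dl dl) + (15 / 8) ^+ 2 * a dl dl) / 2.
Proof.
pose Phi t := 2^-1 * a (seg_phase t) (seg_phase t).
pose D t := a (seg_phase t) (seg_der t).
have s1 : segment 1 = dl + u by rewrite /segment scale1r.
have s0 : segment 0 = u by rewrite /segment scale0r add0r.
have := @discrete_taylor R Phi D err (N * curvature + (15 / 8) ^+ 2 * a dl dl).
move=> /(_ ((N / 2 * (L_f / 2) + N / 2 * (15 / 8) ^+ 2) * ipX dl dl)).
rewrite /Phi /D /seg_phase /seg_der s1 s0; apply.
- have lf := L_f0; rewrite addr_ge0// mulr_ge0 ?sqr_ge0//.
    by rewrite mulr_ge0 ?divr_ge0// (si_ge0 si Ldl).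
  exact: (si_ge0 sa).
- move=> h; have lf := L_f0; have E0 := nonlocal_error_ge0 dl h.
  have q (K : R) : 0 <= K -> 0 <= K + L_f by move=> ?; exact: addr_ge0.
  apply: addr_ge0.
    apply: mulr_ge0 E0; apply: mulr_ge0; last exact: q (ler0n _ _).
    exact: divr_ge0 N0 (ler0n _ _).
  apply: mulr_ge0 N0 _; apply: mulr_ge0; apply: mulr_ge0; rewrite ?nrm_ge0 ?sqrtr_ge0//.
  by rewrite addrC; exact: q (ler0n _ _).
- have Ec := nonlocal_error_cvg Ldl.
  have sEc : Num.sqrt (E n.+1%:R^-1) @[n --> \oo] --> 0.
    by rewrite -[X in _ --> X]sqrtr0; apply: continuous_cvg => //; exact: sqrt_continuous.
  rewrite -[X in _ --> X](addr0 0); apply: cvgD.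
    by rewrite -[X in _ --> X](mulr0 (N / 2 * (1060 + L_f))); apply: cvgM => //; exact: cvg_cst.
  rewrite -[X in _ --> X](mulr0 N); apply: cvgM; first exact: cvg_cst.
  rewrite -[X in _ --> X](mul0r (15 / 8 * nrmX dl)); apply: cvgM; last exact: cvg_cst.
  by rewrite -[X in _ --> X](mulr0 (L_f + 4)); apply: cvgM => //; exact: cvg_cst.
- by move=> s h h0; exact: form_Phi.
- by move=> s h h0; exact: form_D.
Qed.

End form.

End nonlocal_taylor.

(** * Energy decay *)

Section energy_decay.
Context {R : realType} {d : nat}.
Variable X : 'I_d -> R.
Hypothesis X0 : forall i, 0 < X i.
Local Notation V := 'rV[R]_d.
Local Notation mu := (@leb R d).
Implicit Types (u v w g h : V -> R).

Let mD := measurable_box X.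
Let muD := leb_box_lty X.
Let L2 := L2per X : set (V -> R).
Let si : @semi_inner R (V -> R) L2 (inner X) := L2per_semi X.
Local Notation ipX := (inner X).

Definition invlap_form g h : R := inner X (invlap X g) h.

Lemma invlap_form_semi : semi_inner L2 invlap_form.
Proof. exact: sym_op_form si _ (invlap_sym X0) (invlap_ge0 X0). Qed.

Lemma invlap_form_addc g (c : R) h : L2per X g -> L2per X h ->
  invlap_form (fun y => g y + c) h = invlap_form g h.
Proof. exact: invlap_addc X0 g c h. Qed.

Lemma invlap_form_addc2 g (c : R) : L2per X g ->
  invlap_form (fun y => g y + c) (fun y => g y + c) = invlap_form g g.
Proof.
move=> Lg; have Lgc := L2per_addc c Lg.
rewrite (invlap_form_addc c Lg Lgc) (si_sym invlap_form_semi Lg Lgc).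
exact: invlap_form_addc.
Qed.

Lemma invlap_Linf_norm_ge0 : (0 <= invlap_Linf_norm X)%E.
Proof.
pose z : V -> R := fun=> 0%R.
have n1 : (Linf_norm X z <= 1)%E.
  by apply/Linf_norm_le => //; apply: nearW => y _; rewrite normr0.
apply: (@le_trans _ _ (Linf_norm X (invlap X z))); first exact: Lnorm_ge0.
apply: ereal_sup_ubound; exists z => //.
split; last exact: n1.
split; [exact: measurable_cst|by []|].
by apply: (le_lt_trans n1); rewrite ltry.
Qed.

Lemma dirichlet_polar (g h : 'I_d -> V -> R) : (forall i, L2per X (g i)) ->
  (forall i, L2per X (h i)) ->
  2 * dirichlet X g h <= dirichlet X g g + dirichlet X h h.
Proof.
move=> Lg Lh; rewrite /dirichlet -big_split /= mulr_sumr; apply: ler_sum => i _.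
have := si_ge0 si (si_memB si (Lg i) (Lh i)).
by rewrite (si_sqB si (Lg i) (Lh i)); lra.
Qed.

Lemma volume_defect_bound (omega : R) u : L2per X u -> 0 < omega < 1 ->
  `|volume_defect X omega u| <= vol X * Num.max omega (1 - omega).
Proof.
move=> Lu /andP[w0 w1]; have sf := L2per_sqint (L2_fphase Lu).
have v0 : 0 <= vol X by exact: ltW (vol_gt0 X0).
have i0 : 0 <= \int[mu]_(x in box X) fphase (u x).
  by apply: Rintegral_ge0 => y _; have /andP[] := fphase_in (u y).
have i1 : \int[mu]_(x in box X) fphase (u x) <= vol X.
  rewrite -[leRHS]mul1r -[leRHS](Rintegral_cst _ mD 1).
  apply: ae_le_Rintegral => //; first exact: (sqint_intg mD muD sf).
    exact: intg_cst.
  by apply: nearW => y _; have /andP[] := fphase_in (u y).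
rewrite /volume_defect; move: i0 i1; set I := \int[mu]_(y in _) _ => i0 i1.
have m1 : omega <= Num.max omega (1 - omega) by rewrite le_max lexx.
have m2 : 1 - omega <= Num.max omega (1 - omega) by rewrite le_max lexx orbT.
have := ler_wpM2l v0 m1; have := ler_wpM2l v0 m2.
by rewrite ler_norml => q1 q2; apply/andP; split; lra.
Qed.

Lemma norm_Rintegral_le (g G : V -> R) : intg mu (box X) g -> intg mu (box X) G ->
  (forall y, `|g y| <= G y) ->
  `|\int[mu]_(y in box X) g y| <= \int[mu]_(y in box X) G y.
Proof.
move=> ig iG gG; rewrite ler_norml; apply/andP; split; last first.
  by apply: ae_le_Rintegral => //; apply: nearW => y _; exact: le_trans (ler_norm _) (gG y).
rewrite -mulN1r -RintegralZl//; apply: ae_le_Rintegral => //; first exact: intgZ.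
by apply: nearW => y _; have := gG y; rewrite mulN1r ler_norml => /andP[].
Qed.

Lemma Rintegral_taylor (g g1 g2 : R -> R) (L : R) u v :
  (forall s : R, is_derive s 1 g (g1 s)) -> (forall s : R, is_derive s 1 g1 (g2 s)) ->
  (forall s, `|g2 s| <= L) -> L2per X u -> L2per X v ->
  intg mu (box X) (g \o u) -> intg mu (box X) (g \o v) -> L2per X (g1 \o u) ->
  `|\int[mu]_(y in box X) g (v y) - \int[mu]_(y in box X) g (u y) - ipX (g1 \o u) (v - u)|
     <= L / 2 * ipX (v - u) (v - u).
Proof.
move=> dg dg1 gL Lu Lv iu iv Lg; have Ld := si_memB si Lv Lu.
have sd := L2per_sqint Ld; have sg := L2per_sqint Lg.
rewrite -RintegralB// -RintegralB//; last 2 first.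
- exact: (intgB mD iv iu).
- exact: (sqint_mul mD sg sd).
rewrite -RintegralZl//; last exact: (sqint_mul mD sd sd).
apply: norm_Rintegral_le.
- by apply: (intgB mD _ (sqint_mul mD sg sd)); exact: (intgB mD iv iu).
- exact: (intgZ mD _ (sqint_mul mD sd sd)).
- by move=> y; rewrite -expr2; exact: taylor_bound dg dg1 gL (u y) (v y).
Qed.

Lemma volume_defect_taylor (omega L_f : R) u v : (forall s : R, `|fphase2 s| <= L_f) ->
  L2per X u -> L2per X v ->
  `|volume_defect X omega v - volume_defect X omega u - ipX (fphase1 \o u) (v - u)|
     <= L_f / 2 * ipX (v - u) (v - u).
Proof.
move=> hL Lu Lv; rewrite /volume_defect.
have -> (x y z : R) : x - z - (y - z) = x - y by ring.
apply: (Rintegral_taylor is_derive_fphase is_derive_fphase1 hL Lu Lv).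
- exact: (sqint_intg mD muD (L2per_sqint (L2_fphase Lu))).
- exact: (sqint_intg mD muD (L2per_sqint (L2_fphase Lv))).
- exact: L2_fphase1.
Qed.

(** Cauchy-Schwarz against the constant 1, which produces the factor [vol X]. *)
Lemma volume_defect_lip (omega L_p : R) u v :
  (forall s t : R, `|fphase s - fphase t| <= L_p * `|s - t|) -> L2per X u -> L2per X v ->
  (volume_defect X omega v - volume_defect X omega u) ^+ 2
     <= L_p ^+ 2 * vol X * ipX (v - u) (v - u).
Proof.
move=> hL Lu Lv; rewrite /volume_defect.
have -> (x y z : R) : x - z - (y - z) = x - y by ring.
have Lfu := L2_fphase Lu; have Lfv := L2_fphase Lv; have Ld := si_memB si Lv Lu.
have Lf := si_memB si Lfv Lfu; have L1 := L2per_cst X 1.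
have v0 : 0 <= vol X by exact: ltW (vol_gt0 X0).
have -> : \int[mu]_(x in box X) fphase (v x) - \int[mu]_(x in box X) fphase (u x) =
    ipX ((fphase \o v) - (fphase \o u)) (fun=> 1).
  rewrite (si_Bl si Lfv Lfu L1); congr (_ - _); apply: eq_Rintegral => y _;
  by rewrite mulr1.
apply: le_trans (si_cauchy_schwarz si Lf L1) _.
have -> : ipX (fun=> 1) (fun=> 1) = vol X.
  by rewrite /inner -[RHS]mul1r -[RHS](Rintegral_cst _ mD 1); apply: eq_Rintegral => y _; rewrite mul1r.
rewrite [leRHS]mulrAC ler_wpM2r// -(si_sqZ si _ Ld).
apply: (inner_sq_le Lf (si_memZ si _ Ld)) => y.
rewrite [leRHS]normrM; apply: le_trans (hL _ _) _; apply: ler_wpM2r => //.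
exact: ler_norm.
Qed.

Section well.
Variable Mcut : R.
Hypothesis Mcut0 : 0 < Mcut.

Lemma intg_Wcut u : L2per X u -> intg mu (box X) (Wcut Mcut \o u).
Proof.
move=> Lu; have su := L2per_sqint Lu; have [a [b Wab]] := Wcut_growth Mcut0.
apply: (le_intg mD (g := fun y => a + b * u y ^+ 2)) => [|y _|].
- apply: measurableT_comp; [exact: measurable_Wcut|exact: sqint_mf su].
- exact: Wab.
- by apply: intgD => //; [exact: intg_cst|apply: intgZ => //; exact: sqint_sq su].
Qed.

Lemma L2_Wcut1 u : L2per X u -> L2per X (Wcut1 Mcut \o u).
Proof.
move=> Lu; apply: (L2per_comp _ _ Lu); first exact: measurable_Wcut1.
exact: Wcut1_growth.
Qed.

(** In the nonlocal term the square root is traded for the form of A, and omega drops out because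
    this form does not see constants. *)
Lemma energyE (eps gamma M omega : R) u : H1per X u ->
  energy X eps gamma M omega Mcut u =
  eps / 2 * dirichlet X (grad X u) (grad X u) +
  eps^-1 * \int[mu]_(y in box X) Wcut Mcut (u y) +
  gamma / 2 * invlap_form (fphase \o u) (fphase \o u) +
  M / 2 * volume_defect X omega u ^+ 2.
Proof.
move=> Hu; have Lu := H1per_L2per Hu; have [_ Lg _] := is_grad_grad Hu.
have Lf := L2_fphase Lu.
have sgi i := L2per_sqint (Lg i).
have ig : intg mu (box X) (fun x => \sum_(i < d) grad X u i x * grad X u i x).
  by apply: intg_sum => // i; exact: (sqint_mul mD (sgi i) (sgi i)).
have ie := intgZ mD (eps / 2) ig; have iW := intgZ mD eps^-1 (intg_Wcut Lu).
rewrite /energy; congr (_ + _ + _).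
- rewrite -(Rintegral_dirichlet Lg Lg) -RintegralZl// -RintegralZl//; last exact: intg_Wcut.
  by rewrite -RintegralD//; apply: eq_Rintegral.
- congr (_ * _); rewrite (invlap_half_energy X0 (L2per_subc omega Lf)).
  exact: (invlap_form_addc2 (- omega) Lf).
Qed.

End well.

Lemma grad_sub_ge0 u v : H1per X u -> H1per X v ->
  2 * dirichlet X (grad X v) (grad X u) <=
  dirichlet X (grad X v) (grad X v) + dirichlet X (grad X u) (grad X u).
Proof.
move=> /is_grad_grad[_ Lu _] /is_grad_grad[_ Lv _].
exact: dirichlet_polar.
Qed.

(** The terms of the scheme are abstract functions here, so that pairing an almost everywhere
    identity with [z] is pure linearity. *)
Lemma step_tested (u v w gV gU gF Wu fu : V -> R) (tau c2 c3 c4 c5 c6 c7 c8 c9 : R) :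
  L2per X u -> L2per X v -> L2per X w -> L2per X gV -> L2per X gU -> L2per X gF ->
  L2per X Wu -> L2per X fu ->
  {ae mu, forall y, box X y -> (v y - u y) / tau =
    c2 * w y - c3 * v y - c4 * gV y + c5 * (c6 * u y - Wu y)
    + c7 * (c8 * gU y - gF y) - c9 * fu y} ->
  forall z, L2per X z -> tau^-1 * ipX (v - u) z =
    c2 * ipX w z - c3 * ipX v z - c4 * ipX gV z + c5 * (c6 * ipX u z - ipX Wu z)
    + c7 * (c8 * ipX gU z - ipX gF z) - c9 * ipX fu z.
Proof.
move=> Lu Lv Lw LV LU LF LW Lf ae z Lz.
have Z c x (Lx : L2per X x) : L2per X (c *: x) := si_memZ si c Lx.
have Ld := si_memB si Lv Lu.
have L1 := si_memB si (Z c2 _ Lw) (Z c3 _ Lv).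
have L2' := si_memB si L1 (Z c4 _ LV).
have L3 := si_memB si (Z c6 _ Lu) LW.
have L4 := si_memD si L2' (Z c5 _ L3).
have L5 := si_memB si (Z c8 _ LU) LF.
have L6 := si_memD si L4 (Z c7 _ L5).
have L7 := si_memB si L6 (Z c9 _ Lf).
rewrite -(si_Zl si _ Ld Lz).
rewrite -(si_Zl si c2 Lw Lz) -(si_Zl si c3 Lv Lz) -(si_Bl si (Z c2 _ Lw) (Z c3 _ Lv) Lz).
rewrite -(si_Zl si c4 LV Lz) -(si_Bl si L1 (Z c4 _ LV) Lz).
rewrite -(si_Zl si c6 Lu Lz) -(si_Bl si (Z c6 _ Lu) LW Lz) -(si_Zl si c5 L3 Lz).
rewrite -(si_Dl si L2' (Z c5 _ L3) Lz).
rewrite -(si_Zl si c8 LU Lz) -(si_Bl si (Z c8 _ LU) LF Lz) -(si_Zl si c7 L5 Lz).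
rewrite -(si_Dl si L4 (Z c7 _ L5) Lz) -(si_Zl si c9 Lf Lz) -(si_Bl si L6 (Z c9 _ Lf) Lz).
have mf x (Lx : L2per X x) := sqint_mf (L2per_sqint Lx).
apply: (ae_eq_inn mD (mf _ (Z tau^-1 _ Ld)) (mf _ L7) (mf _ Lz) (mf _ Lz)).
  by apply: (ae_mono ae) => y h By; rewrite !fctE /GRing.scale /= mulrC h.
by apply: nearW => y.
Qed.

(** The scheme tested with v - u. Implicit and explicit stabilising terms combine into squares of v
    - u, and the Laplacian tested with v and u yields the Dirichlet terms on the right. *)
Lemma step_identity (eps gamma M omega Mcut tau kappa beta : R) u v :
  0 < Mcut -> eps != 0 -> H1per X u ->
  scheme_step X eps gamma M omega Mcut tau kappa beta u v ->
  H1per X v /\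
  (tau^-1 + kappa / eps) * ipX (v - u) (v - u) + gamma * beta * invlap_form (v - u) (v - u)
  + eps^-1 * ipX (Wcut1 Mcut \o u) (v - u)
  + gamma * invlap_form (fphase \o u) (fun y => fphase1 (u y) * (v - u) y)
  + M * volume_defect X omega u * ipX (fphase1 \o u) (v - u)
  = eps * (dirichlet X (grad X v) (grad X u) - dirichlet X (grad X v) (grad X v)).
Proof.
move=> Mcut0 e0 Hu [w lapw stp]; have [Hv Lw _] := lapw; split=> //.
have Lu := H1per_L2per Hu; have Lv := H1per_L2per Hv; have Ld := si_memB si Lv Lu.
have Lfu := L2_fphase Lu.
have LV := invlap_L2per X0 (L2per_subc omega Lv).
have LU := invlap_L2per X0 (L2per_subc omega Lu).
have LF := invlap_L2per X0 (L2per_subc omega Lfu).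
have Lf1F := L2_fphase1M Lu LF.
have Lf1d := L2_fphase1M Lu Ld.
have Lf1 := L2_fphase1 Lu.
have LW := L2_Wcut1 Mcut0 Lu.
have sa := invlap_form_semi.
have aV : ipX (invlap X (fun y => v y - omega)) (v - u) = invlap_form v (v - u).
  exact: (invlap_form_addc (- omega) Lv Ld).
have aU : ipX (invlap X (fun y => u y - omega)) (v - u) = invlap_form u (v - u).
  exact: (invlap_form_addc (- omega) Lu Ld).
have aF : ipX (fun y => fphase1 (u y) * invlap X (fun y => fphase (u y) - omega) y) (v - u) =
    invlap_form (fphase \o u) (fun y => fphase1 (u y) * (v - u) y).
  rewrite -(invlap_form_addc (- omega) Lfu Lf1d) /invlap_form /inner.
  by apply: eq_Rintegral => y _; rewrite mulrCA mulrA.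
have h1 := laplacian_test lapw Hv; have h2 := laplacian_test lapw Hu.
rewrite h1 h2.
have T : tau^-1 * ipX (v - u) (v - u) = eps * ipX w (v - u) - kappa / eps * ipX v (v - u)
    - gamma * beta * invlap_form v (v - u)
    + eps^-1 * (kappa * ipX u (v - u) - ipX (Wcut1 Mcut \o u) (v - u))
    + gamma * (beta * invlap_form u (v - u)
      - invlap_form (fphase \o u) (fun y => fphase1 (u y) * (v - u) y))
    - M * volume_defect X omega u * ipX (fphase1 \o u) (v - u).
  rewrite -aV -aU -aF.
  apply: (step_tested Lu Lv Lw LV LU Lf1F LW Lf1 _ Ld).
  rewrite derive1_fphase (derive1_Wcut Mcut0) in stp.
  apply: (ae_mono stp) => y h By; rewrite (h By).
  by rewrite [invlap _ _ _ * fphase1 _]mulrC.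
have p1 : ipX (v - u) (v - u) = ipX v (v - u) - ipX u (v - u) := si_Bl si Lv Lu Ld.
have p2 := si_Bl sa Lv Lu Ld.
rewrite (si_Br si Lv Lu Lw) in T.
rewrite mulrDl T p1 p2.
move: (volume_defect X omega u) (ipX (fphase1 \o u) (v - u)) => x1 x2.
move: (ipX (Wcut1 Mcut \o u) (v - u)) (ipX w v) (ipX w u) => x3 x4 x5.
move: (invlap_form (fphase \o u) _) (invlap_form v (v - u)) => x6 x7.
move: (invlap_form u (v - u)) (ipX v (v - u)) (ipX u (v - u)) => x8 x9 y1.
by ring.
Qed.

(** If ||A||_oo were infinite, its positive coefficient would make the left side infinite, against a
    real [kappa]; hence a real bound [N] exists. *)
Lemma stabilisation_bound (eps gamma M omega L_W L_f L_p kappa : R) :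
  0 < eps -> 0 < gamma -> 0 < L_f -> 0 < omega < 1 ->
  ((L_W / 2)%:E + eps%:E *
     ((gamma * L_f / 2)%:E * invlap_Linf_norm X
        * (Num.max omega (1 - omega))%:E
      + (M / 2 * vol X *
           (L_p ^+ 2 + L_f * Num.max omega (1 - omega)))%:E)
     <= kappa%:E)%E ->
  exists N : R, [/\ 0 <= N, (invlap_Linf_norm X <= N%:E)%E &
    L_W / 2 + eps * (gamma * L_f / 2 * N * Num.max omega (1 - omega)
      + M / 2 * vol X * (L_p ^+ 2 + L_f * Num.max omega (1 - omega))) <= kappa].
Proof.
move=> e0 g0 f0 /andP[w0 w1]; have := invlap_Linf_norm_ge0.
set mx := Num.max omega (1 - omega); have mx0 : 0 < mx by rewrite lt_max w0.
case: (invlap_Linf_norm X) => [N||] //= N0 hk.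
  by exists N; rewrite lexx; split => //; rewrite -lee_fin.
exfalso; move: hk.
have c0 : 0 < gamma * L_f / 2 by rewrite divr_gt0// mulr_gt0.
by rewrite gt0_muley ?lte_fin// gt0_mulye ?lte_fin// addye// gt0_muley ?lte_fin// addey// leye_eq.
Qed.

End energy_decay.

(** Links the factor 1/2 coming from |f - 1/2| <= 1/2 with the maximum present in the condition on
    kappa. *)
Lemma max_compl_ge (R : realFieldType) (x : R) : 1 / 2 <= Num.max x (1 - x).
Proof. by rewrite le_max; apply/orP; case: (lerP (1 / 2) x) => h; [left|right; lra]. Qed.

(** With dl = v - u: [q] is |dl|^2, [b] is <A dl, dl>, and [w], [s], [f] are the first variations of
    the well, nonlocal and volume terms. The share of kappa absorbs all multiples of q, that of beta
    the multiple of b. *)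
Lemma energy_balance (R : realType)
  (eps gamma M ti kappa beta L_W L_f L_p K mx vl q b w s f Du Dv gvu gvv guu Wu Wv pu pv : R) :
  0 < eps -> 0 < gamma -> 0 < M -> 0 <= ti -> 0 < L_f -> 15 / 8 <= L_p -> 0 <= K ->
  1 / 2 <= mx -> 0 <= vl -> 0 <= q -> 0 <= b ->
  (ti + kappa / eps) * q + gamma * beta * b + eps^-1 * w + gamma * s + M * Du * f =
    eps * (gvu - gvv) ->
  2^-1 * pv - 2^-1 * pu - s <= (K * (L_f / 2 * q) + (15 / 8) ^+ 2 * b) / 2 ->
  `|Wv - Wu - w| <= L_W / 2 * q ->
  `|Dv - Du - f| <= L_f / 2 * q ->
  (Dv - Du) ^+ 2 <= L_p ^+ 2 * vl * q ->
  `|Du| <= vl * mx ->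
  2 * gvu <= gvv + guu ->
  L_W / 2 + eps * (gamma * L_f / 2 * K * mx + M / 2 * vl * (L_p ^+ 2 + L_f * mx)) <= kappa ->
  L_p ^+ 2 / 2 <= beta ->
  eps / 2 * gvv + eps^-1 * Wv + gamma / 2 * pv + M / 2 * Dv ^+ 2 <=
  eps / 2 * guu + eps^-1 * Wu + gamma / 2 * pu + M / 2 * Du ^+ 2.
Proof.
move=> e0 g0 M0 ti0 f0 p0 K0 mx0 vl0 q0 b0 id nl wl vt vd vb gs hk hb.
have ie0 : 0 < eps^-1 by rewrite invr_gt0.
have eie : eps * eps^-1 = 1 by rewrite mulfV// gt_eqF.
move: id ie0 eie; set ie := eps^-1 => id ie0 eie.
have h1 : ie * (Wv - Wu - w) <= ie * (L_W / 2 * q).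
  by apply: ler_wpM2l; [exact: ltW|exact: le_trans (ler_norm _) wl].
have h2 := ler_wpM2l (ltW g0) nl.
(* From Dv^2 - Du^2 = 2 Du (Dv - Du) + (Dv - Du)^2: this handles the cross term beyond first order,
   [h4] the square. *)
have h3 : M * (Du * (Dv - Du - f)) <= M * (vl * mx * (L_f / 2 * q)).
  apply: ler_wpM2l; first exact: ltW. apply: le_trans (ler_norm _) _.
  by rewrite normrM ler_pM.
have h4 := ler_wpM2l (ltW M0) vd.
have h5 := ler_wpM2r q0 (ler_wpM2l (ltW ie0) hk).
have h5' : ie * (L_W / 2 + eps * (gamma * L_f / 2 * K * mx + M / 2 * vl * (L_p ^+ 2 + L_f * mx))) * q
   = ie * (L_W / 2) * q + (gamma * L_f / 2 * K * mx + M / 2 * vl * (L_p ^+ 2 + L_f * mx)) * q.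
  by rewrite mulrDr (mulrA ie eps) (mulrC ie eps) eie mul1r mulrDl.
rewrite {}h5' in h5.
have p2 : (15 / 8) ^+ 2 <= L_p ^+ 2 by rewrite ler_sqr ?nnegrE//; lra.
have h6 : gamma * ((15 / 8) ^+ 2 / 2) * b <= gamma * beta * b.
  by apply: ler_wpM2r => //; apply: ler_wpM2l; [exact: ltW|lra].
have h7 : gamma * L_f * K * q * (1 / 2) <= gamma * L_f * K * q * mx.
  by apply: ler_wpM2l => //; rewrite !mulr_ge0// ltW.
have h8 : 0 <= ti * q by rewrite mulr_ge0.
have h9 := ler_wpM2l (ltW e0) gs.
by lra.
Qed.

Theorem theorem2p1 (R : realType) (d : nat) (hd : d = 2%N \/ d = 3%N)
  (X : 'I_d -> R) (hX : forall i, 0 < X i)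
  (eps gamma M omega T Mcut : R)
  (heps : 0 < eps) (hgamma : 0 < gamma) (hM : 0 < M)
  (homega : 0 < omega < 1) (hT : 0 < T) (hMcut : 0 < Mcut)
  (N : nat) (hN : (1 <= N)%N) (tau : R) (htau : tau = T / N%:R)
  (L_W L_f L_p : R)
  (hL_W : forall s, `|derive1n 2 (Wcut Mcut) s| <= L_W)
  (hL_f : forall s, `|derive1n 2 fphase s| <= L_f)
  (hL_p : forall s t, `|fphase s - fphase t| <= L_p * `|s - t|)
  (kappa beta : R)
  (phi : nat -> 'rV[R]_d -> R)
  (hphi0 : H1per X (phi 0%N))
  (hphi : forall n, (n < N)%N ->
    scheme_step X eps gamma M omega Mcut tau kappa beta (phi n) (phi n.+1))
  (hkappa : ((L_W / 2)%:E + eps%:E *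
     ((gamma * L_f / 2)%:E * invlap_Linf_norm X
        * (Num.max omega (1 - omega))%:E
      + (M / 2 * vol X *
           (L_p ^+ 2 + L_f * Num.max omega (1 - omega)))%:E)
     <= kappa%:E)%E)
  (hbeta : L_p ^+ 2 / 2 <= beta) :
  forall n, (n < N)%N ->
    energy X eps gamma M omega Mcut (phi n.+1)
    <= energy X eps gamma M omega Mcut (phi n).
Proof.
move=> n nN.
(* Only the initial datum is assumed in [H1per]; each later step inherits it from the existence of
   its weak Laplacian. *)
have H1 k : (k <= N)%N -> H1per X (phi k).
  by case: k => [//|k kN]; have [w [Hv _ _] _] := hphi k kN.
have Hu := H1 _ (ltnW nN); have Hv := H1 _ nN; have stp := hphi n nN.
move: (phi n) (phi n.+1) Hu Hv stp => u v Hu Hv stp {phi hphi0 hphi H1}.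
have tau0 : 0 <= tau^-1 by rewrite invr_ge0 htau divr_ge0// ltW.
rewrite derive1n2_fphase in hL_f; rewrite (derive1n2_Wcut hMcut) in hL_W.
have r0 : 0 < Num.sqrt 3 :> R by rewrite sqrtr_gt0.
have r3 : Num.sqrt 3 ^+ 2 = 3 :> R by rewrite sqr_sqrtr.
(* Positivity of [L_f] and 15/8 <= [L_p] follow from the explicit f, although both are merely given
   as bounds. *)
have Lf0 : 0 < L_f by apply: lt_le_trans (fphase2_bound_ge hL_f r0 r3); rewrite mulr_gt0.
have Lp0 := fphase_lip_const_ge hL_p.
have [K [K0 KP {}hkappa]] := stabilisation_bound hX heps hgamma Lf0 homega hkappa.
have Lu := H1per_L2per Hu; have Lv := H1per_L2per Hv.
have Ld := si_memB (L2per_semi X) Lv Lu.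
have [_ id] := step_identity hX hMcut (lt0r_neq0 heps) Hu stp.
have sa := invlap_form_semi hX.
have a_bound g (c : R) h : 0 <= c -> L2per X g -> L2per X h -> (forall y, `|g y| <= c) ->
    invlap_form X g h <= K * c * \int[leb d]_(y in box X) `|h y|.
  move=> c0 Lg Lh gc; apply: (ae_bound_ip (invlap_L2per hX Lg) Lh).
  by apply: (invlap_bound hX K0 KP c0 Lg); apply: nearW => y _.
have nl := nonlocal_taylor sa K0 (fun x Lx => invlap_quad hX K0 KP Lx)
  (fun g c h Lg Lh => invlap_form_addc hX c Lg Lh) a_bound hL_f Lu Ld.
rewrite subrK in nl.
have wl := Rintegral_taylor (is_derive_Wcut hMcut) (is_derive_Wcut1 hMcut) hL_W Lu Lv
  (intg_Wcut hMcut Lu) (intg_Wcut hMcut Lv) (L2_Wcut1 hMcut Lu).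
have vt := volume_defect_taylor omega hL_f Lu Lv.
have vl := volume_defect_lip hX omega hL_p Lu Lv.
have vb := volume_defect_bound hX Lu homega.
have gs := grad_sub_ge0 Hu Hv.
rewrite (energyE hX hMcut _ _ _ _ Hu) (energyE hX hMcut _ _ _ _ Hv).
have q0 := si_ge0 (L2per_semi X) Ld; have b0 := si_ge0 sa Ld.
have v0 := vol_gt0 hX.
have mx2 := max_compl_ge omega.
exact: (energy_balance heps hgamma hM tau0 Lf0 Lp0 K0 mx2 (ltW v0) q0 b0 id nl wl vt vl vb gs
  hkappa hbeta).
Qed.
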